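(* Let $\Omega'(A),\Omega(A)$ be strongly bicovariant exterior algebras (with differentials $d'_A$, $d_A$) on a coquasitriangular Hopf algebra $(A,\mathcal R)$. Then $\Omega(A\bowtie_{\mathcal R}A):=\Omega'(A)\bowtie_{\mathcal R}\Omega(A)$ is a strongly bicovariant exterior algebra on $A\bowtie_{\mathcal R}A$ with differential $$d(\omega\otimes\eta)=d'_A\omega\otimes\eta+(-1)^{|\omega|}\omega\otimes d_A\eta$$ for $\omega\in\Omega'(A)$, $\eta\in\Omega(A)$. Moreover, the right action of $A\bowtie_{\mathcal R}A$ on $A$ by $a\triangleleft(b\otimes c)=\mathcal R(a_{(2)},b)(Sc_{(1)})a_{(1)}c_{(2)}$ for all $a,b,c\in A$ is differentiable, extending to an action of $\Omega(A\bowtie_{\mathcal R}A)$ on $\Omega(A)$ by $$\tau\triangleleft(\omega\otimes\eta)=\begin{cases}(-1)^{|\eta_{(1)}||\tau|}\mathcal R(\tau_{(2)},\omega)(S\eta_{(1)})\tau_{(1)}\eta_{(2)}&\text{if }\omega\in A\\0&\text{if }\omega\text{ has degree}\ge1\end{cases}$$ for $\tau\in\Omega(A)$. Here only the part of $\Delta_*\tau$ in $\Omega(A)\otimes A$ contributes.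
   Context: Work over a field $k$. A coquasitriangular Hopf algebra is a Hopf algebra $A$ with a convolution-invertible $\mathcal R:A\otimes A\to k$ such that $\mathcal R(ab,c)=\mathcal R(a,c_{(1)})\mathcal R(b,c_{(2)})$, $\mathcal R(a,bc)=\mathcal R(a_{(1)},c)\mathcal R(a_{(2)},b)$, $a_{(1)}b_{(1)}\mathcal R(b_{(2)},a_{(2)})=\mathcal R(b_{(1)},a_{(1)})b_{(2)}a_{(2)}$. An exterior algebra on $A$ is a DGA $\Omega(A)=\oplus_{n\ge0}\Omega^n(A)$ with $\Omega^0=A$, generated by $A$ and $\Omega^1=\mathrm{span}\{a\,db\}$, $d^2=0$, graded Leibniz rule. $\underline\otimes$ is the super tensor product, $(a\otimes b)(c\otimes d)=(-1)^{|b||c|}ac\otimes bd$. $\Omega(A)$ is strongly bicovariant if it is a super-Hopf algebra (grade = form degree mod 2) with $\Delta_*$ preserving total degree, restricting to $\Delta$, and $\Delta_*d=(d\otimes\mathrm{id}+(-1)^{|\ |}\mathrm{id}\otimes d)\Delta_*$. $A\bowtie_{\mathcal R}A$ is $A\otimes A$ with tensor product coalgebra and product $(a\otimes b)(c\otimes d)=\mathcal R(Sb_{(1)},c_{(1)})\,ac_{(2)}\otimes b_{(2)}d\,\mathcal R(b_{(3)},c_{(3)})$. $\mathcal R$ is extended by zero when an argument has degree $\ge1$, and $\Omega'(A)\bowtie_{\mathcal R}\Omega(A)$ is $\Omega'(A)\otimes\Omega(A)$ with $$(\omega\otimes\eta)(\tau\otimes\xi)=(-1)^{|\eta||\tau|}\mathcal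 R(S\eta_{(1)},\tau_{(1)})\,\omega\tau_{(2)}\otimes\eta_{(2)}\xi\,\mathcal R(\eta_{(3)},\tau_{(3)}),$$ $$\Delta_*(\omega\otimes\eta)=(-1)^{|\eta_{(1)}||\omega_{(2)}|}\omega_{(1)}\otimes\eta_{(1)}\otimes\omega_{(2)}\otimes\eta_{(2)}.$$ Differentiable action: for $K$ a bialgebra or Hopf algebra with $\Omega(K)$ strongly bicovariant, and an exterior algebra $\Omega(B)$ that is a right $K$-module algebra, the action is differentiable if it extends to a degree-preserving $\triangleleft:\Omega(B)\underline\otimes\Omega(K)\to\Omega(B)$ making $\Omega(B)$ a super $\Omega(K)$-module algebra, $(vw)\triangleleft a=(-1)^{|w||a_{(1)}|}(v\triangleleft a_{(1)})(w\triangleleft a_{(2)})$, with $d_B(\eta\triangleleft\omega)=(d_B\eta)\triangleleft\omega+(-1)^{|\eta|}\eta\triangleleft d_K\omega$. *)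

(* Defs.v *)
From HB Require Import structures.
From mathcomp Require Import all_boot all_order all_algebra.
From mathcomp Require Import boolp classical_sets functions cardinality fsbigop.

Set Implicit Arguments.
Unset Strict Implicit.
Unset Printing Implicit Defensive.

Import GRing.Theory.
Local Open Scope quotient_scope.
Local Open Scope classical_set_scope.
Local Open Scope ring_scope.

Reserved Notation "x \ox y" (at level 40, left associativity).
Reserved Notation "\tsum_ ( x , y <- t ) E"
  (at level 41, x name, y name, t at level 200, E at level 41,
   format "\tsum_ ( x ,  y  <-  t ) '/  '  E").

(** * Tensor product of two vector spaces

    [tensor V W] is the set of formal finite sums of pairs, modulo the smallest
    congruence making addition commutative and pairs bilinear. *)

Section TensorProduct.
Context (k : fieldType) (V W : lmodType k).

Inductive tensor_rel : seq (V * W) -> seq (V * W) -> Prop :=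
| tensor_refl s : tensor_rel s s
| tensor_sym s t : tensor_rel s t -> tensor_rel t s
| tensor_trans s t u : tensor_rel s t -> tensor_rel t u -> tensor_rel s u
| tensor_cat s s' t t' :
    tensor_rel s s' -> tensor_rel t t' -> tensor_rel (s ++ t) (s' ++ t')
| tensor_comm s t : tensor_rel (s ++ t) (t ++ s)
| tensor_zero w : tensor_rel [:: (0, w)] [::]
| tensor_addl v v' w : tensor_rel [:: (v + v', w)] [:: (v, w); (v', w)]
| tensor_addr v w w' : tensor_rel [:: (v, w + w')] [:: (v, w); (v, w')]
| tensor_scale a v w : tensor_rel [:: (a *: v, w)] [:: (v, a *: w)].

Definition tensor_relb : rel (seq (V * W)) := fun s t => `[< tensor_rel s t >].

Lemma tensor_relb_refl : reflexive tensor_relb.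
Proof. by move=> s; apply/asboolP; exact: tensor_refl. Qed.

Lemma tensor_relb_sym : symmetric tensor_relb.
Proof. by move=> s t; apply/asboolP/asboolP => h; exact: tensor_sym. Qed.

Lemma tensor_relb_trans : transitive tensor_relb.
Proof.
by move=> t s u /asboolP h /asboolP h'; apply/asboolP; apply: tensor_trans h h'.
Qed.

Canonical tensor_equiv :=
  EquivRel tensor_relb tensor_relb_refl tensor_relb_sym tensor_relb_trans.

Definition tensor := {eq_quot tensor_equiv}.

HB.instance Definition _ := Choice.on tensor.
HB.instance Definition _ := EqQuotient.on tensor.

Lemma tensor_piE s t : tensor_rel s t <-> \pi_tensor s = \pi_tensor t.
Proof.
split=> [h|]; first by apply/eqmodP; apply/asboolP.
by move/eqmodP/asboolP.
Qed.

Lemma tensor_reprP s : tensor_rel (repr (\pi_tensor s)) s.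
Proof. by apply/tensor_piE; rewrite reprK. Qed.

Definition tensor_map_scale (a : k) (s : seq (V * W)) : seq (V * W) :=
  [seq (a *: p.1, p.2) | p <- s].

Lemma tensor_rel_scale a s t :
  tensor_rel s t -> tensor_rel (tensor_map_scale a s) (tensor_map_scale a t).
Proof.
elim=> [*|*|*|*|*|w|v v' w|v w w'|b v w]; rewrite /tensor_map_scale /=.
- exact: tensor_refl.
- exact: tensor_sym.
- by apply: tensor_trans; eassumption.
- by rewrite !map_cat; exact: tensor_cat.
- by rewrite !map_cat; exact: tensor_comm.
- by rewrite scaler0; exact: tensor_zero.
- by rewrite scalerDr; exact: tensor_addl.
- exact: tensor_addr.
- by rewrite scalerA mulrC -scalerA; exact: tensor_scale.
Qed.

Definition tensor_add (x y : tensor) : tensor := \pi_tensor (repr x ++ repr y).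
Definition tensor_scl (a : k) (x : tensor) : tensor :=
  \pi_tensor (tensor_map_scale a (repr x)).
Definition tensor_opp (x : tensor) : tensor := tensor_scl (-1) x.
Definition tensor0 : tensor := \pi_tensor [::].

Lemma tensor_add_pi s t :
  tensor_add (\pi_tensor s) (\pi_tensor t) = \pi_tensor (s ++ t).
Proof. by apply/tensor_piE; apply: tensor_cat; exact: tensor_reprP. Qed.

Lemma tensor_scl_pi a s :
  tensor_scl a (\pi_tensor s) = \pi_tensor (tensor_map_scale a s).
Proof. by apply/tensor_piE; apply: tensor_rel_scale; exact: tensor_reprP. Qed.

Lemma tensor_ind_pi (P : tensor -> Prop) :
  (forall s, P (\pi_tensor s)) -> forall x, P x.
Proof. by move=> h x; rewrite -[x]reprK. Qed.

Lemma tensor_addA : associative tensor_add.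
Proof.
elim/tensor_ind_pi=> s; elim/tensor_ind_pi=> t; elim/tensor_ind_pi=> u.
by rewrite !tensor_add_pi catA.
Qed.

Lemma tensor_addC : commutative tensor_add.
Proof.
elim/tensor_ind_pi=> s; elim/tensor_ind_pi=> t.
by rewrite !tensor_add_pi; apply/tensor_piE; exact: tensor_comm.
Qed.

Lemma tensor_add0 : left_id tensor0 tensor_add.
Proof. by elim/tensor_ind_pi=> s; rewrite tensor_add_pi. Qed.

Lemma tensor_rel_scaleDl a b s :
  tensor_rel (tensor_map_scale (a + b) s)
             (tensor_map_scale a s ++ tensor_map_scale b s).
Proof.
elim: s => [|[v w] s IH] /=; first exact: tensor_refl.
rewrite -cat1s.
apply: tensor_trans (tensor_cat (tensor_refl _) IH) _.
rewrite scalerDl.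
apply: tensor_trans (tensor_cat (tensor_addl _ _ _) (tensor_refl _)) _.
rewrite -/(cat [:: (a *: v, w)] [:: (b *: v, w)]).
rewrite -[X in tensor_rel _ X]/([:: (a *: v, w)] ++ _).
rewrite -[X in tensor_rel X _]/([:: (a *: v, w)] ++ _).
apply: tensor_cat; first exact: tensor_refl.
rewrite -[X in tensor_rel _ (_ ++ X)]cat1s -[X in tensor_rel X _]cat1s !catA.
by apply: tensor_cat (tensor_refl _); exact: tensor_comm.
Qed.

Lemma tensor_rel_scale0 s : tensor_rel (tensor_map_scale 0 s) [::].
Proof.
elim: s => [|[v w] s IH] /=; first exact: tensor_refl.
by rewrite scale0r -cat1s -[X in tensor_rel _ X]cats0;
  apply: tensor_cat IH; exact: tensor_zero.
Qed.

Lemma tensor_scl1 : left_id 1 tensor_scl.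
Proof.
elim/tensor_ind_pi=> s; rewrite tensor_scl_pi; congr \pi_tensor.
by elim: s => //= -[v w] s ->; rewrite scale1r.
Qed.

Lemma tensor_sclA a b x : tensor_scl a (tensor_scl b x) = tensor_scl (a * b) x.
Proof.
elim/tensor_ind_pi: x => s; rewrite !tensor_scl_pi; congr \pi_tensor.
by rewrite /tensor_map_scale -map_comp; apply: eq_map => p /=; rewrite scalerA.
Qed.

Lemma tensor_sclDr : right_distributive tensor_scl tensor_add.
Proof.
move=> a; elim/tensor_ind_pi=> s; elim/tensor_ind_pi=> t.
rewrite (tensor_add_pi s t) (tensor_scl_pi a s) (tensor_scl_pi a t).
by rewrite (tensor_scl_pi a (s ++ t)) tensor_add_pi /tensor_map_scale map_cat.
Qed.

Lemma tensor_sclDl x :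
  {morph tensor_scl^~ x : a b / a + b >-> tensor_add a b}.
Proof.
elim/tensor_ind_pi: x => s a b; rewrite !tensor_scl_pi tensor_add_pi.
by apply/tensor_piE; exact: tensor_rel_scaleDl.
Qed.

Lemma tensor_addN : left_inverse tensor0 tensor_opp tensor_add.
Proof.
elim/tensor_ind_pi=> s; rewrite /tensor_opp.
rewrite -[X in tensor_add _ X]tensor_scl1 -tensor_sclDl addNr tensor_scl_pi.
by apply/tensor_piE; exact: tensor_rel_scale0.
Qed.

HB.instance Definition _ :=
  GRing.isZmodule.Build tensor tensor_addA tensor_addC tensor_add0 tensor_addN.

HB.instance Definition _ :=
  GRing.Zmodule_isLmodule.Build k tensor
    tensor_sclA tensor_scl1 tensor_sclDr tensor_sclDl.

Lemma tensor_piD s t :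
  (\pi_tensor s : tensor) + \pi_tensor t = \pi_tensor (s ++ t).
Proof. exact: tensor_add_pi. Qed.

Lemma tensor_piZ a s :
  a *: (\pi_tensor s : tensor) = \pi_tensor (tensor_map_scale a s).
Proof. exact: tensor_scl_pi. Qed.

Definition tens (v : V) (w : W) : tensor := \pi_tensor [:: (v, w)].

Lemma tens_bilinear : bilinear_for *:%R *:%R tens.
Proof.
split=> [w a v v' | v a w w'].
- rewrite /tens /= tensor_piZ tensor_piD; apply/tensor_piE; exact: tensor_addl.
- rewrite /tens /= tensor_piZ tensor_piD; apply/tensor_piE.
  apply: tensor_trans (tensor_addr _ _ _) _.
  rewrite -cat1s -[X in tensor_rel _ X]cat1s.
  by apply: tensor_cat (tensor_refl _); apply: tensor_sym; exact: tensor_scale.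
Qed.

Lemma tensorE (x : tensor) : x = \sum_(p <- repr x) tens p.1 p.2.
Proof.
rewrite -[LHS]reprK; elim: (repr x) => [|[v w] s IH]; first by rewrite big_nil.
by rewrite big_cons -IH -cat1s -tensor_piD.
Qed.

(* The value at [x] of the linear map on [tensor V W] induced by [f]; it depends
   on the chosen representative of [x] unless [f] is bilinear, see
   [tsum_linear] and [tsum_tens]. *)
Definition tsum (U : nmodType) (f : V -> W -> U) (x : tensor) : U :=
  \sum_(p <- repr x) f p.1 p.2.

Lemma tsum_pi (U : lmodType k) (f : V -> W -> U) s :
  bilinear_for *:%R *:%R f -> tsum f (\pi_tensor s) = \sum_(p <- s) f p.1 p.2.
Proof.
move=> [fl0 fr0]; rewrite /tsum.
have fl w a v v' : f (a *: v + v') w = a *: f v w + f v' w by exact: fl0.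
have fr v a w w' : f v (a *: w + w') = a *: f v w + f v w' by exact: fr0.
have fD v v' w : f (v + v') w = f v w + f v' w.
  by rewrite -[v in LHS]scale1r [LHS](fl w 1 v v') scale1r.
have fD' v w w' : f v (w + w') = f v w + f v w'.
  by rewrite -[w in LHS]scale1r [LHS](fr v 1 w w') scale1r.
have f0 w : f 0 w = 0 by apply: (@addrI _ (f 0 w)); rewrite -fD !addr0.
have f0' v : f v 0 = 0 by apply: (@addrI _ (f v 0)); rewrite -fD' !addr0.
have fZ a v w : f (a *: v) w = a *: f v w.
  by rewrite -[a *: v]addr0 [LHS](fl w a v 0) f0 addr0.
have fZ' a v w : f v (a *: w) = a *: f v w.
  by rewrite -[a *: w]addr0 [LHS](fr v a w 0) f0' addr0.
move: (repr _) (tensor_reprP s) => r; elim=> {r s} //.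
- by move=> ? ? ? _ -> _ ->.
- by move=> ? ? ? ? _ h1 _ h2; rewrite !big_cat /= h1 h2.
- by move=> ? ?; rewrite !big_cat /= addrC.
- by move=> ?; rewrite big_seq1 big_nil f0.
- by move=> *; rewrite !big_cons !big_nil !addr0 /= fD.
- by move=> *; rewrite !big_cons !big_nil !addr0 /= fD'.
- by move=> *; rewrite !big_seq1 /= fZ fZ'.
Qed.

Lemma tsum_tens (U : lmodType k) (f : V -> W -> U) v w :
  bilinear_for *:%R *:%R f -> tsum f (tens v w) = f v w.
Proof. by move=> h; rewrite /tens tsum_pi // big_seq1. Qed.

Lemma tsum_linear (U : lmodType k) (f : V -> W -> U) :
  bilinear_for *:%R *:%R f -> linear (tsum f).
Proof.
move=> h a; elim/tensor_ind_pi=> s; elim/tensor_ind_pi=> t.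
rewrite tensor_piZ tensor_piD.
rewrite !tsum_pi // big_cat /= scaler_sumr big_map; congr (_ + _).
apply: eq_bigr => p _ /=; case: h => fl0 _.
have fl w b v v' : f (b *: v + v') w = b *: f v w + f v' w by exact: fl0.
have f0 : f 0 p.2 = 0.
  by apply: (@addrI _ (f 0 p.2)); rewrite -[X in X + _]scale1r -fl scaler0 !addr0.
by rewrite -[a *: p.1]addr0 [LHS](fl p.2 a p.1 0) f0 addr0.
Qed.

End TensorProduct.

Arguments tens {k V W} v w.
Arguments tsum {k V W U} f x.

Notation "x \ox y" := (tens x y) : ring_scope.
(* Reads [t] as a sum of pure tensors [x \ox y]; nested over iterated coproducts,
   this is Sweedler notation. *)
Notation "\tsum_ ( x , y <- t ) E" := (tsum (fun x y => E) t) : ring_scope.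

Definition tmap (k : fieldType) (V V' W W' : lmodType k)
    (f : V -> V') (g : W -> W') (t : tensor V W) : tensor V' W' :=
  \tsum_(v, w <- t) f v \ox g w.

(** * Gradings and signs

    A grading of [V] by degrees [n >= 0] is given by its projections
    [pr n : V -> V^n]. *)

Record is_grading (k : fieldType) (V : lmodType k) (pr : nat -> V -> V) : Prop := {
  gr_linear : forall n, linear (pr n);
  gr_proj : forall m n x, pr m (pr n x) = if m == n then pr n x else 0;
  gr_finite : forall x, finite_set [set n | pr n x != 0];
  gr_sum : forall x, x = \sum_(n \in [set: nat]) pr n x }.

Definition homog (k : fieldType) (V : lmodType k) (pr : nat -> V -> V)
    (n : nat) (x : V) : Prop := pr n x = x.

Definition has_parity (k : fieldType) (V : lmodType k) (pr : nat -> V -> V)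
    (b : bool) (x : V) : Prop := forall n, odd n != b -> pr n x = 0.

(* The total degree on a tensor product of graded spaces. *)
Definition tpr (k : fieldType) (V W : lmodType k)
    (pV : nat -> V -> V) (pW : nat -> W -> W) (n : nat) (t : tensor V W) :
    tensor V W :=
  \sum_(i < n.+1) tmap (pV i) (pW (n - i)%N) t.

(* The extension by linearity of [(-1) ^ |v| f v]. *)
Definition dsign (k : fieldType) (V U : lmodType k) (pV : nat -> V -> V)
    (f : V -> U) (v : V) : U :=
  \sum_(m \in [set: nat]) (-1) ^+ m *: f (pV m v).

(* The extension by bilinearity of [(-1) ^ (|v| |w|) f v w]. *)
Definition koszul (k : fieldType) (V W U : lmodType k)
    (pV : nat -> V -> V) (pW : nat -> W -> W)
    (f : V -> W -> U) (v : V) (w : W) : U :=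
  \sum_(m \in [set: nat]) \sum_(n \in [set: nat])
     (-1) ^+ (m * n) *: f (pV m v) (pW n w).

(** * Algebras, bialgebras and Hopf algebras

    Operations are separated from their axioms, so that one can speak of the
    operations on [A |><| A] before knowing that they form a Hopf algebra. *)

Record algOps (k : fieldType) := AlgOps {
  alg_sort :> lmodType k;
  amul : alg_sort -> alg_sort -> alg_sort;
  aone : alg_sort }.

Record bialgOps (k : fieldType) := BialgOps {
  bialg_alg :> algOps k;
  cop : bialg_alg -> tensor bialg_alg bialg_alg;
  eps : bialg_alg -> k }.

Arguments amul {k a} : rename.
Arguments aone {k} a.
Arguments cop {k b} : rename.
Arguments eps {k b} : rename.

Record is_algebra (k : fieldType) (A : algOps k) : Prop := {
  alg_bilinear : bilinear_for *:%R *:%R (@amul k A);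
  alg_assoc : associative (@amul k A);
  alg_one_l : left_id (aone A) amul;
  alg_one_r : right_id (aone A) amul }.

Record is_coalgebra (k : fieldType) (C : bialgOps k) : Prop := {
  coalg_cop_linear : linear (@cop k C);
  coalg_eps_linear : scalar (@eps k C);
  coalg_coassoc : forall x : C,
    \tsum_(x12, x3 <- cop x) \tsum_(x1, x2 <- cop x12) x1 \ox (x2 \ox x3) =
    \tsum_(x1, x23 <- cop x) \tsum_(x2, x3 <- cop x23) x1 \ox (x2 \ox x3);
  coalg_counit_l : forall x : C, \tsum_(x1, x2 <- cop x) eps x1 *: x2 = x;
  coalg_counit_r : forall x : C, \tsum_(x1, x2 <- cop x) eps x2 *: x1 = x }.

Definition tmul (k : fieldType) (A B : algOps k) (x y : tensor A B) :
    tensor A B :=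
  \tsum_(a, b <- x) \tsum_(c, d <- y) amul a c \ox amul b d.

(* The product of the super tensor product,
   [(a (x) b)(c (x) d) = (-1) ^ (|b| |c|) ac (x) bd]. *)
Definition stmul (k : fieldType) (A B : algOps k)
    (pA : nat -> A -> A) (pB : nat -> B -> B) (x y : tensor A B) : tensor A B :=
  \tsum_(a, b <- x) \tsum_(c, d <- y)
    koszul pB pA (fun b c => amul a c \ox amul b d) b c.

Record is_bialgebra (k : fieldType) (H : bialgOps k) : Prop := {
  bialg_algebra : is_algebra H;
  bialg_coalgebra : is_coalgebra H;
  bialg_cop_mul : forall x y : H, cop (amul x y) = tmul (cop x) (cop y);
  bialg_cop_one : cop (aone H) = aone H \ox aone H;
  bialg_eps_mul : forall x y : H, eps (amul x y) = eps x * eps y;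
  bialg_eps_one : eps (aone H) = 1 }.

Record is_antipode (k : fieldType) (H : bialgOps k) (S : H -> H) : Prop := {
  antip_linear : linear S;
  antip_l : forall x : H,
    \tsum_(x1, x2 <- cop x) amul (S x1) x2 = eps x *: aone H;
  antip_r : forall x : H,
    \tsum_(x1, x2 <- cop x) amul x1 (S x2) = eps x *: aone H }.
Arguments is_antipode {k} H S.

Definition is_hopf (k : fieldType) (H : bialgOps k) : Prop :=
  is_bialgebra H /\ exists S : H -> H, is_antipode H S.

(* [pr] is a grading by nonnegative degrees, of which only the parity matters
   here. *)
Record is_super_bialgebra (k : fieldType) (H : bialgOps k)
    (pr : nat -> H -> H) : Prop := {
  sbialg_algebra : is_algebra H;
  sbialg_coalgebra : is_coalgebra H;
  sbialg_mul_even : forall b c (x y : H),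
    has_parity pr b x -> has_parity pr c y ->
    has_parity pr (b (+) c) (amul x y);
  sbialg_one_even : has_parity pr false (aone H);
  sbialg_cop_even : forall b (x : H),
    has_parity pr b x -> has_parity (tpr pr pr) b (cop x);
  sbialg_eps_even : forall x : H, has_parity pr true x -> eps x = 0;
  sbialg_cop_mul : forall x y : H,
    cop (amul x y) = stmul pr pr (cop x) (cop y);
  sbialg_cop_one : cop (aone H) = aone H \ox aone H;
  sbialg_eps_mul : forall x y : H, eps (amul x y) = eps x * eps y;
  sbialg_eps_one : eps (aone H) = 1 }.
Arguments is_super_bialgebra {k} H pr.

Definition is_super_antipode (k : fieldType) (H : bialgOps k)
    (pr : nat -> H -> H) (S : H -> H) : Prop :=
  is_antipode H S /\
  forall b (x : H), has_parity pr b x -> has_parity pr b (S x).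
Arguments is_super_antipode {k} H pr S.

Definition is_super_hopf (k : fieldType) (H : bialgOps k)
    (pr : nat -> H -> H) : Prop :=
  is_super_bialgebra H pr /\ exists S : H -> H, is_super_antipode H pr S.
Arguments is_super_hopf {k} H pr.

Record is_coquasitriangular (k : fieldType) (A : bialgOps k)
    (R : A -> A -> k) : Prop := {
  cqt_hopf : is_hopf A;
  cqt_bilinear : bilinear_for *%R *%R R;
  cqt_invertible : exists R' : A -> A -> k,
    [/\ bilinear_for *%R *%R R',
        forall a b : A, \tsum_(a1, a2 <- cop a) \tsum_(b1, b2 <- cop b)
          (R a1 b1 * R' a2 b2) = eps a * eps b
      & forall a b : A, \tsum_(a1, a2 <- cop a) \tsum_(b1, b2 <- cop b)
          (R' a1 b1 * R a2 b2) = eps a * eps b];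
  cqt_mul_l : forall a b c : A,
    R (amul a b) c = \tsum_(c1, c2 <- cop c) (R a c1 * R b c2);
  cqt_mul_r : forall a b c : A,
    R a (amul b c) = \tsum_(a1, a2 <- cop a) (R a1 c * R a2 b);
  cqt_comm : forall a b : A,
    \tsum_(a1, a2 <- cop a) \tsum_(b1, b2 <- cop b) R b2 a2 *: amul a1 b1 =
    \tsum_(a1, a2 <- cop a) \tsum_(b1, b2 <- cop b) R b1 a1 *: amul b2 a2 }.
Arguments is_coquasitriangular {k} A R.

(** * Exterior algebras *)

(* [ext_in] is the inclusion of [A] as the degree [0] part, and [ext_res] the
   projection [Omega -> Omega^0 = A]. *)
Record extOps (k : fieldType) (A : algOps k) := ExtOps {
  ext_alg :> algOps k;
  ext_pr : nat -> ext_alg -> ext_alg;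
  ext_in : A -> ext_alg;
  ext_res : ext_alg -> A;
  ext_d : ext_alg -> ext_alg }.

Record extHopfOps (k : fieldType) (A : bialgOps k) := ExtHopfOps {
  eh_ext :> extOps A;
  eh_cop : eh_ext -> tensor eh_ext eh_ext;
  eh_eps : eh_ext -> k }.

Arguments ext_pr {k A} e : rename.
Arguments ext_in {k A} e : rename.
Arguments ext_res {k A} e : rename.
Arguments ext_d {k A} e : rename.

Definition eh_bialg (k : fieldType) (A : bialgOps k) (O : extHopfOps A) :
    bialgOps k :=
  BialgOps (@eh_cop k A O) (@eh_eps k A O).
Arguments eh_bialg {k A} O.

Record is_exterior (k : fieldType) (A : algOps k) (O : extOps A) : Prop := {
  ext_base : is_algebra A;
  ext_algebra : is_algebra O;
  ext_grading : is_grading (ext_pr O);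
  ext_mul_degree : forall m n (x y : O),
    homog (ext_pr O) m x -> homog (ext_pr O) n y ->
    homog (ext_pr O) (m + n) (amul x y);
  ext_in_linear : linear (ext_in O);
  ext_in_mul : forall a b : A, ext_in O (amul a b) = amul (ext_in O a) (ext_in O b);
  ext_in_one : ext_in O (aone A) = aone O;
  ext_in_res : forall x : O, ext_in O (ext_res O x) = ext_pr O 0 x;
  ext_res_in : forall a : A, ext_res O (ext_in O a) = a;
  ext_d_linear : linear (ext_d O);
  ext_d_degree : forall n (x : O),
    homog (ext_pr O) n x -> homog (ext_pr O) n.+1 (ext_d O x);
  ext_d_square : forall x : O, ext_d O (ext_d O x) = 0;
  ext_leibniz : forall n (x y : O), homog (ext_pr O) n x ->
    ext_d O (amul x y) = amul (ext_d O x) y + (-1) ^+ n *: amul x (ext_d O y);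
  ext_span1 : forall x : O, homog (ext_pr O) 1 x ->
    exists s : seq (A * A),
      x = \sum_(p <- s) amul (ext_in O p.1) (ext_d O (ext_in O p.2));
  ext_generated : forall P : set O,
    (forall a : A, P (ext_in O a)) ->
    (forall x : O, homog (ext_pr O) 1 x -> P x) ->
    (forall (c : k) (x y : O), P x -> P y -> P (c *: x + y)) ->
    (forall x y : O, P x -> P y -> P (amul x y)) ->
    forall x, P x }.

Record is_strongly_bicovariant (k : fieldType) (A : bialgOps k)
    (O : extHopfOps A) : Prop := {
  sb_base : is_hopf A;
  sb_exterior : is_exterior O;
  sb_super_hopf : is_super_hopf (eh_bialg O) (ext_pr O);
  sb_cop_degree : forall n (x : O), homog (ext_pr O) n x ->
    homog (tpr (ext_pr O) (ext_pr O)) n (eh_cop x);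
  sb_cop_restr : forall a : A,
    eh_cop (ext_in O a) = tmap (ext_in O) (ext_in O) (cop a);
  sb_cop_d : forall x : O,
    eh_cop (ext_d O x) =
    \tsum_(x1, x2 <- eh_cop x)
      (ext_d O x1 \ox x2 + dsign (ext_pr O) (fun x1 => x1 \ox ext_d O x2) x1) }.

(** * The double cross products *)

Section Bowtie.
Context (k : fieldType) (A : bialgOps k) (R : A -> A -> k) (S : A -> A).

Definition bowtie_mul (x y : tensor A A) : tensor A A :=
  \tsum_(a, b <- x) \tsum_(c, d <- y)
  \tsum_(b12, b3 <- cop b) \tsum_(b1, b2 <- cop b12)
  \tsum_(c12, c3 <- cop c) \tsum_(c1, c2 <- cop c12)
    (R (S b1) c1 * R b3 c3) *: (amul a c2 \ox amul b2 d).

Definition bowtie_cop (x : tensor A A) : tensor (tensor A A) (tensor A A) :=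
  \tsum_(a, b <- x) \tsum_(a1, a2 <- cop a) \tsum_(b1, b2 <- cop b)
    (a1 \ox b1) \ox (a2 \ox b2).

Definition bowtie_eps (x : tensor A A) : k :=
  \tsum_(a, b <- x) (eps a * eps b).

Definition bowtie : bialgOps k :=
  @BialgOps k (AlgOps bowtie_mul (aone A \ox aone A)) bowtie_cop bowtie_eps.

Context (O' O : extHopfOps A) (SO : O -> O).

(* [R] extended by zero to degrees [>= 1], on the pairs of arguments used
   below. *)
Definition R_ext (x : O) (y : O') : k := R (ext_res O x) (ext_res O' y).

Definition ebowtie_mul (x y : tensor O' O) : tensor O' O :=
  \tsum_(w, e <- x) \tsum_(t, z <- y)
  koszul (ext_pr O) (ext_pr O') (fun e t =>
    \tsum_(e12, e3 <- eh_cop e) \tsum_(e1, e2 <- eh_cop e12)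
    \tsum_(t12, t3 <- eh_cop t) \tsum_(t1, t2 <- eh_cop t12)
      (R_ext (SO e1) t1 * R_ext e3 t3) *: (amul w t2 \ox amul e2 z)) e t.

Definition ebowtie_cop (x : tensor O' O) : tensor (tensor O' O) (tensor O' O) :=
  \tsum_(w, e <- x) \tsum_(w1, w2 <- eh_cop w) \tsum_(e1, e2 <- eh_cop e)
    koszul (ext_pr O) (ext_pr O')
      (fun e1 w2 => (w1 \ox e1) \ox (w2 \ox e2)) e1 w2.

Definition ebowtie_eps (x : tensor O' O) : k :=
  \tsum_(w, e <- x) (eh_eps w * eh_eps e).

Definition ebowtie_d (x : tensor O' O) : tensor O' O :=
  \tsum_(w, e <- x)
    (ext_d O' w \ox e + dsign (ext_pr O') (fun w => w \ox ext_d O e) w).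

Definition ebowtie_ext : extOps bowtie :=
  @ExtOps k bowtie
    (AlgOps ebowtie_mul (aone O' \ox aone O))
    (tpr (ext_pr O') (ext_pr O))
    (tmap (ext_in O') (ext_in O))
    (tmap (ext_res O') (ext_res O))
    ebowtie_d.

Definition ebowtie : extHopfOps bowtie :=
  @ExtHopfOps k bowtie ebowtie_ext ebowtie_cop ebowtie_eps.

Definition bowtie_act (a : A) (x : bowtie) : A :=
  \tsum_(b, c <- (x : tensor A A))
  \tsum_(a1, a2 <- cop a) \tsum_(c1, c2 <- cop c)
    R a2 b *: amul (amul (S c1) a1) c2.

(* [R_ext t2 w] vanishes when [w] has degree [>= 1], and only the degree [0]
   part of [t2] contributes. *)
Definition ebowtie_act (t : O) (x : ebowtie) : O :=
  \tsum_(w, e <- (x : tensor O' O)) \tsum_(e1, e2 <- eh_cop e)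
  koszul (ext_pr O) (ext_pr O) (fun e1 t =>
    \tsum_(t1, t2 <- eh_cop t)
      R_ext t2 w *: amul (amul (SO e1) t1) e2) e1 t.

End Bowtie.

Arguments bowtie_act {k A} R S a x.
Arguments ebowtie_act {k A} R S {O' O} SO t x.

(** * Module algebras and differentiable actions *)

Record is_module_algebra (k : fieldType) (K : bialgOps k) (B : algOps k)
    (act : B -> K -> B) : Prop := {
  modalg_bilinear : bilinear_for *:%R *:%R act;
  modalg_act_one : forall v : B, act v (aone K) = v;
  modalg_act_mul : forall (v : B) (a b : K), act v (amul a b) = act (act v a) b;
  modalg_one : forall a : K, act (aone B) a = eps a *: aone B;
  modalg_mul : forall (v w : B) (a : K),
    act (amul v w) a = \tsum_(a1, a2 <- cop a) amul (act v a1) (act w a2) }.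
Arguments is_module_algebra {k} K B act.

Record is_super_module_algebra (k : fieldType) (K : bialgOps k) (B : algOps k)
    (pK : nat -> K -> K) (pB : nat -> B -> B) (act : B -> K -> B) : Prop := {
  smodalg_bilinear : bilinear_for *:%R *:%R act;
  smodalg_even : forall b c (v : B) (a : K),
    has_parity pB b v -> has_parity pK c a -> has_parity pB (b (+) c) (act v a);
  smodalg_act_one : forall v : B, act v (aone K) = v;
  smodalg_act_mul : forall (v : B) (a b : K), act v (amul a b) = act (act v a) b;
  smodalg_one : forall a : K, act (aone B) a = eps a *: aone B;
  smodalg_mul : forall (v w : B) (a : K),
    act (amul v w) a =
    \tsum_(a1, a2 <- cop a)
      koszul pB pK (fun w a1 => amul (act v a1) (act w a2)) w a1 }.
Arguments is_super_module_algebra {k} K B pK pB act.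

(* The action [act] of [K] on [B] is differentiable when some [eact] satisfies
   this; naming [eact] records which extension makes it so. *)
Record differentiable_by (k : fieldType) (K : bialgOps k) (OK : extHopfOps K)
    (B : algOps k) (OB : extOps B) (act : B -> K -> B) (eact : OB -> OK -> OB) :
    Prop := {
  diff_K : is_strongly_bicovariant OK;
  diff_B : is_exterior OB;
  diff_action : is_module_algebra K B act;
  diff_extends : forall (b : B) (h : K),
    eact (ext_in OB b) (ext_in OK h) = ext_in OB (act b h);
  diff_degree : forall m n (v : OB) (a : OK),
    homog (ext_pr OB) m v -> homog (ext_pr OK) n a ->
    homog (ext_pr OB) (m + n) (eact v a);
  diff_modalg : is_super_module_algebra (eh_bialg OK) OB
    (ext_pr OK) (ext_pr OB) eact;
  diff_d : forall n (v : OB) (a : OK), homog (ext_pr OB) n v ->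
    ext_d OB (eact v a) =
    eact (ext_d OB v) a + (-1) ^+ n *: eact v (ext_d OK a) }.
Arguments differentiable_by {k K} OK {B} OB act eact.

(* Main.v *)
Require Import Defs.
From mathcomp Require Import all_boot all_order all_algebra.
From mathcomp Require Import boolp classical_sets functions cardinality fsbigop.

(** Three ideas make the theorem true.

    The form [R] brings in no signs. It sees elements of [Omega(A)] only through the
    projection [ext_res] onto [A], which is a morphism of super Hopf algebras
    ([res_mul], [res_cop], [eps_res], [res_SO]). Hence [A] coacts on [Omega(A)] from
    the left and from the right ([lco], [rco]) by maps that preserve the degree, are
    multiplicative and commute with [d]. Through [R] these coactions of [A] on
    [Omega'(A)] become two commuting actions [la] and [ra] of [A], and with
    [act2 a b = la a \o ra b] the product is that of a super smash product,
      (w (x) e)(t (x) z) = (-1)^(|e| |t|) w . act2 e_(-1) e_(1) t (x) e_(0) . z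
    ([ebowtie_mul_tens]). Associativity amounts to the module algebra laws of [act2]
    and the coassociativity of the two-sided coaction, and the Leibniz rule holds
    because [d] commutes with everything that occurs in the formula.

    The graded identities follow from degree zero. An exterior algebra is generated by
    [A] and [d A], and [db . y = d (b . y) - b . dy]. So an identity saying that some
    operations commuting with the differentials are compatible with left
    multiplication by [x] holds for every [x] as soon as it holds for [x] of degree
    zero. This applies to the multiplicativity of the coproduct ([cop_mul_from_base]),
    to the action of a product ([act_mul_from_base]) and to the action on a product
    ([modalg_from_base]), and leaves the cases [x = a (x) 1] and [x = 1 (x) c] with
    [a] and [c] in [A]. These are Hopf algebra computations without signs: the
    coproduct is multiplicative because the actions [ra] and [la] that face each other
    on the two legs of a coproduct cancel ([ra_la_cancel]), and the two factors act
    compatibly by [ract_adact_in].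

    Antipodes are convolution inverses, hence unique. This gives that the antipode of
    [Omega(A)] preserves the degree, commutes with [d], restricts to that of [A] and
    reverses products with elements of [A] ([conv_cancel] and its applications). The
    antipode of the double cross product is the anti-multiplicative extension of those
    of the factors ([ebowtie_antipode]).

    The assertions on the double cross product of [A] with itself, and on its action on
    [A], are the degree zero parts of those on forms ([degree0_hopf],
    [degree0_module_algebra]).

    All these identities are multilinear. They are checked on homogeneous pure tensors
    ([homog_ext2], [tens_homog_ext], [eq_tsum_homog]), where each Koszul sign is an
    explicit power of [-1]. *)

Set Implicit Arguments.
Unset Strict Implicit.
Unset Printing Implicit Defensive.

Import GRing.Theory.
Local Open Scope classical_set_scope.
Local Open Scope ring_scope.

(** * Multilinear maps and Sweedler sums *)

(** The statement [linear f] as a plain proposition, on which tactics can match. Forms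
    with values in [k] are covered by taking [k^o] as the target. *)
Definition lin (k : fieldType) (V U : lmodType k) (f : V -> U) : Prop :=
  forall a x y, f (a *: x + y) = a *: f x + f y.

Definition bilin (k : fieldType) (V W U : lmodType k) (f : V -> W -> U) : Prop :=
  (forall w, lin (fun v => f v w)) /\ (forall v, lin (f v)).

Definition trilin (k : fieldType) (V W X U : lmodType k)
    (f : V -> W -> X -> U) : Prop :=
  [/\ forall w x, lin (fun v => f v w x), forall v x, lin (fun w => f v w x)
    & forall v w, lin (f v w)].

Section Lin.
Context (k : fieldType).
Implicit Types (V W U X : lmodType k).

Lemma lin_id V : lin (fun x : V => x). Proof. by []. Qed.

Lemma lin_cst0 V U : lin (fun _ : V => 0 : U).
Proof. by move=> a x y; rewrite scaler0 addr0. Qed.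

Lemma lin_comp V W U (g : W -> U) (f : V -> W) :
  lin g -> lin f -> lin (fun x => g (f x)).
Proof. by move=> hg hf a x y; rewrite hf hg. Qed.

Lemma lin_add V U (f g : V -> U) : lin f -> lin g -> lin (fun x => f x + g x).
Proof. by move=> hf hg a x y; rewrite hf hg scalerDr addrACA. Qed.

Lemma lin_scale_v V U c (f : V -> U) : lin f -> lin (fun x => c *: f x).
Proof. by move=> hf a x y; rewrite hf scalerDr !scalerA mulrC. Qed.

Lemma lin_opp V U (f : V -> U) : lin f -> lin (fun x => - f x).
Proof. by move=> hf a x y; rewrite hf opprD scalerN. Qed.

Lemma lin_scale_c V U (c : V -> k^o) (u : U) :
  lin c -> lin (fun x => (c x : k) *: u).
Proof. by move=> hc a x y; rewrite hc scalerDl -scalerA. Qed.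

Lemma lin_mul_l V (f : V -> k^o) (c : k) :
  lin f -> lin (fun x => (f x : k) * c : k^o).
Proof. by move=> hf a x y; rewrite hf mulrDl -mulrA. Qed.

Lemma lin_mul_r V (f : V -> k^o) (c : k) :
  lin f -> lin (fun x => c * (f x : k) : k^o).
Proof. by move=> hf a x y; rewrite hf mulrDr /GRing.scale /= mulrCA. Qed.

Lemma lin0 V U (f : V -> U) : lin f -> f 0 = 0.
Proof.
move=> hf; have := hf 1 0 0; rewrite !scale1r addr0 => h.
by apply: (@addrI _ (f 0)); rewrite -h addr0.
Qed.

Lemma linD V U (f : V -> U) x y : lin f -> f (x + y) = f x + f y.
Proof. by move=> hf; have := hf 1 x y; rewrite !scale1r. Qed.

Lemma linZ V U (f : V -> U) a x : lin f -> f (a *: x) = a *: f x.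
Proof. by move=> hf; have := hf a x 0; rewrite !addr0 (lin0 hf) addr0. Qed.

Lemma linN V U (f : V -> U) x : lin f -> f (- x) = - f x.
Proof. by move=> hf; rewrite -scaleN1r linZ // scaleN1r. Qed.

Lemma linB V U (f : V -> U) x y : lin f -> f (x - y) = f x - f y.
Proof. by move=> hf; rewrite linD // linN. Qed.

Lemma lin_sum V U (f : V -> U) I (r : seq I) (F : I -> V) :
  lin f -> f (\sum_(i <- r) F i) = \sum_(i <- r) f (F i).
Proof.
move=> hf; elim: r => [|i r IH]; first by rewrite !big_nil lin0.
by rewrite !big_cons linD // IH.
Qed.

Lemma bilin_for V W U (f : V -> W -> U) : bilin f <-> bilinear_for *:%R *:%R f.
Proof. by split=> [[h1 h2]|[h1 h2]]; split. Qed.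

Lemma lin_tensl V W (w : W) : lin (fun v : V => v \ox w).
Proof. by move=> a x y; case: (tens_bilinear V W) => h _; exact: h. Qed.

Lemma lin_tensr V W (v : V) : lin (fun w : W => v \ox w).
Proof. by move=> a x y; case: (tens_bilinear V W) => _ h; exact: h. Qed.

Lemma tsum_pure V W U (f : V -> W -> U) v w : bilin f -> tsum f (v \ox w) = f v w.
Proof. by move/bilin_for; exact: tsum_tens. Qed.

Lemma lin_tsum V W U (f : V -> W -> U) : bilin f -> lin (tsum f).
Proof. by move/bilin_for/tsum_linear => h a x y; exact: h. Qed.

Lemma lin_tsum_f V W X U (g : X -> V -> W -> U) t :
  (forall v w, lin (fun x => g x v w)) -> lin (fun x => tsum (g x) t).
Proof.
move=> h a x y; rewrite /tsum scaler_sumr -big_split /=.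
by apply: eq_bigr => p _; exact: h.
Qed.

Lemma eq_tsum V W (U : nmodType) (f g : V -> W -> U) t :
  (forall v w, f v w = g v w) -> tsum f t = tsum g t.
Proof. by move=> h; apply: eq_bigr => p _. Qed.

(** A [tsum] is a finite sum over a representative of [t], so it can be moved out of a
    linear map whatever the summand; likewise for the exchange of two [tsum] below. *)
Lemma lin_out V W X U (f : X -> U) (g : V -> W -> X) t :
  lin f -> f (tsum g t) = tsum (fun v w => f (g v w)) t.
Proof. by move=> hf; rewrite /tsum lin_sum. Qed.

Lemma tsum_exch V W (V' W' : lmodType k) (U : nmodType) (f : V -> W -> V' -> W' -> U) t t' :
  tsum (fun v w => tsum (f v w) t') t =
  tsum (fun v' w' => tsum (fun v w => f v w v' w') t) t'.
Proof. exact: exchange_big. Qed.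

Lemma tsumD V W (U : nmodType) (f g : V -> W -> U) t :
  tsum (fun v w => f v w + g v w) t = tsum f t + tsum g t.
Proof. exact: big_split. Qed.

Lemma tsumB V W U (f g : V -> W -> U) t :
  tsum (fun v w => f v w - g v w) t = tsum f t - tsum g t.
Proof. exact: sumrB. Qed.

Lemma tsumZ V W U a (f : V -> W -> U) t :
  tsum (fun v w => a *: f v w) t = a *: tsum f t.
Proof. by rewrite /tsum scaler_sumr. Qed.

Lemma tsum_scale V W U (f : V -> W -> k) (u : U) t :
  tsum f t *: u = tsum (fun v w => f v w *: u) t.
Proof. by rewrite /tsum scaler_suml. Qed.

Lemma tsum0 V W (U : nmodType) t : tsum (fun (_ : V) (_ : W) => 0 : U) t = 0.
Proof. exact: big1. Qed.

Lemma tsum_id V W (t : tensor V W) : tsum (fun v w => v \ox w) t = t.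
Proof. by rewrite [RHS]tensorE. Qed.

Lemma tens_ext V W U (f g : tensor V W -> U) :
  lin f -> lin g -> (forall v w, f (v \ox w) = g (v \ox w)) -> forall t, f t = g t.
Proof.
by move=> hf hg h t; rewrite [t]tensorE !lin_sum //; apply: eq_bigr => p _.
Qed.

Lemma tsum_tsum V W (V' W' : lmodType k) U (f : V' -> W' -> U) (g : V -> W -> tensor V' W') t :
  bilin f -> tsum f (tsum g t) = tsum (fun v w => tsum f (g v w)) t.
Proof. by move=> hf; rewrite lin_out //; exact: lin_tsum. Qed.

Lemma tsum_tmap V W (V' W' : lmodType k) U (f : V' -> W' -> U) (g : V -> V') (h : W -> W') t :
  bilin f -> tsum f (tmap g h t) = tsum (fun v w => f (g v) (h w)) t.
Proof. by move=> hf; rewrite tsum_tsum //; apply: eq_tsum => v w; rewrite tsum_pure. Qed.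

End Lin.

(** * Gradings *)

Section Gradings.
Context (k : fieldType).
Implicit Types (V W U : lmodType k).

Lemma fsum_bounded V (F : nat -> V) N :
  (forall n, (N <= n)%N -> F n = 0) ->
  \sum_(n \in [set: nat]) F n = \sum_(i < N) F i.
Proof.
move=> F0; rewrite -(big_mkord xpredT) /index_iota subn0.
rewrite (fsbig_seq _ _ (iota_uniq 0 N)) /=; apply: esym; apply: fsbig_widen => //= n [_ hn].
apply: F0; rewrite leqNgt; apply: contra_notN hn => h.
by rewrite /= mem_iota.
Qed.

Lemma fsum_single V (F : nat -> V) m :
  (forall n, n != m -> F n = 0) -> \sum_(n \in [set: nat]) F n = F m.
Proof.
move=> F0; rewrite (@fsum_bounded _ _ m.+1) => [|n hn].
  by rewrite big_ord_recr /= big1 ?add0r // => i _; apply: F0; rewrite ltn_eqF.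
by apply: F0; rewrite gtn_eqF.
Qed.

Section One.
Context (V : lmodType k) (pr : nat -> V -> V) (gr : is_grading pr).

Lemma lin_pr n : lin (pr n).
Proof. by move=> a x y; exact: (gr_linear gr n). Qed.

Lemma pr_bound x : exists N, forall n, (N <= n)%N -> pr n x = 0.
Proof.
have /finite_seqP [s hs] := gr_finite gr x.
exists (\max_(i <- s) i).+1 => n hn; apply/eqP; apply/negPn/negP => h.
have : [set n | pr n x != 0] n by [].
rewrite hs /= => ns; move: hn; rewrite ltnNge => /negP; apply.
exact: leq_bigmax_seq.
Qed.

Lemma pr_sum x N : (forall n, (N <= n)%N -> pr n x = 0) ->
  x = \sum_(i < N) pr i x.
Proof. by move=> h; rewrite [LHS](gr_sum gr); exact: fsum_bounded. Qed.

Lemma homog_pr n x : homog pr n (pr n x).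
Proof. by rewrite /homog (gr_proj gr) eqxx. Qed.

Lemma pr_homog m n x : homog pr n x -> pr m x = if m == n then x else 0.
Proof. by move=> h; rewrite -[x in LHS]h (gr_proj gr) h. Qed.

Lemma homog0 n : homog pr n 0. Proof. exact: lin0 (lin_pr n). Qed.

Lemma homog_lin n a x y : homog pr n x -> homog pr n y -> homog pr n (a *: x + y).
Proof. by move=> hx hy; rewrite /homog lin_pr hx hy. Qed.

Lemma homogZ n a x : homog pr n x -> homog pr n (a *: x).
Proof. by move=> hx; rewrite -[_ *: _]addr0; exact: homog_lin (homog0 n). Qed.

Lemma homogD n x y : homog pr n x -> homog pr n y -> homog pr n (x + y).
Proof. by move=> hx hy; rewrite -[x]scale1r; exact: homog_lin. Qed.

(** Homogeneous elements span, so a linear identity only has to be checked on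
    them. *)
Lemma homog_ext U (f g : V -> U) : lin f -> lin g ->
  (forall n x, homog pr n x -> f x = g x) -> forall x, f x = g x.
Proof.
move=> hf hg h x; have [N /pr_sum ->] := pr_bound x.
rewrite !lin_sum //; apply: eq_bigr => i _; apply: h; exact: homog_pr.
Qed.

(** This and the next lemma serve the maps that are defined by a different formula in
    each degree: signs, and the degree-preserving part of a map. *)
Lemma fsum_pr_homog U (f : nat -> V -> U) m v : (forall n, lin (f n)) ->
  homog pr m v -> \sum_(n \in [set: nat]) f n (pr n v) = f m v.
Proof.
move=> hf hv; rewrite (@fsum_single _ _ m) ?hv // => n.
by rewrite (pr_homog _ hv) => /negPf ->; rewrite lin0.
Qed.

Lemma lin_fsum_pr U (f : nat -> V -> U) : (forall n, lin (f n)) ->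
  lin (fun v => \sum_(n \in [set: nat]) f n (pr n v)).
Proof.
move=> hf a x y; have [M hM] := pr_bound x; have [N hN] := pr_bound y.
pose K := maxn M N.
have hx n : (K <= n)%N -> pr n x = 0 by rewrite geq_max => /andP [/hM ->].
have hy n : (K <= n)%N -> pr n y = 0 by rewrite geq_max => /andP [_ /hN ->].
have hK v : (forall n, (K <= n)%N -> pr n v = 0) ->
    \sum_(n \in [set: nat]) f n (pr n v) = \sum_(i < K) f i (pr i v).
  by move=> hv; rewrite (@fsum_bounded _ _ K) // => n hn; rewrite hv // lin0.
rewrite (hK x) // (hK y) // hK => [|n hn].
  rewrite scaler_sumr -big_split /=; apply: eq_bigr => i _.
  by rewrite (lin_pr i) hf.
by rewrite lin_pr hx // hy // scaler0 addr0.
Qed.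

Lemma dsign_homog U (f : V -> U) m v : lin f -> homog pr m v ->
  dsign pr f v = (-1) ^+ m *: f v.
Proof.
move=> hf; apply: (@fsum_pr_homog _ (fun m v => (-1) ^+ m *: f v)) => n.
exact: lin_scale_v.
Qed.

Lemma lin_dsign U (f : V -> U) : lin f -> lin (dsign pr f).
Proof.
move=> hf; apply: (@lin_fsum_pr _ (fun m v => (-1) ^+ m *: f v)) => n.
exact: lin_scale_v.
Qed.

Lemma dsign_sum U (f : V -> U) v N : lin f ->
  (forall n, (N <= n)%N -> pr n v = 0) ->
  dsign pr f v = \sum_(i < N) (-1) ^+ i *: f (pr i v).
Proof.
move=> hf h; rewrite /dsign (@fsum_bounded _ _ N) // => n hn.
by rewrite h // lin0 // scaler0.
Qed.

Lemma lin_dsign_f (X : lmodType k) U (f : X -> V -> U) v : (forall x, lin (f x)) ->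
  (forall v, lin (fun x => f x v)) -> lin (fun x => dsign pr (f x) v).
Proof.
move=> hf hf'; have [M hM] := pr_bound v => a x y.
rewrite !(dsign_sum (hf _) hM) scaler_sumr -big_split /=; apply: eq_bigr => i _.
by rewrite hf' scalerDr !scalerA mulrC.
Qed.

End One.

Section Two.
Context (V W : lmodType k) (pV : nat -> V -> V) (pW : nat -> W -> W).
Context (gV : is_grading pV) (gW : is_grading pW).

Lemma koszul_sum U (f : V -> W -> U) v w M N : bilin f ->
  (forall n, (M <= n)%N -> pV n v = 0) -> (forall n, (N <= n)%N -> pW n w = 0) ->
  koszul pV pW f v w =
  \sum_(i < M) \sum_(j < N) (-1) ^+ (i * j) *: f (pV i v) (pW j w).
Proof.
move=> [fl fr] hM hN; rewrite /koszul (@fsum_bounded _ _ M) => [|i hi].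
  apply: eq_bigr => i _; rewrite (@fsum_bounded _ _ N) // => j hj.
  by rewrite hN // (lin0 (fr _)) scaler0.
by apply: fsbig1 => n _; rewrite hM // (lin0 (fl _)) scaler0.
Qed.

Lemma koszul_homog U (f : V -> W -> U) m n v w :
  bilin f -> homog pV m v -> homog pW n w ->
  koszul pV pW f v w = (-1) ^+ (m * n) *: f v w.
Proof.
move=> [fl fr] hv hw; rewrite /koszul (@fsum_single _ _ m) => [|i hi].
  rewrite (@fsum_single _ _ n) ?hv ?hw // => j hj.
  by rewrite (pr_homog gW _ hw) (negPf hj) (lin0 (fr _)) scaler0.
apply: fsbig1 => j _.
by rewrite (pr_homog gV _ hv) (negPf hi) (lin0 (fl _)) scaler0.
Qed.

Lemma lin_koszul_l U (f : V -> W -> U) w : bilin f ->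
  lin (fun v => koszul pV pW f v w).
Proof.
move=> hf a x y; have [M hM] := pr_bound gV x; have [N hN] := pr_bound gV y.
have [L hL] := pr_bound gW w; pose K := maxn M N.
have hx n : (K <= n)%N -> pV n x = 0 by rewrite geq_max => /andP [/hM ->].
have hy n : (K <= n)%N -> pV n y = 0 by rewrite geq_max => /andP [_ /hN ->].
rewrite (koszul_sum hf hx hL) (koszul_sum hf hy hL) (@koszul_sum _ _ _ _ K L) //.
  rewrite scaler_sumr -big_split /=; apply: eq_bigr => i _.
  rewrite scaler_sumr -big_split /=; apply: eq_bigr => j _.
  by rewrite (lin_pr gV i) (proj1 hf) scalerDr !scalerA mulrC.
by move=> n hn; rewrite (lin_pr gV) hx // hy // scaler0 addr0.
Qed.

Lemma koszul0l U (f : V -> W -> U) v w : bilin f -> homog pV 0 v ->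
  koszul pV pW f v w = f v w.
Proof.
move=> hf hv; rewrite /koszul (@fsum_single _ _ 0) => [|i hi].
  rewrite hv [in RHS](gr_sum gW w).
  under eq_fsbigr => n _ do rewrite scale1r.
  have [N hN] := pr_bound gW w.
  rewrite (fsum_bounded hN) (lin_sum _ _ (proj2 hf v)) (@fsum_bounded _ _ N) // => n hn.
  by rewrite hN // (lin0 (proj2 hf v)).
apply: fsbig1 => j _.
by rewrite (pr_homog gV _ hv) (negPf hi) (lin0 (proj1 hf _)) scaler0.
Qed.

Lemma lin_koszul_f (X : lmodType k) U (f : X -> V -> W -> U) v w : (forall x, bilin (f x)) ->
  (forall v w, lin (fun x => f x v w)) ->
  lin (fun x => koszul pV pW (f x) v w).
Proof.
move=> hf hf'; have [M hM] := pr_bound gV v; have [N hN] := pr_bound gW w => a x y.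
rewrite !(koszul_sum (hf _) hM hN) scaler_sumr -big_split /=; apply: eq_bigr => i _.
rewrite scaler_sumr -big_split /=; apply: eq_bigr => j _.
by rewrite hf' scalerDr !scalerA mulrC.
Qed.

(** Homogeneous elements span both spaces. This is how signs are made explicit: after it,
    [koszul_homog] applies. *)
Lemma homog_ext2 U (f g : V -> W -> U) : bilin f -> bilin g ->
  (forall m n v w, homog pV m v -> homog pW n w -> f v w = g v w) ->
  forall v w, f v w = g v w.
Proof.
move=> [fl fr] [gl gr] h v w.
apply: (homog_ext gV (fl w) (gl w)) => m {}v hv.
by apply: (homog_ext gW (fr v) (gr v)) => n {}w hw; exact: h hv hw.
Qed.

(** The sign is also trivial when the function vanishes unless one of its arguments has
    degree zero, as for a function that factors through [ext_res]. *)
Lemma eq_koszul0 U (f : V -> W -> U) v w : bilin f ->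
  (forall m n v w, homog pV m v -> homog pW n w -> (0 < m * n)%N -> f v w = 0) ->
  koszul pV pW f v w = f v w.
Proof.
move=> hf h; have [M hM] := pr_bound gV v; have [N hN] := pr_bound gW w.
rewrite (koszul_sum hf hM hN) [in RHS](pr_sum gV hM) [in RHS](pr_sum gW hN).
rewrite (lin_sum _ _ (proj1 hf _)); apply: eq_bigr => i _.
rewrite (lin_sum _ _ (proj2 hf _)); apply: eq_bigr => j _.
have [->|h0] := posnP (i * j); first by rewrite scale1r.
by rewrite (h _ _ _ _ (homog_pr gV _ _) (homog_pr gW _ _) h0) scaler0.
Qed.

End Two.

Lemma koszul_sym V W U (pV : nat -> V -> V) (pW : nat -> W -> W)
    (gV : is_grading pV) (gW : is_grading pW) (f : V -> W -> U) v w :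
  bilin f -> koszul pV pW f v w = koszul pW pV (fun w v => f v w) w v.
Proof.
move=> [h1 h2]; have hf' : bilin (fun w v => f v w) by split.
have [M hM] := pr_bound gV v; have [N hN] := pr_bound gW w.
rewrite (koszul_sum (conj h1 h2) hM hN) (koszul_sum hf' hN hM) exchange_big.
by apply: eq_bigr => i _; apply: eq_bigr => j _; rewrite mulnC.
Qed.

Lemma koszul0r V W U (pV : nat -> V -> V) (pW : nat -> W -> W)
    (gV : is_grading pV) (gW : is_grading pW) (f : V -> W -> U) v w :
  bilin f -> homog pW 0 w -> koszul pV pW f v w = f v w.
Proof.
move=> hf hw; rewrite (koszul_sym gV gW) // koszul0l //.
by case: hf => h1 h2; split.
Qed.

Lemma lin_koszul_r V W U (pV : nat -> V -> V) (pW : nat -> W -> W)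
    (gV : is_grading pV) (gW : is_grading pW) (f : V -> W -> U) v :
  bilin f -> lin (koszul pV pW f v).
Proof.
move=> [h1 h2] a x y; rewrite !(koszul_sym gV gW _ _ (conj h1 h2)).
exact: (lin_koszul_l gW gV v (conj h2 h1)).
Qed.

(** ** The total grading on a tensor product *)

(** A partial sum that recovers [x] also bounds the degrees that occur in [x], by
    orthogonality of the projections. *)
Lemma gradingP V (pr : nat -> V -> V) :
  (forall n, lin (pr n)) ->
  (forall m n x, pr m (pr n x) = if m == n then pr n x else 0) ->
  (forall x, exists N, x = \sum_(i < N) pr i x) -> is_grading pr.
Proof.
move=> hl hp hs.
have hb x : exists2 N, x = \sum_(i < N) pr i x & forall n, (N <= n)%N -> pr n x = 0.
  have [N hN] := hs x; exists N => // n hn.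
  rewrite hN lin_sum // big1 // => i _; rewrite hp gtn_eqF //.
  exact: leq_trans hn.
split=> // [x|x]; have [N hN h0] := hb x.
- apply: (@sub_finite_set _ _ `I_N); last exact: finite_II.
  move=> n /= h; rewrite ltnNge; apply: contra h => /h0 ->; exact: eqxx.
- by rewrite [LHS]hN (fsum_bounded h0).
Qed.

Section TensorGrading.
Context (V W : lmodType k) (pV : nat -> V -> V) (pW : nat -> W -> W).
Context (gV : is_grading pV) (gW : is_grading pW).

Lemma bilin_tens_lin (f : V -> V) (g : W -> W) : lin f -> lin g ->
  bilin (fun v w => f v \ox g w).
Proof.
by move=> hf hg; split=> [w|v];
  [apply: (lin_comp (lin_tensl _)) | apply: (lin_comp (lin_tensr _))].
Qed.

Lemma lin_tpr n : lin (tpr pV pW n).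
Proof.
move=> a x y; rewrite /tpr scaler_sumr -big_split /=; apply: eq_bigr => i _.
by apply: lin_tsum; apply: bilin_tens_lin; exact: lin_pr.
Qed.

Lemma tpr_tens n i j v w : homog pV i v -> homog pW j w ->
  tpr pV pW n (v \ox w) = if n == (i + j)%N then v \ox w else 0.
Proof.
move=> hv hw; rewrite /tpr.
have E (l : 'I_n.+1) : tmap (pV l) (pW (n - l)%N) (v \ox w) =
    if (l == i :> nat) && (n - l == j)%N then v \ox w else 0.
  rewrite /tmap tsum_pure; last by apply: bilin_tens_lin; exact: lin_pr.
  rewrite (pr_homog gV _ hv) (pr_homog gW _ hw).
  by do 2![case: ifP => _ //=]; rewrite ?(lin0 (lin_tensr _)) ?(lin0 (lin_tensl _)).
rewrite (eq_bigr _ (fun l _ => E l)); case: eqP => [->|ne].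
  have lt : (i < (i + j).+1)%N by rewrite ltnS leq_addr.
  rewrite (bigD1 (Ordinal lt)) //= eqxx addKn eqxx big1 ?addr0 // => l.
  by rewrite -val_eqE /= => /negPf ->.
rewrite big1 // => l _; case: ifP => // /andP [/eqP li /eqP lj]; case: ne.
by rewrite -lj -li subnKC // -ltnS.
Qed.

Lemma homog_tens i j v w : homog pV i v -> homog pW j w ->
  homog (tpr pV pW) (i + j) (v \ox w).
Proof. by move=> hv hw; rewrite /homog (tpr_tens _ hv hw) eqxx. Qed.

Lemma tens_homog_ext U (f g : tensor V W -> U) : lin f -> lin g ->
  (forall i j v w, homog pV i v -> homog pW j w -> f (v \ox w) = g (v \ox w)) ->
  forall t, f t = g t.
Proof.
move=> hf hg h; apply: tens_ext => // v w.
apply: (homog_ext2 gV gW (f := fun v w => f (v \ox w)) (g := fun v w => g (v \ox w))) => //.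
- by split=> *; apply: (lin_comp hf); [exact: lin_tensl | exact: lin_tensr].
- by split=> *; apply: (lin_comp hg); [exact: lin_tensl | exact: lin_tensr].
Qed.

Lemma tpr_grading : is_grading (tpr pV pW).
Proof.
apply: gradingP => [n|m n|t]; first exact: lin_tpr.
- apply: tens_homog_ext => [||i j v w hv hw].
  + by apply: lin_comp; exact: lin_tpr.
  + by case: eqP => _; [exact: lin_tpr | exact: lin_cst0].
  + rewrite (tpr_tens n hv hw); case: (n =P _) => [->|_]; last first.
      by rewrite (lin0 (lin_tpr _)); case: ifP.
    by rewrite (tpr_tens m hv hw).
(* All large enough partial sums are considered, so as to add two tensors. *)
- suff [N hN] : exists N, forall M, (N <= M)%N -> t = \sum_(i < M) tpr pV pW i t.
    by exists N; exact: hN.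
  rewrite [t]tensorE; elim: (repr t) => [|[v w] s [N hN]].
    by exists 0%N => M _; rewrite big_nil big1 // => i _; exact: lin0 (lin_tpr i).
  suff [K hK] : exists N, forall M, (N <= M)%N ->
      v \ox w = \sum_(i < M) tpr pV pW i (v \ox w).
    exists (maxn K N) => M; rewrite geq_max => /andP [KM NM].
    rewrite big_cons {1}(hK M KM) {1}(hN M NM) -big_split /=.
    by apply: eq_bigr => i _; rewrite (linD _ _ (lin_tpr i)).
  have [A hA] := pr_bound gV v; have [B hB] := pr_bound gW w.
  exists (A + B)%N => M hM.
  have E : v \ox w = \sum_(a < A) \sum_(b < B) pV a v \ox pW b w.
    rewrite {1}(pr_sum gV hA) (lin_sum _ _ (lin_tensl _)).
    by apply: eq_bigr => a _; rewrite {1}(pr_sum gW hB) (lin_sum _ _ (lin_tensr _)).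
  rewrite {1}E.
  under [RHS]eq_bigr => i _ do rewrite E (lin_sum _ _ (lin_tpr i)).
  rewrite [RHS]exchange_big /=; apply: eq_bigr => a _.
  under [RHS]eq_bigr => i _ do rewrite (lin_sum _ _ (lin_tpr i)).
  rewrite [RHS]exchange_big /=; apply: eq_bigr => b _.
  have T (i : 'I_M) := tpr_tens i (homog_pr gV a v) (homog_pr gW b w).
  rewrite [RHS](eq_bigr _ (fun i _ => T i)).
  have lt : (a + b < M)%N.
    by apply: leq_trans hM; rewrite -addSn leq_add // ltnW.
  rewrite (bigD1 (Ordinal lt)) //= eqxx big1 ?addr0 // => i.
  by rewrite -val_eqE /= => /negPf ->.
Qed.

(** Sweedler components of a homogeneous tensor may be assumed homogeneous, of
    degrees adding up to the degree of the tensor. *)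
Lemma eq_tsum_homog U (f g : V -> W -> U) n t : bilin f -> bilin g ->
  homog (tpr pV pW) n t ->
  (forall i j v w, (i + j)%N = n -> homog pV i v -> homog pW j w -> f v w = g v w) ->
  tsum f t = tsum g t.
Proof.
move=> hf hg ht h; rewrite -ht /tpr !(lin_sum _ _ (lin_tsum _)) //.
apply: eq_bigr => i _; rewrite !tsum_tmap //; apply: eq_tsum => v w.
apply: (h i (n - i)%N); [by rewrite subnKC // -ltnS|exact: homog_pr..].
Qed.

Lemma homog_tsum U (pU : nat -> U -> U) (gU : is_grading pU) (f : V -> W -> U) n m t :
  bilin f -> homog (tpr pV pW) n t ->
  (forall i j v w, (i + j)%N = n -> homog pV i v -> homog pW j w -> homog pU m (f v w)) ->
  homog pU m (tsum f t).
Proof.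
move=> hf ht h; rewrite /homog (lin_out _ _ (lin_pr gU _)).
apply: (eq_tsum_homog _ hf ht) => [|i j v w e hv hw]; last exact: h hv hw.
by split=> *; apply: (lin_comp (lin_pr gU _)); case: hf.
Qed.

End TensorGrading.
End Gradings.

(** * A tactic for multilinearity *)

Lemma lin_amul_l (k : fieldType) (A : algOps k) (hA : is_algebra A) (c : A) :
  lin (fun x : A => amul x c).
Proof. by case: hA => -[h _] _ _ _ a x y; exact: h. Qed.

Lemma lin_amul_r (k : fieldType) (A : algOps k) (hA : is_algebra A) (c : A) :
  lin (@amul k A c).
Proof. by case: hA => -[_ h] _ _ _ a x y; exact: h. Qed.

Lemma lin_cop (k : fieldType) (C : bialgOps k) (hC : is_coalgebra C) :
  lin (@cop k C).
Proof. by move=> a x y; exact: (coalg_cop_linear hC). Qed.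

Lemma lin_eps (k : fieldType) (C : bialgOps k) (hC : is_coalgebra C) :
  lin (@eps k C : C -> k^o).
Proof. by move=> a x y; exact: (coalg_eps_linear hC). Qed.

Lemma lin_eh_cop (k : fieldType) (A : bialgOps k) (O : extHopfOps A)
    (hC : is_coalgebra (eh_bialg O)) : lin (@eh_cop k A O).
Proof. exact: (lin_cop hC). Qed.

Lemma lin_eh_eps (k : fieldType) (A : bialgOps k) (O : extHopfOps A)
    (hC : is_coalgebra (eh_bialg O)) : lin (@eh_eps k A O : O -> k^o).
Proof. exact: (lin_eps hC). Qed.

Lemma lin_d (k : fieldType) (A : algOps k) (O : extOps A) (hO : is_exterior O) :
  lin (ext_d O).
Proof. by move=> a x y; exact: (ext_d_linear hO). Qed.

Lemma lin_in (k : fieldType) (A : algOps k) (O : extOps A) (hO : is_exterior O) :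
  lin (ext_in O).
Proof. by move=> a x y; exact: (ext_in_linear hO). Qed.

Lemma lin_res (k : fieldType) (A : algOps k) (O : extOps A) (hO : is_exterior O) :
  lin (ext_res O).
Proof.
move=> a x y; apply: (can_inj (ext_res_in hO)).
by rewrite (lin_in hO) !(ext_in_res hO) (lin_pr (ext_grading hO)).
Qed.

(* [lin] proves that an expression is linear, or multilinear, in variables that each
   occur once, by recursion on the expression: [lin_step] handles the operations with
   binders, [lin_leaf] looks up an atomic operation among the hypotheses and in the hint
   database [lin], and [lin_app] views an application as a composition. *)
Create HintDb lin.
#[local] Hint Resolve lin_amul_l lin_amul_r lin_cop lin_eps lin_eh_cop
  lin_eh_eps lin_d lin_in lin_res lin_pr lin_tpr tpr_grading ext_grading
  ext_algebra : lin.

Ltac lin_leaf :=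
  match goal with
  | H : lin ?f |- lin ?f => exact H
  | H : bilin ?F |- lin (fun x => ?F x ?c) => exact (proj1 H c)
  | H : bilin ?F |- lin (?F ?c) => exact (proj2 H c)
  | H : trilin ?F |- lin (fun x => ?F x ?b ?c) => let h := fresh in
      case: H => h _ _; exact (h b c)
  | H : trilin ?F |- lin (fun x => ?F ?b x ?c) => let h := fresh in
      case: H => _ h _; exact (h b c)
  | H : trilin ?F |- lin (?F ?b ?c) => let h := fresh in
      case: H => _ _ h; exact (h b c)
  | H : forall _, bilin _ |- _ =>
      first [exact (proj1 (H _) _) | exact (proj2 (H _) _) | exact (H _)]
  | H : forall _, lin _ |- _ => exact (H _)
  | H : forall _ _ _, lin _ |- _ => exact (H _ _ _)
  | H : forall _ _ _ _, lin _ |- _ => exact (H _ _ _ _)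
  | |- _ => solve [eauto 4 with lin]
  end.

Ltac lin_step :=
  cbv beta;
  match goal with
  | H : bilin ?F |- bilin ?F => exact H
  | |- bilin _ => split; [intro | intro]
  | |- trilin _ => split; intros ? ?
  | |- forall _, _ => intro
  | |- is_grading _ => solve [eauto 4 with lin]
  | |- is_algebra _ => solve [eauto 4 with lin]
  | |- lin (fun x => x) => exact (@lin_id _ _)
  | |- @lin ?k ?V ?U (fun x => ?h x) => progress change (@lin k V U h)
  | |- lin (fun _ => 0) => exact (@lin_cst0 _ _ _)
  | |- lin (fun x => tens (@?f x) ?w) =>
      refine (@lin_comp _ _ _ _ (fun v => tens v w) f (lin_tensl w) _)
  | |- lin (fun x => tens ?v (@?f x)) =>
      refine (@lin_comp _ _ _ _ (fun w => tens v w) f (lin_tensr v) _)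
  | |- lin (tens ?v) => exact (lin_tensr v)
  | |- @lin ?k ?X ?U (fun x => @tsum _ ?V ?W _ ?g (@?t x)) =>
      refine (@lin_comp k X _ U (@tsum k V W U g) t (@lin_tsum k V W U g _) _)
  | |- @lin ?k ?X ?U (fun x => @tsum _ ?V ?W _ (@?g x) ?t) =>
      refine (@lin_tsum_f k V W X U g t _); intros ? ?
  | |- @lin _ _ ?U (@tsum ?k ?V ?W _ ?g) => refine (@lin_tsum k V W U g _)
  | |- lin (fun x => tmap ?f ?g (@?t x)) => unfold tmap
  | |- lin (tmap ?f ?g) => unfold tmap
  | |- lin (fun x => koszul ?p ?q ?g (@?v x) ?w) =>
      refine (@lin_comp _ _ _ _ (fun y => koszul p q g y w) v
                (@lin_koszul_l _ _ _ p q _ _ _ g w _) _)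
  | |- lin (fun x => koszul ?p ?q ?g ?v (@?w x)) =>
      refine (@lin_comp _ _ _ _ (koszul p q g v) w
                (@lin_koszul_r _ _ _ _ p q _ _ g v _) _)
  | |- lin (fun x => koszul ?p ?q (@?g x) ?v ?w) =>
      refine (@lin_koszul_f _ _ _ p q _ _ _ _ g v w _ _)
  | |- lin (koszul ?p ?q ?g ?v) => refine (@lin_koszul_r _ _ _ _ p q _ _ g v _)
  | |- lin (fun x => dsign ?p ?g (@?v x)) =>
      refine (@lin_comp _ _ _ _ (dsign p g) v (@lin_dsign _ _ p _ _ g _) _)
  | |- lin (fun x => dsign ?p (@?g x) ?v) =>
      refine (@lin_dsign_f _ _ p _ _ _ g v _ _)
  | |- lin (dsign ?p ?g) => refine (@lin_dsign _ _ p _ _ g _)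
  | |- lin (fun x => GRing.add (@?f x) (@?g x)) => refine (@lin_add _ _ _ f g _ _)
  | |- lin (fun x => GRing.opp (@?f x)) => refine (@lin_opp _ _ _ f _)
  | |- lin (fun x => GRing.scale ?c (@?f x)) => refine (@lin_scale_v _ _ _ c f _)
  | |- lin (fun x => GRing.scale (@?c x) ?u) => refine (@lin_scale_c _ _ _ c u _)
  | |- lin (GRing.scale ?c) => exact (lin_scale_v c (@lin_id _ _))
  | |- @lin _ ?V _ (GRing.mul ?c) =>
      exact (@lin_mul_r _ V (fun x => x) c (@lin_id _ V))
  | |- lin (fun x => GRing.mul ?c (@?f x)) => refine (@lin_mul_r _ _ f c _)
  | |- lin (fun x => GRing.mul (@?f x) ?c) => refine (@lin_mul_l _ _ f c _)
  end.
Ltac not_id f := lazymatch f with fun x => x => fail | _ => idtac end.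
Ltac lin_app :=
  match goal with
  | |- @lin ?k ?V ?U (fun x => ?h (@?f x)) => not_id f; refine (@lin_comp k V _ U h f _ _)
  | |- @lin ?k ?V ?U (fun x => ?h (@?f x) ?c) =>
      not_id f; refine (@lin_comp k V _ U (fun y => h y c) f _ _)
  | |- @lin ?k ?V ?U (fun x => ?h (@?f x) ?c ?d) =>
      not_id f; refine (@lin_comp k V _ U (fun y => h y c d) f _ _)
  | |- @lin ?k ?V ?U (fun x => ?h (@?f x) ?c ?d ?e) =>
      not_id f; refine (@lin_comp k V _ U (fun y => h y c d e) f _ _)
  end.
(* Redefined whenever a multilinear operation is defined. *)
Ltac lin_unfold := fail.
Ltac lin := first [ lin_step | lin_leaf | lin_unfold | lin_app ]; [> lin ..].

Lemma tensZl (k : fieldType) (V W : lmodType k) a (v : V) (w : W) :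
  (a *: v) \ox w = a *: (v \ox w).
Proof. exact: (linZ _ _ (lin_tensl w)). Qed.

Lemma tensZr (k : fieldType) (V W : lmodType k) a (v : V) (w : W) :
  v \ox (a *: w) = a *: (v \ox w).
Proof. exact: (linZ _ _ (lin_tensr v)). Qed.

Lemma amulZl (k : fieldType) (A : algOps k) a (x y : A) : is_algebra A ->
  amul (a *: x) y = a *: amul x y.
Proof. by move=> hA; exact: (linZ _ _ (lin_amul_l hA y)). Qed.

Lemma amulZr (k : fieldType) (A : algOps k) a (x y : A) : is_algebra A ->
  amul x (a *: y) = a *: amul x y.
Proof. by move=> hA; exact: (linZ _ _ (lin_amul_r hA x)). Qed.

Lemma amulDl (k : fieldType) (A : algOps k) (x y z : A) : is_algebra A ->
  amul (x + y) z = amul x z + amul y z.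
Proof. by move=> hA; exact: (linD _ _ (lin_amul_l hA z)). Qed.

Lemma eq_add (V : nmodType) (a b c d : V) : a = b -> c = d -> a + c = b + d.
Proof. by move=> -> ->. Qed.

Lemma sign_scale (k : fieldType) (V : lmodType k) m n (x y : V) :
  odd m = odd n -> x = y -> (-1) ^+ m *: x = (-1) ^+ n *: y.
Proof. by move=> h ->; rewrite -signr_odd h signr_odd. Qed.

(* [sgn] compares two signed terms by the parity of the exponents of [-1]. *)
Ltac sgn_odd := rewrite ?(oddD, oddM, oddS);
  repeat match goal with |- context [odd ?n] => case: (odd n) end.
Ltac sgn := apply: sign_scale; [sgn_odd | ]; done.

(** * Coalgebras and convolution *)

Section Coalgebra.
Context (k : fieldType) (C : bialgOps k) (hC : is_coalgebra C).

Lemma cop_assoc (U : lmodType k) (F : C -> C -> C -> U) (x : C) : trilin F ->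
  \tsum_(x12, x3 <- cop x) \tsum_(x1, x2 <- cop x12) F x1 x2 x3 =
  \tsum_(x1, x23 <- cop x) \tsum_(x2, x3 <- cop x23) F x1 x2 x3.
Proof.
move=> hF; have h a : bilin (F a) by lin.
have hb : bilin (fun a t => tsum (F a) t) by lin.
have := congr1 (tsum (fun a t => tsum (F a) t)) (coalg_coassoc hC x).
rewrite !tsum_tsum //.
under eq_tsum => x12 x3.
  rewrite tsum_tsum //.
  under eq_tsum => x1 x2 do rewrite tsum_pure // tsum_pure //.
  over.
move=> ->; apply: eq_tsum => x1 x23; rewrite tsum_tsum //; apply: eq_tsum => x2 x3.
by rewrite !tsum_pure.
Qed.

(** In a threefold coproduct the legs may be bracketed in pairs, or with the two inner
    legs together, which is how an identity on adjacent legs gets applied. *)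
Lemma cop_assoc_pairs (U : lmodType k) (F : C -> C -> C -> C -> U) (x : C) :
  (forall b c d, lin (fun a => F a b c d)) -> (forall a c d, lin (fun b => F a b c d)) ->
  (forall a b d, lin (fun c => F a b c d)) -> (forall a b c, lin (F a b c)) ->
  \tsum_(x123, x4 <- cop x) \tsum_(x1, x23 <- cop x123) \tsum_(x2, x3 <- cop x23)
    F x1 x2 x3 x4 =
  \tsum_(x12, x34 <- cop x) \tsum_(x1, x2 <- cop x12) \tsum_(x3, x4 <- cop x34)
    F x1 x2 x3 x4.
Proof.
move=> h1 h2 h3 h4.
under [RHS]eq_tsum => x12 x34 do rewrite tsum_exch.
rewrite -(cop_assoc (F := fun x12 x3 x4 => \tsum_(x1, x2 <- cop x12) F x1 x2 x3 x4));
  last by lin.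
by apply: eq_tsum => x123 x4; rewrite (cop_assoc (F := fun x1 x2 x3 => F x1 x2 x3 x4)) //; lin.
Qed.

Lemma cop_assoc_mid (U : lmodType k) (F : C -> C -> C -> C -> U) (x : C) :
  (forall b c d, lin (fun a => F a b c d)) -> (forall a c d, lin (fun b => F a b c d)) ->
  (forall a b d, lin (fun c => F a b c d)) -> (forall a b c, lin (F a b c)) ->
  \tsum_(x12, x34 <- cop x) \tsum_(x1, x2 <- cop x12) \tsum_(x3, x4 <- cop x34)
    F x1 x2 x3 x4 =
  \tsum_(x1, x234 <- cop x) \tsum_(x23, x4 <- cop x234) \tsum_(x2, x3 <- cop x23)
    F x1 x2 x3 x4.
Proof.
move=> h1 h2 h3 h4.
rewrite (cop_assoc (F := fun x1 x2 x34 => \tsum_(x3, x4 <- cop x34) F x1 x2 x3 x4));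
  last by lin.
apply: eq_tsum => x1 x234.
by rewrite (cop_assoc (F := fun x2 x3 x4 => F x1 x2 x3 x4)) //; lin.
Qed.

Lemma counit_l (U : lmodType k) (f : C -> U) (x : C) : lin f ->
  \tsum_(x1, x2 <- cop x) eps x1 *: f x2 = f x.
Proof.
move=> hf; rewrite -[in RHS](coalg_counit_l hC x) (lin_out _ _ hf).
by apply: eq_tsum => x1 x2; rewrite linZ.
Qed.

Lemma counit_r (U : lmodType k) (f : C -> U) (x : C) : lin f ->
  \tsum_(x1, x2 <- cop x) eps x2 *: f x1 = f x.
Proof.
move=> hf; rewrite -[in RHS](coalg_counit_r hC x) (lin_out _ _ hf).
by apply: eq_tsum => x1 x2; rewrite linZ.
Qed.

(** Convolution with a map [j] that has a convolution inverse [j'] is injective: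
    [G x = G x1 (j x2 (j' x3)) = (G x1 (j x2)) (j' x3)]. Every uniqueness property of
    antipodes below comes from it. *)
Lemma conv_cancel (B : algOps k) (hB : is_algebra B) (j j' G : C -> B) :
  lin j -> lin j' -> lin G ->
  (forall x, \tsum_(x1, x2 <- cop x) amul (j x1) (j' x2) = eps x *: aone B) ->
  (forall x, \tsum_(x1, x2 <- cop x) amul (G x1) (j x2) = 0) ->
  forall x, G x = 0.
Proof.
move=> hj hj' hG hjj hGj x.
rewrite -(counit_r x hG).
under eq_tsum => x1 x2.
  rewrite -[G x1](alg_one_r hB) -amulZr // -hjj (lin_out _ _ (lin_amul_r hB _)).
  under eq_tsum => y1 y2 do rewrite (alg_assoc hB).
  over.
rewrite -cop_assoc; last by lin.
under eq_tsum => x12 x3.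
  rewrite -(lin_out _ (cop x12) (lin_amul_l hB (j' x3))) hGj.
  rewrite (lin0 (lin_amul_l hB _)).
  over.
exact: tsum0.
Qed.

End Coalgebra.

(** * Graded algebras *)

Section Parity.
Context (k : fieldType) (V W U : lmodType k).
Context (pV : nat -> V -> V) (pW : nat -> W -> W) (pU : nat -> U -> U).
Context (gV : is_grading pV) (gW : is_grading pW) (gU : is_grading pU).

Lemma parity_homog n x : homog pV n x -> has_parity pV (odd n) x.
Proof.
by move=> hx i; rewrite (pr_homog gV _ hx); case: (i =P n) => // ->; rewrite eqxx.
Qed.

Lemma parity_bilin (f : V -> W -> U) b c x y : bilin f ->
  (forall m n v w, homog pV m v -> homog pW n w -> homog pU (m + n) (f v w)) ->
  has_parity pV b x -> has_parity pW c y -> has_parity pU (b (+) c) (f x y).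
Proof.
move=> [fl fr] hf hx hy n hn.
have [M hM] := pr_bound gV x; have [N hN] := pr_bound gW y.
rewrite (pr_sum gV hM) (lin_sum _ _ (fl _)) (lin_sum _ _ (lin_pr gU n)) big1 // => i _.
rewrite (pr_sum gW hN) (lin_sum _ _ (fr _)) (lin_sum _ _ (lin_pr gU n)) big1 // => j _.
rewrite (pr_homog gU n (hf _ _ _ _ (homog_pr gV i x) (homog_pr gW j y))).
case: eqP => // nij; have [oi|/hx ->] := eqVneq (odd i) b; last by rewrite (lin0 (fl _)).
have [oj|/hy ->] := eqVneq (odd j) c; last by rewrite (lin0 (fr _)).
by move: hn; rewrite nij oddD oi oj eqxx.
Qed.

Lemma parity_lin (f : V -> U) b x : lin f ->
  (forall n x, homog pV n x -> homog pU n (f x)) ->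
  has_parity pV b x -> has_parity pU b (f x).
Proof.
move=> hl hf hx n hn; have [M hM] := pr_bound gV x.
rewrite (pr_sum gV hM) (lin_sum _ _ hl) (lin_sum _ _ (lin_pr gU n)) big1 // => i _.
rewrite (pr_homog gU n (hf _ _ (homog_pr gV i x))); case: eqP => // ni.
by rewrite hx ?lin0 // -ni.
Qed.

End Parity.

(** ** The super tensor square of a graded algebra *)

Section SuperSquare.
Context (k : fieldType) (E : algOps k) (p : nat -> E -> E).
Context (hE : is_algebra E) (gE : is_grading p).
Context (mul_deg : forall m n x y,
  homog p m x -> homog p n y -> homog p (m + n) (amul x y)).

Lemma bilin_stmul : bilin (@stmul k E E p p).
Proof. by rewrite /stmul; lin. Qed.

Lemma stmul_tens m n a b c d : homog p m b -> homog p n c ->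
  stmul p p (a \ox b) (c \ox d) = (-1) ^+ (m * n) *: (amul a c \ox amul b d).
Proof.
move=> hb hc; rewrite /stmul tsum_pure; last by lin.
rewrite tsum_pure; last by lin.
by rewrite (koszul_homog gE gE _ hb hc) //; lin.
Qed.

Lemma stmul0l a b c d : homog p 0 b ->
  stmul p p (a \ox b) (c \ox d) = amul a c \ox amul b d.
Proof.
move=> hb; move: c; apply: (homog_ext gE) => [||n c hc]; [|by lin|].
  by case: bilin_stmul => h1 h2; lin.
by rewrite (stmul_tens _ _ hb hc) mul0n scale1r.
Qed.

Lemma stmul_assoc x y z :
  stmul p p x (stmul p p y z) = stmul p p (stmul p p x y) z.
Proof.
have [h1 h2] := bilin_stmul.
move: x; apply: (tens_homog_ext gE gE); [by lin|by lin|] => i1 j1 a b ha hb.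
move: y; apply: (tens_homog_ext gE gE); [by lin|by lin|] => i2 j2 c d hc hd.
move: z; apply: (tens_homog_ext gE gE); [by lin|by lin|] => i3 j3 e f he hf.
rewrite (stmul_tens _ _ hd he) (stmul_tens _ _ hb hc).
rewrite (linZ _ _ (h2 _)) (linZ _ _ (h1 _)).
rewrite (stmul_tens _ _ hb (mul_deg hc he)) (stmul_tens _ _ (mul_deg hb hd) he).
rewrite !(alg_assoc hE) !scalerA -!exprD; by sgn.
Qed.

Section Derivation.
Context (d : E -> E) (hd : lin d).
Context (d_deg : forall n x, homog p n x -> homog p n.+1 (d x)).
Context (leibniz : forall n x y, homog p n x ->
  d (amul x y) = amul (d x) y + (-1) ^+ n *: amul x (d y)).

(** The differential [d \ox id + (-1) ^ | | id \ox d]. *)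
Definition dtens (t : tensor E E) : tensor E E :=
  \tsum_(x, y <- t) (d x \ox y + dsign p (fun x => x \ox d y) x).

Lemma bilin_dtens_fun : bilin (fun x y => d x \ox y + dsign p (fun x => x \ox d y) x).
Proof. by split=> [w|v]; lin. Qed.

Lemma lin_dtens : lin dtens.
Proof. exact: (lin_tsum bilin_dtens_fun). Qed.

Lemma dtens_tens m x y : homog p m x ->
  dtens (x \ox y) = d x \ox y + (-1) ^+ m *: (x \ox d y).
Proof.
move=> hx; rewrite /dtens (tsum_pure _ _ bilin_dtens_fun).
by rewrite (@dsign_homog _ _ _ gE _ (fun x => x \ox d y) m x) //; lin.
Qed.

(** The graded Leibniz rule of [dtens] for a left factor of degree zero, which is where
    [d b] enters an induction on the generators. *)
Lemma dtens_mul0 a b y : homog p 0 a -> homog p 0 b ->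
  dtens (stmul p p (a \ox b) y) =
  stmul p p (dtens (a \ox b)) y + stmul p p (a \ox b) (dtens y).
Proof.
move=> ha hb; have [h1 h2] := bilin_stmul; have hD := lin_dtens.
have da := d_deg ha; have db := d_deg hb.
move: y; apply: (tens_homog_ext gE gE); [by lin|by lin|] => i j e f he hf.
rewrite (stmul_tens _ _ hb he) (dtens_tens _ ha) (dtens_tens _ he).
rewrite mul0n !expr0 !scale1r (dtens_tens _ (mul_deg ha he))
  (linD _ _ (h1 _)) (linD _ _ (h2 _)).
rewrite (linZ _ _ (h2 _)) (stmul_tens _ _ hb he) (stmul_tens _ _ db he) (stmul_tens _ _ hb (d_deg he)).
rewrite (stmul_tens _ _ hb he) !mul0n !mul1n !expr0 !scale1r.
rewrite (leibniz _ ha) (leibniz _ hb) !expr0 !scale1r add0n.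
rewrite (linD _ _ (lin_tensl _)) (linD _ _ (lin_tensr _)) scalerDr -!addrA.
by congr (_ + _); rewrite addrCA.
Qed.

End Derivation.
End SuperSquare.

(** ** Exterior algebras are generated in degree zero *)

Section Exterior.
Context (k : fieldType) (A : algOps k) (O : extOps A) (hO : is_exterior O).
Let hA : is_algebra O := ext_algebra hO.
Let gO : is_grading (ext_pr O) := ext_grading hO.

Lemma homog_in a : homog (ext_pr O) 0 (ext_in O a).
Proof. by rewrite /homog -(ext_in_res hO) (ext_res_in hO). Qed.

Lemma homog_one : homog (ext_pr O) 0 (aone O).
Proof. by rewrite -(ext_in_one hO); exact: homog_in. Qed.

Lemma in_res_homog x : homog (ext_pr O) 0 x -> ext_in O (ext_res O x) = x.
Proof. by move=> hx; rewrite (ext_in_res hO). Qed.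

Lemma res_homog n x : homog (ext_pr O) n.+1 x -> ext_res O x = 0.
Proof.
move=> hx; apply: (can_inj (ext_res_in hO)).
by rewrite (ext_in_res hO) (lin0 (lin_in hO)) (pr_homog gO _ hx).
Qed.

Lemma res_d x : ext_res O (ext_d O x) = 0.
Proof.
move: x; apply: (homog_ext gO); [by lin|exact: lin_cst0|] => n x hx.
exact: res_homog (ext_d_degree hO hx).
Qed.

Lemma res_one : ext_res O (aone O) = aone A.
Proof. by rewrite -(ext_in_one hO) (ext_res_in hO). Qed.

Lemma res_mul x y : ext_res O (amul x y) = amul (ext_res O x) (ext_res O y).
Proof.
have hAA := ext_base hO.
move: x y; apply: (homog_ext2 gO gO); [by lin|by lin|] => -[|m] [|n] x y hx hy.
- apply: (can_inj (ext_res_in hO)).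
  by rewrite (ext_in_mul hO) !in_res_homog //; exact: (ext_mul_degree hO hx hy).
- rewrite (res_homog hy) (res_homog (ext_mul_degree hO hx hy)).
  by rewrite (lin0 (lin_amul_r hAA _)).
- rewrite (res_homog hx) (@res_homog m) ?(lin0 (lin_amul_l hAA _)) //.
  by rewrite -[m.+1]addn0; exact: (ext_mul_degree hO hx hy).
- rewrite (res_homog hx) (res_homog (ext_mul_degree hO hx hy)).
  by rewrite (lin0 (lin_amul_l hAA _)).
Qed.

Lemma res_mul_in x a : ext_res O (amul x (ext_in O a)) = amul (ext_res O x) a.
Proof. by rewrite res_mul (ext_res_in hO). Qed.

(** The generation axiom restated with [d A] in place of all one-forms, since the latter
    are sums of products [a . db]. *)
Lemma exterior_ind (P : O -> Prop) :
  (forall c x y, P x -> P y -> P (c *: x + y)) ->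
  (forall x y, P x -> P y -> P (amul x y)) ->
  (forall a, P (ext_in O a)) -> (forall a, P (ext_d O (ext_in O a))) ->
  forall x, P x.
Proof.
move=> hl hm hi hd; apply: (ext_generated hO) => // x /(ext_span1 hO) [s ->].
elim: s => [|[a b] s IH]; last first.
  by rewrite big_cons -[amul _ _]scale1r; apply: hl => //; apply: hm.
by rewrite big_nil -(lin0 (lin_in hO)); exact: hi.
Qed.

(** The identity that propagates a property of left multiplication from [a] to [da]. *)
Lemma d_in_mul a y : amul (ext_d O (ext_in O a)) y =
  ext_d O (amul (ext_in O a) y) - amul (ext_in O a) (ext_d O y).
Proof. by rewrite (ext_leibniz hO _ (homog_in a)) expr0 scale1r addrK. Qed.

End Exterior.

(** ** Maps applied to signed sums *)

Lemma eq_koszul (k : fieldType) (V W U : lmodType k)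
    (pV : nat -> V -> V) (pW : nat -> W -> W) (f g : V -> W -> U) v w :
  (forall v w, f v w = g v w) -> koszul pV pW f v w = koszul pV pW g v w.
Proof. by move=> h; have -> : f = g by apply: funext => u; apply: funext. Qed.

Lemma eq_dsign (k : fieldType) (V U : lmodType k)
    (pV : nat -> V -> V) (f g : V -> U) v :
  (forall v, f v = g v) -> dsign pV f v = dsign pV g v.
Proof. by move=> /funext ->. Qed.

Lemma lin_koszul_out (k : fieldType) (V W X U : lmodType k)
    (pV : nat -> V -> V) (pW : nat -> W -> W)
    (gV : is_grading pV) (gW : is_grading pW) (h : X -> U) (f : V -> W -> X) v w :
  bilin f -> lin h ->
  h (koszul pV pW f v w) = koszul pV pW (fun v w => h (f v w)) v w.
Proof.
move=> hf hh; have hfh : bilin (fun v w => h (f v w)) by lin.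
have [M hM] := pr_bound gV v; have [N hN] := pr_bound gW w.
rewrite (koszul_sum hf hM hN) (koszul_sum hfh hM hN) lin_sum //.
by apply: eq_bigr => i _; rewrite lin_sum //; apply: eq_bigr => j _; rewrite linZ.
Qed.

Lemma koszul_tsum (k : fieldType) (V W X Y U : lmodType k)
    (pV : nat -> V -> V) (pW : nat -> W -> W)
    (gV : is_grading pV) (gW : is_grading pW) (f : X -> Y -> V -> W -> U) t v w :
  (forall x y, bilin (f x y)) ->
  koszul pV pW (fun v w => tsum (fun x y => f x y v w) t) v w =
  tsum (fun x y => koszul pV pW (f x y) v w) t.
Proof.
move=> hf; have hf' : bilin (fun v w => tsum (fun x y => f x y v w) t).
  by split=> [w'|v']; apply: lin_tsum_f => x y; [exact: (proj1 (hf _ _))|exact: (proj2 (hf _ _))].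
have [M hM] := pr_bound gV v; have [N hN] := pr_bound gW w.
rewrite (koszul_sum hf' hM hN).
under [RHS]eq_tsum => x y do rewrite (koszul_sum (hf x y) hM hN).
rewrite [RHS]exchange_big; apply: eq_bigr => i _.
by rewrite [RHS]exchange_big; apply: eq_bigr => j _; rewrite -tsumZ.
Qed.

Lemma lin_dsign_out (k : fieldType) (V X U : lmodType k)
    (pV : nat -> V -> V) (gV : is_grading pV) (h : X -> U) (f : V -> X) v :
  lin f -> lin h -> h (dsign pV f v) = dsign pV (fun v => h (f v)) v.
Proof.
move=> hf hh; have hfh : lin (fun v => h (f v)) by lin.
have [M hM] := pr_bound gV v.
rewrite (dsign_sum hf hM) (dsign_sum hfh hM) lin_sum //.
by apply: eq_bigr => i _; rewrite linZ.
Qed.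

Lemma eq_dsign0 (k : fieldType) (V U : lmodType k)
    (pV : nat -> V -> V) (gV : is_grading pV) (f : V -> U) v : lin f ->
  (forall m v, homog pV m v -> odd m -> f v = 0) -> dsign pV f v = f v.
Proof.
move=> hf h; have hd := lin_dsign gV hf.
move: v; apply: (homog_ext gV) => // m v hv; rewrite (dsign_homog gV hf hv).
by rewrite -signr_odd; case om: (odd m); rewrite ?scale1r // (h _ _ hv om) scaler0.
Qed.

(** * Strongly bicovariant exterior algebras *)

Section Coactions.
Context (k : fieldType) (A : bialgOps k) (O : extHopfOps A).

(** Since [ext_res] kills positive degrees, these are the left and right coactions
    of [A] on [Omega(A)], and they carry no signs. *)
Definition lco (U : nmodType) (F : A -> O -> U) (x : O) : U :=
  \tsum_(x1, x2 <- eh_cop x) F (ext_res O x1) x2.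

Definition rco (U : nmodType) (F : O -> A -> U) (x : O) : U :=
  \tsum_(x1, x2 <- eh_cop x) F x1 (ext_res O x2).

End Coactions.

Ltac lin_unfold ::= progress unfold lco, rco.

Section Bicovariant.
Context (k : fieldType) (A : bialgOps k) (O : extHopfOps A).
Context (hO : is_strongly_bicovariant O).
Implicit Types (U : lmodType k) (a b : A) (x y : O).

Local Notation p := (ext_pr O).
Local Notation d := (ext_d O).
Local Notation res := (ext_res O).
Local Notation inA := (ext_in O).

Let hE : is_exterior O := sb_exterior hO.
Let hAlg : is_algebra O := ext_algebra hE.
Let hAA : is_algebra A := ext_base hE.
Let gO : is_grading p := ext_grading hE.
Let hBA : is_bialgebra A := proj1 (sb_base hO).
Let hCA : is_coalgebra A := bialg_coalgebra hBA.
Let hSH : is_super_bialgebra (eh_bialg O) p := proj1 (sb_super_hopf hO).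
Let hC : is_coalgebra (eh_bialg O) := sbialg_coalgebra hSH.

Lemma eh_assoc U (F : O -> O -> O -> U) x : trilin F ->
  \tsum_(x12, x3 <- eh_cop x) \tsum_(x1, x2 <- eh_cop x12) F x1 x2 x3 =
  \tsum_(x1, x23 <- eh_cop x) \tsum_(x2, x3 <- eh_cop x23) F x1 x2 x3.
Proof. exact: (cop_assoc hC). Qed.

Lemma eh_counit_l U (f : O -> U) x : lin f ->
  \tsum_(x1, x2 <- eh_cop x) eh_eps x1 *: f x2 = f x.
Proof. exact: (counit_l hC). Qed.

Lemma eh_counit_r U (f : O -> U) x : lin f ->
  \tsum_(x1, x2 <- eh_cop x) eh_eps x2 *: f x1 = f x.
Proof. exact: (counit_r hC). Qed.

Lemma eps_odd n x : homog p n x -> odd n -> eh_eps x = 0 :> k.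
Proof.
move=> hx on; apply: (sbialg_eps_even hSH).
by rewrite -on; exact: (parity_homog gO hx).
Qed.

(** Applying the counit to the first leg of [cop (d x)] gives [d x] again plus
    [eps (d x1) x2], so the latter vanishes; apply the counit once more. The sign in
    [cop (d x)] does not matter because the counit vanishes in odd degree. *)
Lemma eps_d x : eh_eps (d x) = 0 :> k.
Proof.
have H y : \tsum_(y1, y2 <- eh_cop y) eh_eps (d y1) *: y2 = 0.
  have := @eh_counit_l O id (d y) (@lin_id _ _); rewrite /= (sb_cop_d hO).
  have hb := bilin_dtens_fun gO (lin_d hE).
  rewrite tsum_tsum; last by lin.
  under eq_tsum => y1 y2.
    rewrite (linD _ _ (lin_tsum _)); last by lin.
    rewrite tsum_pure; last by lin.
    rewrite (lin_dsign_out gO); [|by lin|by lin].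
    rewrite eq_dsign0 //; last 2 first.
    - by lin.
    - move=> m v hv om; rewrite tsum_pure; last by lin.
      by rewrite (eps_odd hv om) scale0r.
    rewrite tsum_pure; last by lin.
    over.
  rewrite tsumD eh_counit_l; last by lin.
  by move=> h; apply: (@addIr _ (d y)); rewrite h add0r.
have := congr1 (@eh_eps k A O) (H x).
rewrite (lin_out _ _ (lin_eh_eps hC)) (lin0 (lin_eh_eps hC)) => <-.
rewrite -[in LHS](@eh_counit_r O id x (@lin_id _ _)) (lin_out _ _ (lin_d hE)).
rewrite (lin_out _ _ (lin_eh_eps hC)); apply: eq_tsum => x1 x2.
rewrite (linZ _ _ (lin_d hE)) !(linZ _ _ (lin_eh_eps hC)).
exact: mulrC.
Qed.

Lemma tsum_cop_in U (F : O -> O -> U) a : bilin F ->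
  tsum F (eh_cop (inA a)) = \tsum_(a1, a2 <- cop a) F (inA a1) (inA a2).
Proof. by move=> hF; rewrite (sb_cop_restr hO) tsum_tmap. Qed.

(** A counit is determined by its coproduct. *)
Lemma eps_in a : eh_eps (inA a) = eps a.
Proof.
have H : \tsum_(a1, a2 <- cop a) eh_eps (inA a1) *: a2 = a.
  apply: (can_inj (ext_res_in hE)); rewrite (lin_out _ _ (lin_in hE)).
  rewrite -[RHS](@eh_counit_l O id (inA a) (@lin_id _ _)) tsum_cop_in; last by lin.
  by apply: eq_tsum => a1 a2; rewrite (linZ _ _ (lin_in hE)).
rewrite -[in RHS]H (lin_out _ _ (lin_eps hCA)).
rewrite -[in LHS](coalg_counit_r hCA a) (lin_out _ _ (lin_in hE)).
rewrite (lin_out _ _ (lin_eh_eps hC)); apply: eq_tsum => a1 a2.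
rewrite (linZ _ _ (lin_in hE)) (linZ _ _ (lin_eh_eps hC)) (linZ _ _ (lin_eps hCA)).
exact: mulrC.
Qed.

(** Both sides are multiplicative and vanish on [d A], so they agree on generators. *)
Lemma eps_res x : eh_eps x = eps (res x).
Proof.
move: x; apply: (exterior_ind hE) => [c x y hx hy|x y hx hy|a|a].
- by rewrite (lin_eh_eps hC) (lin_res hE) (lin_eps hCA) hx hy.
- have := sbialg_eps_mul hSH x y; rewrite /= => ->.
  by rewrite (res_mul hE) (bialg_eps_mul hBA) hx hy.
- by rewrite (ext_res_in hE) eps_in.
- by rewrite eps_d (res_d hE) (lin0 (lin_eps hCA)).
Qed.

(** In a coproduct both of whose legs are projected to degree zero, only the degree
    zero part matters. *)
Lemma res_cop U (F : A -> A -> U) x : bilin F ->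
  \tsum_(x1, x2 <- eh_cop x) F (res x1) (res x2) = tsum F (cop (res x)).
Proof.
move=> hF; move: x; apply: (homog_ext gO); [by lin|by lin|] => -[|n] x hx.
  rewrite -{1}(in_res_homog hE hx) tsum_cop_in; last by lin.
  by apply: eq_tsum => a1 a2; rewrite !(ext_res_in hE).
rewrite (res_homog hE hx) (lin0 (lin_cop hCA)) (lin0 (lin_tsum hF)).
rewrite -[RHS](tsum0 U (eh_cop x)).
apply: (eq_tsum_homog gO gO _ _ (sb_cop_degree hO hx)); [by lin|by split=> *; exact: lin_cst0|].
move=> [|i] j v w e hv hw.
  have [h1 h2] := hF.
  by move: hw; rewrite -[j]/(0 + j)%N e => hw; rewrite (res_homog hE hw) (lin0 (h2 _)).
by have [h1 _] := hF; rewrite (res_homog hE hv) (lin0 (h1 _)).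
Qed.

Lemma lco_in U (F : A -> O -> U) a : bilin F ->
  lco F (inA a) = \tsum_(a1, a2 <- cop a) F a1 (inA a2).
Proof.
move=> hF; rewrite /lco tsum_cop_in; last by lin.
by apply: eq_tsum => a1 a2; rewrite (ext_res_in hE).
Qed.

Lemma rco_in U (F : O -> A -> U) a : bilin F ->
  rco F (inA a) = \tsum_(a1, a2 <- cop a) F (inA a1) a2.
Proof.
move=> hF; rewrite /rco tsum_cop_in; last by lin.
by apply: eq_tsum => a1 a2; rewrite (ext_res_in hE).
Qed.

Lemma tsum_cop_one U (F : O -> O -> U) : bilin F ->
  tsum F (eh_cop (aone O)) = F (aone O) (aone O).
Proof.
move=> hF; have := sbialg_cop_one hSH; rewrite /= => ->; exact: tsum_pure.
Qed.

Lemma lco_one U (F : A -> O -> U) : bilin F -> lco F (aone O) = F (aone A) (aone O).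
Proof.
by move=> hF; rewrite /lco tsum_cop_one; [rewrite (res_one hE)|lin].
Qed.

Lemma rco_one U (F : O -> A -> U) : bilin F -> rco F (aone O) = F (aone O) (aone A).
Proof.
by move=> hF; rewrite /rco tsum_cop_one; [rewrite (res_one hE)|lin].
Qed.

Lemma tsum_cop_mul U (F : O -> O -> U) x y : bilin F ->
  tsum F (eh_cop (amul x y)) =
  \tsum_(x1, x2 <- eh_cop x) \tsum_(y1, y2 <- eh_cop y)
    koszul p p (fun x2 y1 => F (amul x1 y1) (amul x2 y2)) x2 y1.
Proof.
move=> hF; have := sbialg_cop_mul hSH x y; rewrite /= => ->.
rewrite /stmul tsum_tsum //; apply: eq_tsum => x1 x2.
rewrite tsum_tsum //; apply: eq_tsum => y1 y2.
rewrite (lin_koszul_out gO gO); [|by lin|by lin].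
apply: eq_koszul => u v.
by rewrite tsum_pure.
Qed.

(** The product of the coproducts of [x] and [y] has the sign [(-1) ^ (|x2| |y1|)], and the
    projection makes [y1] of degree zero. *)
Lemma lco_mul U (F : A -> O -> U) x y : bilin F ->
  lco F (amul x y) = lco (fun a x' => lco (fun b y' => F (amul a b) (amul x' y')) y) x.
Proof.
move=> hF; rewrite /lco tsum_cop_mul; last by lin.
apply: eq_tsum => x1 x2; apply: eq_tsum => y1 y2.
rewrite (eq_koszul0 gO gO) => [||m n v w hv hw]; first by rewrite (res_mul hE).
  by lin.
case: n hw => [|n] hw; rewrite ?muln0 // => _.
by rewrite (res_mul hE) (res_homog hE hw) (lin0 (lin_amul_r hAA _)) (lin0 (proj1 hF _)).
Qed.

(** The same with [x2] of degree zero. *)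
Lemma rco_mul U (F : O -> A -> U) x y : bilin F ->
  rco F (amul x y) = rco (fun x' a => rco (fun y' b => F (amul x' y') (amul a b)) y) x.
Proof.
move=> hF; rewrite /rco tsum_cop_mul; last by lin.
apply: eq_tsum => x1 x2; apply: eq_tsum => y1 y2.
rewrite (eq_koszul0 gO gO) => [||m n v w hv hw]; first by rewrite (res_mul hE).
  by lin.
case: m hv => [|n'] hv; rewrite ?mul0n // => _.
by rewrite (res_mul hE) (res_homog hE hv) (lin0 (lin_amul_l hAA _)) (lin0 (proj2 hF _)).
Qed.

Lemma lco_coassoc U (F : A -> A -> O -> U) x : trilin F ->
  lco (fun a x' => lco (F a) x') x =
  lco (fun a x' => \tsum_(a1, a2 <- cop a) F a1 a2 x') x.
Proof.
move=> hF; rewrite /lco -eh_assoc; last by lin.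
by apply: eq_tsum => x1 x2; rewrite (res_cop (F := fun a1 a2 => F a1 a2 x2)); last by lin.
Qed.

Lemma rco_coassoc U (F : O -> A -> A -> U) x : trilin F ->
  rco (fun x' b => rco (fun x'' a => F x'' a b) x') x =
  rco (fun x' a => \tsum_(a1, a2 <- cop a) F x' a1 a2) x.
Proof.
move=> hF; rewrite /rco eh_assoc; last by lin.
by apply: eq_tsum => x1 x2; rewrite (res_cop (F := fun a1 a2 => F x1 a1 a2)); last by lin.
Qed.

Lemma lco_rco U (F : A -> O -> A -> U) x : trilin F ->
  lco (fun a x' => rco (F a) x') x = rco (fun x' b => lco (fun a x'' => F a x'' b) x') x.
Proof. by move=> hF; rewrite /lco /rco -eh_assoc //; lin. Qed.

(** Of the two terms of [d \ox id + (-1) ^ | | id \ox d], the one that differentiates the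
    projected leg vanishes. *)
Lemma lco_d U (F : A -> O -> U) x : bilin F ->
  lco F (d x) = lco (fun a x' => F a (d x')) x.
Proof.
move=> hF; have hb := bilin_dtens_fun gO (lin_d hE).
have [h1 h2] := hF.
rewrite /lco (sb_cop_d hO) tsum_tsum; last by lin.
apply: eq_tsum => x1 x2; rewrite (linD _ _ (lin_tsum _)); last by lin.
rewrite tsum_pure; last by lin.
rewrite (res_d hE) (lin0 (h1 _)) add0r (lin_dsign_out gO); [|by lin|by lin].
rewrite eq_dsign0 // => [||m v hv om]; first by rewrite tsum_pure //; lin.
  by lin.
rewrite tsum_pure; last by lin.
by case: m om hv => // m _ hv; rewrite (res_homog hE hv) (lin0 (h1 _)).
Qed.

Lemma rco_d U (F : O -> A -> U) x : bilin F ->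
  rco F (d x) = rco (fun x' b => F (d x') b) x.
Proof.
move=> hF; have hb := bilin_dtens_fun gO (lin_d hE).
have [h1 h2] := hF.
rewrite /rco (sb_cop_d hO) tsum_tsum; last by lin.
apply: eq_tsum => x1 x2; rewrite (linD _ _ (lin_tsum _)); last by lin.
rewrite tsum_pure; last by lin.
rewrite (lin_dsign_out gO); [|by lin|by lin].
have Z (v : O) : tsum (fun x0 x3 : O => F x0 (res x3)) (v \ox d x2) = 0.
  by rewrite tsum_pure; [rewrite (res_d hE) (lin0 (h2 _))|lin].
rewrite eq_dsign0 ?Z ?addr0 //; first by lin.
Qed.

(** The coactions preserve the degree, the projected leg having degree zero. *)
Lemma eq_lco U (F G : A -> O -> U) n x : bilin F -> bilin G -> homog p n x ->
  (forall a x', homog p n x' -> F a x' = G a x') -> lco F x = lco G x.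
Proof.
move=> hF hG hx h; rewrite /lco; apply: (eq_tsum_homog gO gO _ _ (sb_cop_degree hO hx)).
- by lin.
- by lin.
move=> [|i] j v w e hv hw; first by apply: h; rewrite -e.
by rewrite (res_homog hE hv) (lin0 (proj1 hF _)) (lin0 (proj1 hG _)).
Qed.

Lemma eq_rco U (F G : O -> A -> U) n x : bilin F -> bilin G -> homog p n x ->
  (forall x' a, homog p n x' -> F x' a = G x' a) -> rco F x = rco G x.
Proof.
move=> hF hG hx h; rewrite /rco; apply: (eq_tsum_homog gO gO _ _ (sb_cop_degree hO hx)).
- by lin.
- by lin.
move=> i [|j] v w e hv hw; first by apply: h; rewrite -e addn0.
by rewrite (res_homog hE hw) (lin0 (proj2 hF _)) (lin0 (proj2 hG _)).
Qed.

Lemma lco_counit U (f : O -> U) x : lin f -> lco (fun a x' => eps a *: f x') x = f x.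
Proof.
move=> hf; rewrite -[RHS](eh_counit_l x hf) /lco.
by apply: eq_tsum => x1 x2; rewrite eps_res.
Qed.

Lemma rco_counit U (f : O -> U) x : lin f -> rco (fun x' a => eps a *: f x') x = f x.
Proof.
move=> hf; rewrite -[RHS](eh_counit_r x hf) /rco.
by apply: eq_tsum => x1 x2; rewrite eps_res.
Qed.

Section Antipode.
Context (S : A -> A) (hS : is_antipode A S).
Context (SO : O -> O) (hSO : is_super_antipode (eh_bialg O) p SO).

Let linS : lin S.
Proof. by move=> c x y; exact: (antip_linear hS). Qed.

Lemma lin_SO : lin SO.
Proof. by move=> c x y; exact: (antip_linear (proj1 hSO)). Qed.

Let linSO := lin_SO.

Lemma SO_l x : \tsum_(x1, x2 <- eh_cop x) amul (SO x1) x2 = eh_eps x *: aone O.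
Proof. exact: (antip_l (proj1 hSO)). Qed.

Lemma SO_r x : \tsum_(x1, x2 <- eh_cop x) amul x1 (SO x2) = eh_eps x *: aone O.
Proof. exact: (antip_r (proj1 hSO)). Qed.

(** Both sides are left convolution inverses of the inclusion of [A]. *)
Lemma SO_in a : SO (inA a) = inA (S a).
Proof.
pose G a := SO (inA a) - inA (S a).
suff: G a = 0 by move/eqP; rewrite subr_eq0 => /eqP.
apply: (conv_cancel hCA hAlg (j := inA) (j' := fun a => inA (S a))) => //; rewrite /G.
- by lin.
- by lin.
- by lin.
- move=> {}a; have := antip_r hS a => /(congr1 inA).
  rewrite (lin_out _ _ (lin_in hE)) (linZ _ _ (lin_in hE)) (ext_in_one hE) => <-.
  by apply: eq_tsum => a1 a2; rewrite (ext_in_mul hE).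
- move=> {}a; under eq_tsum => a1 a2 do rewrite (linB _ _ (lin_amul_l hAlg _)).
  have := SO_l (inA a); rewrite tsum_cop_in; last by lin.
  rewrite tsumB eps_in => ->; apply/eqP; rewrite subr_eq0; apply/eqP.
  have := antip_l hS a => /(congr1 inA).
  rewrite (lin_out _ _ (lin_in hE)) (linZ _ _ (lin_in hE)) (ext_in_one hE) => <-.
  by apply: eq_tsum => a1 a2; rewrite (ext_in_mul hE).
Qed.

Lemma SO_unique (G : O -> O) : lin G ->
  (forall x, \tsum_(x1, x2 <- eh_cop x) amul (G x1) x2 = 0) -> forall x, G x = 0.
Proof.
move=> hG h; apply: (conv_cancel hC hAlg (j := id) (j' := SO)) => //.
exact: SO_r.
Qed.

Lemma eps_homog n x : homog p n.+1 x -> eh_eps x = 0 :> k.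
Proof. by move=> hx; rewrite eps_res (res_homog hE hx) (lin0 (lin_eps hCA)). Qed.

Lemma pr_mul_r i j y z : homog p j z -> p (i + j)%N (amul y z) = amul (p i y) z.
Proof.
move=> hz; move: y; apply: (homog_ext gO) => [||l y hy]; [by lin|by lin|].
rewrite (pr_homog gO _ (ext_mul_degree hE hy hz)) (pr_homog gO _ hy) eqn_add2r.
by case: ifP => // _; rewrite (lin0 (lin_amul_l hAlg z)).
Qed.

(** The degree [n] part of [S x1 * x2 = eps x] shows that the degree-preserving part of the
    antipode is also a left convolution inverse of the identity. *)
Lemma SO_homog n x : homog p n x -> homog p n (SO x).
Proof.
pose T y := \sum_(m \in [set: nat]) p m (SO (p m y)).
have linp m : lin (fun y => p m (SO y)) by lin.
have linT : lin T by exact: (lin_fsum_pr gO linp).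
have TE m y : homog p m y -> T y = p m (SO y) by exact: (fsum_pr_homog gO linp).
suff H y : SO y - T y = 0.
  by move=> hx; rewrite /homog -(TE _ _ hx); apply/esym/eqP; rewrite -subr_eq0 H.
apply: (SO_unique (G := fun y => SO y - T y)) => {n x}[|{}y]; first by lin.
move: y; apply: (homog_ext gO) => [||n y hy]; [by lin|exact: lin_cst0|].
under eq_tsum => y1 y2 do rewrite (linB _ _ (lin_amul_l hAlg y2)).
rewrite tsumB SO_l; apply/eqP; rewrite subr_eq0; apply/eqP.
have -> : eh_eps y *: aone O = p n (eh_eps y *: aone O).
  case: n hy => [|n] hy; first by rewrite (linZ _ _ (lin_pr gO _)) (homog_one hE).
  by rewrite (eps_homog hy) scale0r (lin0 (lin_pr gO _)).
rewrite -SO_l (lin_out _ _ (lin_pr gO n)).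
apply: (eq_tsum_homog gO gO _ _ (sb_cop_degree hO hy)) => [||i j v w <- hv hw].
- by lin.
- by lin.
by rewrite (TE _ _ hv) (pr_mul_r _ _ hw).
Qed.

Lemma d_one : d (aone O) = 0.
Proof.
have := ext_leibniz hE (aone O) (homog_one hE).
rewrite expr0 scale1r (alg_one_l hAlg) (alg_one_r hAlg) (alg_one_l hAlg).
by move=> h; apply: (@addrI _ (d (aone O))); rewrite -h addr0.
Qed.

(** Applying [d] to [S x1 * x2 = eps x] and replacing [x] by [d x] in it give two relations,
    whose difference is [(d (S x1) - S (d x1)) * x2 = 0]. *)
Lemma SO_d x : d (SO x) = SO (d x).
Proof.
have hb := bilin_dtens_fun gO (lin_d hE).
suff: d (SO x) - SO (d x) = 0 by move/eqP; rewrite subr_eq0 => /eqP.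
apply: (SO_unique (G := fun y => d (SO y) - SO (d y))) => {x}[|x]; first by lin.
under eq_tsum => x1 x2 do rewrite (linB _ _ (lin_amul_l hAlg x2)).
rewrite tsumB; apply/eqP; rewrite subr_eq0; apply/eqP.
pose rest := \tsum_(x1, x2 <- eh_cop x) dsign p (fun x1 => amul (SO x1) (d x2)) x1.
apply: (@addIr _ rest); rewrite /rest -!tsumD.
have := SO_l (d x); rewrite eps_d scale0r (sb_cop_d hO) tsum_tsum; last by lin.
move=> h; transitivity (0 : O); last first.
  rewrite -h; apply: eq_tsum => x1 x2; rewrite (linD _ _ (lin_tsum _)); last by lin.
  rewrite tsum_pure; last by lin.
  rewrite (lin_dsign_out gO); [|by lin|by lin].
  congr (_ + _); apply: eq_dsign => u; rewrite tsum_pure //; by lin.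
have := congr1 d (SO_l x); rewrite (linZ _ _ (lin_d hE)) d_one scaler0 => <-.
rewrite (lin_out _ _ (lin_d hE)); apply: eq_tsum => x1 x2.
move: x1; apply: (homog_ext gO) => [||n x1 hx]; [by lin|by lin|].
rewrite (ext_leibniz hE _ (SO_homog hx)) (dsign_homog gO _ hx) //; by lin.
Qed.

Lemma tsum_cop_in_mul U (F : O -> O -> U) a z : bilin F ->
  tsum F (eh_cop (amul (inA a) z)) =
  \tsum_(a1, a2 <- cop a) \tsum_(z1, z2 <- eh_cop z)
     F (amul (inA a1) z1) (amul (inA a2) z2).
Proof.
move=> hF; rewrite tsum_cop_mul // tsum_cop_in; last by lin.
apply: eq_tsum => a1 a2; apply: eq_tsum => z1 z2.
by rewrite (koszul0l gO gO) //; [lin|exact: homog_in].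
Qed.

(** Both sides are left convolution inverses of [a, z |-> a * z]. As [a] has degree zero,
    there are no signs. *)
Lemma SO_mul_in a z : SO (amul (inA a) z) = amul (SO z) (SO (inA a)).
Proof.
pose G a z := SO (amul (inA a) z) - amul (SO z) (SO (inA a)).
have hG : bilin G by rewrite /G; split=> [w|v]; lin.
suff: G a z = 0 by move/eqP; rewrite subr_eq0 => /eqP.
have H b y : \tsum_(b1, b2 <- cop b) \tsum_(y1, y2 <- eh_cop y)
    amul (G b1 y1) (amul (inA b2) y2) = 0.
  under eq_tsum => b1 b2 do
    under eq_tsum => y1 y2 do rewrite (linB _ _ (lin_amul_l hAlg _)).
  under eq_tsum => b1 b2 do rewrite tsumB.
  rewrite tsumB; apply/eqP; rewrite subr_eq0; apply/eqP.
  rewrite -(@tsum_cop_in_mul _ (fun x1 x2 => amul (SO x1) x2)); last by lin.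
  rewrite SO_l eps_res (res_mul hE) (bialg_eps_mul hBA) (ext_res_in hE) -eps_res.
  rewrite tsum_exch.
  under eq_tsum => y1 y2.
    under eq_tsum => b1 b2 do
      rewrite -(alg_assoc hAlg) [amul (SO (inA b1)) _](alg_assoc hAlg) (alg_assoc hAlg).
    rewrite -(lin_out _ (cop b) (f := fun u => amul (amul (SO y1) u) y2)); last by lin.
    rewrite -(@tsum_cop_in _ (fun x1 x2 => amul (SO x1) x2)); last by lin.
    rewrite SO_l eps_in amulZr // amulZl // (alg_one_r hAlg).
    over.
  by rewrite tsumZ SO_l scalerA.
have H' b y : \tsum_(b1, b2 <- cop b) amul (G b1 y) (inA b2) = 0.
  apply: (SO_unique (G := fun y => \tsum_(b1, b2 <- cop b) amul (G b1 y) (inA b2))).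
    by lin.
  move=> {}y; rewrite -[RHS](H b y) tsum_exch; apply: eq_tsum => y1 y2.
  rewrite (lin_out _ _ (lin_amul_l hAlg _)); apply: eq_tsum => b1 b2.
  by rewrite (alg_assoc hAlg).
apply: (conv_cancel hCA hAlg (G := fun b => G b z) (j := inA)
  (j' := fun a => inA (S a))) => //; first by lin.
- by lin.
- by lin.
move=> {}a; have := antip_r hS a => /(congr1 inA).
rewrite (lin_out _ _ (lin_in hE)) (linZ _ _ (lin_in hE)) (ext_in_one hE) => <-.
by apply: eq_tsum => a1 a2; rewrite (ext_in_mul hE).
Qed.

Lemma res_SO x : res (SO x) = S (res x).
Proof.
move: x; apply: (homog_ext gO) => [||[|n] x hx]; [by lin|by lin| |].
  by rewrite -{1}(in_res_homog hE hx) SO_in (ext_res_in hE).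
by rewrite (res_homog hE hx) (lin0 linS) (res_homog hE (SO_homog hx)).
Qed.

End Antipode.
End Bicovariant.

(** * Antipodes and the universal R-form *)

Section TensorSquareAlgebra.
Context (k : fieldType) (A : algOps k) (hA : is_algebra A).

Definition tsquare : algOps k := AlgOps (@tmul k A A) (aone A \ox aone A).

Lemma bilin_tmul : bilin (@tmul k A A).
Proof. by rewrite /tmul; lin. Qed.

Lemma tmul_tens (a b c d : A) :
  tmul (a \ox b) (c \ox d) = amul a c \ox amul b d.
Proof. by rewrite /tmul !tsum_pure //; lin. Qed.

Lemma tsquare_algebra : is_algebra tsquare.
Proof.
have [h1 h2] := bilin_tmul; split=> [|x y z|x|x] /=.
- by apply/bilin_for; exact: bilin_tmul.
- move: x; apply: tens_ext => [||a b]; [by lin|by lin|].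
  move: y; apply: tens_ext => [||c d]; [by lin|by lin|].
  move: z; apply: tens_ext => [||e f]; [by lin|by lin|].
  by rewrite !tmul_tens !(alg_assoc hA).
- move: x; apply: tens_ext => [||a b]; [by lin|by lin|].
  by rewrite tmul_tens !(alg_one_l hA).
- move: x; apply: tens_ext => [||a b]; [by lin|by lin|].
  by rewrite tmul_tens !(alg_one_r hA).
Qed.

End TensorSquareAlgebra.

Section RForm.
Context (k : fieldType) (A : bialgOps k) (S : A -> A) (R : A -> A -> k).
Context (hR : is_coquasitriangular A R) (hS : is_antipode A S).
Implicit Types (a b c : A) (U : lmodType k).

Let hBA : is_bialgebra A := proj1 (cqt_hopf hR).
Let hAA : is_algebra A := bialg_algebra hBA.
Let hCA : is_coalgebra A := bialg_coalgebra hBA.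

Lemma lin_S : lin S.
Proof. by move=> c x y; exact: (antip_linear hS). Qed.

Let linS := lin_S.

Lemma bilin_R : bilin (R : A -> A -> k^o).
Proof.
have [h1 h2] := cqt_bilinear hR.
by split=> [w|v] a x y; [exact: h1|exact: h2].
Qed.

Let bR := bilin_R.

(** Apply the counit to [S a1 * a2 = eps a]. *)
Lemma eps_S a : eps (S a) = eps a.
Proof.
have /(congr1 (@eps k A)) := antip_l hS a.
rewrite (lin_out _ _ (lin_eps hCA)) (linZ _ _ (lin_eps hCA)) (bialg_eps_one hBA).
rewrite [_ *: _]mulr1 => <-.
rewrite -[in LHS](coalg_counit_r hCA a) (lin_out _ _ linS) (lin_out _ _ (lin_eps hCA)).
apply: eq_tsum => a1 a2.
by rewrite (linZ _ _ linS) (linZ _ _ (lin_eps hCA)) (bialg_eps_mul hBA); exact: mulrC.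
Qed.

(** The antipode reverses the coproduct, because both sides of the equation are
    convolution inverse to the coproduct in [Hom(A, A \ox A)]. *)
Lemma cop_S U (F : A -> A -> U) a : bilin F ->
  tsum F (cop (S a)) = \tsum_(a1, a2 <- cop a) F (S a2) (S a1).
Proof.
move=> hF; have hT := tsquare_algebra hAA; have [t1 t2] := bilin_tmul hAA.
pose G a := cop (S a) - \tsum_(a1, a2 <- cop a) S a2 \ox S a1.
have hG : lin G by rewrite /G; lin.
suff /eqP : G a = 0.
  rewrite subr_eq0 => /eqP ->; rewrite tsum_tsum //.
  by apply: eq_tsum => a1 a2; rewrite tsum_pure.
apply: (conv_cancel hCA hT (j := @cop k A) (j' := fun a => cop (S a))) => //; first by lin.
- by lin.
- move=> {}a /=; rewrite -(bialg_cop_one hBA) -(linZ _ _ (lin_cop hCA)) -(antip_r hS).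
  rewrite (lin_out _ _ (lin_cop hCA)); apply: eq_tsum => a1 a2.
  by rewrite (bialg_cop_mul hBA).
move=> {}a /=; under eq_tsum => a1 a2 do rewrite (linB _ _ (t1 _)).
rewrite tsumB; apply/eqP; rewrite subr_eq0; apply/eqP.
transitivity (eps a *: (aone A \ox aone A)).
  rewrite -(bialg_cop_one hBA) -(linZ _ _ (lin_cop hCA)) -(antip_l hS).
  rewrite (lin_out _ _ (lin_cop hCA)); apply: eq_tsum => a1 a2.
  by rewrite (bialg_cop_mul hBA).
apply: esym.
have E x y : tmul (S y \ox S x : tensor A A) = fun t => \tsum_(u, v <- t) amul (S y) u \ox amul (S x) v.
  apply: funext => t; rewrite -[in LHS](tsum_id t) (lin_out _ _ (t2 _)).
  by apply: eq_tsum => u v; rewrite tmul_tens.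
under eq_tsum => a1 a2.
  rewrite (lin_out _ _ (t1 _)).
  under eq_tsum => x y do rewrite E.
  over.
rewrite (cop_assoc hCA (F := fun x y a2 =>
  \tsum_(u, v <- cop a2) amul (S y) u \ox amul (S x) v)); last by lin.
under eq_tsum => x r.
  rewrite -(cop_assoc hCA (F := fun y u v => amul (S y) u \ox amul (S x) v)); last by lin.
  under eq_tsum => s v.
    rewrite -(lin_out _ _ (lin_tensl (amul (S x) v))) (antip_l hS) tensZl.
    over.
  rewrite (counit_l hCA (f := fun v => aone A \ox amul (S x) v)); last by lin.
  over.
by rewrite -(lin_out _ _ (lin_tensr (aone A))) (antip_l hS) tensZr.
Qed.

Lemma R_mul_l U a b c (v : U) : R (amul a b) c *: v =
  \tsum_(c1, c2 <- cop c) R a c1 *: (R b c2 *: v).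
Proof.
by rewrite (cqt_mul_l hR) tsum_scale; apply: eq_tsum => c1 c2; rewrite scalerA.
Qed.

Lemma R_mul_r U a b c (v : U) : R a (amul b c) *: v =
  \tsum_(a1, a2 <- cop a) R a1 c *: (R a2 b *: v).
Proof.
by rewrite (cqt_mul_r hR) tsum_scale; apply: eq_tsum => a1 a2; rewrite scalerA.
Qed.

(** [R 1] is idempotent for convolution, and invertible, hence it is the counit. *)
Lemma R_one_l c : R (aone A) c = eps c.
Proof.
have [R' [bR' hRR' _]] := cqt_invertible hR.
have {}bR' : bilin (R' : A -> A -> k^o).
  by case: bR' => h1 h2; split=> [w|v] a x y; [exact: h1|exact: h2].
have RR' c0 : \tsum_(c1, c2 <- cop c0) (R (aone A) c1 * R' (aone A) c2) = eps c0.
  have := hRR' (aone A) c0; rewrite (bialg_cop_one hBA) (bialg_eps_one hBA) mul1r.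
  by rewrite (tsum_pure (U := k^o)) //; lin.
rewrite -(counit_r hCA c (f := R (aone A) : A -> k^o)); last by lin.
under eq_tsum => c1 c2.
  rewrite -RR' [_ *: _]mulrC.
  rewrite (lin_out (f := fun x : k^o => R (aone A) c1 * x : k^o)); last by lin.
  over.
rewrite -(cop_assoc hCA (U := k^o)
  (F := fun x y z => R (aone A) x * (R (aone A) y * R' (aone A) z))); last by lin.
rewrite -[RHS]RR'; apply: eq_tsum => x z.
rewrite -[in RHS](alg_one_l hAA (aone A)) (cqt_mul_l hR).
rewrite [RHS](lin_out (f := fun u : k^o => u * R' (amul (aone A) (aone A)) z : k^o));
  last by lin.
by apply: eq_tsum => x1 x2; rewrite mulrA (alg_one_l hAA).
Qed.

Lemma R_one_r a : R a (aone A) = eps a.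
Proof.
have [R' [bR' hRR' _]] := cqt_invertible hR.
have {}bR' : bilin (R' : A -> A -> k^o).
  by case: bR' => h1 h2; split=> [w|v] x y z; [exact: h1|exact: h2].
have RR' c0 : \tsum_(c1, c2 <- cop c0) (R c1 (aone A) * R' c2 (aone A)) = eps c0.
  have := hRR' c0 (aone A); rewrite (bialg_cop_one hBA) (bialg_eps_one hBA) mulr1 => <-.
  by apply: eq_tsum => c1 c2; rewrite (tsum_pure (U := k^o)) //; lin.
rewrite -(counit_r hCA a (f := R^~ (aone A) : A -> k^o)); last by lin.
under eq_tsum => c1 c2.
  rewrite -RR' [_ *: _]mulrC.
  rewrite (lin_out (f := fun x : k^o => R c1 (aone A) * x : k^o)); last by lin.
  over.
rewrite -(cop_assoc hCA (U := k^o)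
  (F := fun x y z => R x (aone A) * (R y (aone A) * R' z (aone A)))); last by lin.
rewrite -[RHS]RR'; apply: eq_tsum => x z.
rewrite -[in RHS](alg_one_l hAA (aone A)) (cqt_mul_r hR).
rewrite [RHS](lin_out (f := fun u : k^o => u * R' z (amul (aone A) (aone A)) : k^o));
  last by lin.
by apply: eq_tsum => x1 x2; rewrite mulrA (alg_one_l hAA).
Qed.

(** [a, c |-> R (S a) c] is the convolution inverse of [R], by [R_mul_l] and [R_one_l]. *)
Lemma R_S_l U a c (v : U) :
  \tsum_(a1, a2 <- cop a) \tsum_(c1, c2 <- cop c) R (S a1) c1 *: (R a2 c2 *: v) =
  eps a *: (eps c *: v).
Proof.
under eq_tsum => a1 a2 do rewrite -R_mul_l.
have hl : lin (fun x => R x c *: v) by lin.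
by rewrite -(lin_out _ _ hl) (antip_l hS) (linZ _ _ hl) R_one_l.
Qed.

Lemma R_S_r U a c (v : U) :
  \tsum_(a1, a2 <- cop a) \tsum_(c1, c2 <- cop c) R a1 c1 *: (R (S a2) c2 *: v) =
  eps a *: (eps c *: v).
Proof.
under eq_tsum => a1 a2 do rewrite -R_mul_l.
have hl : lin (fun x => R x c *: v) by lin.
by rewrite -(lin_out _ _ hl) (antip_r hS) (linZ _ _ hl) R_one_l.
Qed.

Section Actions.
Context (O : extHopfOps A) (hO : is_strongly_bicovariant O).
Local Notation p := (ext_pr O).
Let hE : is_exterior O := sb_exterior hO.
Let hAlg : is_algebra O := ext_algebra hE.
Let gO : is_grading p := ext_grading hE.
Let hSH : is_super_bialgebra (eh_bialg O) p := proj1 (sb_super_hopf hO).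
Let hC : is_coalgebra (eh_bialg O) := sbialg_coalgebra hSH.

(** The two actions of [A] on [Omega(A)] that [R] makes from the coactions, and the
    composite that appears in the product of the double cross product. *)
Definition la a (t : O) : O := lco (fun q t' => R (S a) q *: t') t.
Definition ra b (t : O) : O := rco (fun t' q => R b q *: t') t.
Definition act2 a b (t : O) : O := la a (ra b t).

Lemma bilin_la : bilin la. Proof. by rewrite /la; lin. Qed.
Lemma bilin_ra : bilin ra. Proof. by rewrite /ra; lin. Qed.
Let bla := bilin_la. Let bra := bilin_ra.
Lemma trilin_act2 : trilin act2. Proof. by rewrite /act2; lin. Qed.

(** The left and the right coaction commute. *)
Lemma la_ra a b t : la a (ra b t) = ra b (la a t).
Proof.
rewrite {1}/ra (lin_out _ _ (proj2 bla a)) {2}/la [in RHS]/lco (lin_out _ _ (proj2 bra b)).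
under eq_tsum => t1 t2 do rewrite (linZ _ _ (proj2 bla a)) {1}/la /lco -tsumZ.
rewrite (eh_assoc hO (F := fun q t' r => R b (ext_res O r) *: (R (S a) (ext_res O q) *: t')));
  last by lin.
apply: eq_tsum => t1 t2; rewrite (linZ _ _ (proj2 bra b)) {1}/ra /rco -tsumZ.
by apply: eq_tsum => t3 t4; rewrite !scalerA mulrC.
Qed.

Lemma la_homog n a t : homog p n t -> homog p n (la a t).
Proof.
move=> ht; rewrite /homog /la [in LHS]/lco (lin_out _ _ (lin_pr gO n)).
apply: (eq_lco hO (F := fun a' x => p n (R (S a) a' *: x)) _ _ ht)
  => [||q x hx]; [by lin|by lin|].
by rewrite (linZ _ _ (lin_pr gO n)) hx.
Qed.

Lemma ra_homog n b t : homog p n t -> homog p n (ra b t).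
Proof.
move=> ht; rewrite /homog /ra [in LHS]/rco (lin_out _ _ (lin_pr gO n)).
apply: (eq_rco hO (F := fun x a' => p n (R b a' *: x)) _ _ ht) => [||x q hx]; [by lin|by lin|].
by rewrite (linZ _ _ (lin_pr gO n)) hx.
Qed.

Lemma act2_homog n a b t : homog p n t -> homog p n (act2 a b t).
Proof. by move=> ht; apply: la_homog; exact: ra_homog. Qed.

Lemma la_d a t : la a (ext_d O t) = ext_d O (la a t).
Proof.
rewrite /la (lco_d hO); last by lin.
rewrite [in RHS]/lco (lin_out _ _ (lin_d hE)).
by apply: eq_tsum => t1 t2; rewrite (linZ _ _ (lin_d hE)).
Qed.

Lemma ra_d b t : ra b (ext_d O t) = ext_d O (ra b t).
Proof.
rewrite /ra (rco_d hO); last by lin.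
rewrite [in RHS]/rco (lin_out _ _ (lin_d hE)).
by apply: eq_tsum => t1 t2; rewrite (linZ _ _ (lin_d hE)).
Qed.

Lemma act2_d a b t : act2 a b (ext_d O t) = ext_d O (act2 a b t).
Proof. by rewrite /act2 ra_d la_d. Qed.

Lemma la_one a : la a (aone O) = eps a *: aone O.
Proof. by rewrite /la (lco_one hO) ?R_one_r ?eps_S //; lin. Qed.

Lemma ra_one b : ra b (aone O) = eps b *: aone O.
Proof. by rewrite /ra (rco_one hO) ?R_one_r //; lin. Qed.

Lemma act2_one a b : act2 a b (aone O) = eps a *: (eps b *: aone O).
Proof. by rewrite /act2 ra_one (linZ _ _ (proj2 bla a)) la_one !scalerA mulrC. Qed.

Lemma S_one : S (aone A) = aone A.
Proof.
have := antip_l hS (aone A); rewrite (bialg_cop_one hBA) tsum_pure; last by lin.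
by rewrite (alg_one_r hAA) (bialg_eps_one hBA) scale1r.
Qed.

Lemma one_la t : la (aone A) t = t.
Proof.
rewrite /la S_one -[RHS](lco_counit hO t (@lin_id _ _)).
by apply: eq_tsum => t1 t2; rewrite R_one_l.
Qed.

Lemma one_ra t : ra (aone A) t = t.
Proof.
rewrite /ra -[RHS](rco_counit hO t (@lin_id _ _)).
by apply: eq_tsum => t1 t2; rewrite R_one_l.
Qed.

Lemma one_act2 t : act2 (aone A) (aone A) t = t.
Proof. by rewrite /act2 one_ra one_la. Qed.

Lemma mul_ra a b t : ra (amul a b) t = ra a (ra b t).
Proof.
rewrite {1}/ra /rco.
under eq_tsum => t1 t2 do rewrite R_mul_l.
rewrite -/(rco (fun t1 q => \tsum_(c1, c2 <- cop q) R a c1 *: (R b c2 *: t1)) t).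
rewrite -(rco_coassoc hO (F := fun t1 c1 c2 => R a c1 *: (R b c2 *: t1))); last by lin.
rewrite [ra b t]/ra {1}/rco [in RHS]/rco (lin_out _ _ (proj2 bra a)).
apply: eq_tsum => t1 t2; rewrite (linZ _ _ (proj2 bra a)) /ra /rco -tsumZ.
by apply: eq_tsum => x y; rewrite !scalerA mulrC.
Qed.

Lemma mul_la a b t : S (amul a b) = amul (S b) (S a) ->
  la (amul a b) t = la a (la b t).
Proof.
move=> Sab; rewrite {1}/la /lco.
under eq_tsum => t1 t2 do rewrite Sab R_mul_l.
rewrite -/(lco (fun q t2 => \tsum_(c1, c2 <- cop q) R (S b) c1 *: (R (S a) c2 *: t2)) t).
rewrite -(lco_coassoc hO (F := fun c1 c2 t1 => R (S b) c1 *: (R (S a) c2 *: t1))); last by lin.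
rewrite [la b t]/la {1}/lco [in RHS]/lco (lin_out _ _ (proj2 bla a)).
apply: eq_tsum => t1 t2; rewrite (linZ _ _ (proj2 bla a)) /la /lco -tsumZ.
by apply: eq_tsum => x y.
Qed.

Lemma mul_act2 a a' b b' t : S (amul a a') = amul (S a') (S a) ->
  act2 (amul a a') (amul b b') t = act2 a b (act2 a' b' t).
Proof. by move=> Saa; rewrite /act2 mul_la // mul_ra [la a' (ra b _)]la_ra. Qed.

Lemma ra_mul b t u : ra b (amul t u) = \tsum_(b1, b2 <- cop b) amul (ra b2 t) (ra b1 u).
Proof.
rewrite {1}/ra (rco_mul hO); last by lin.
rewrite /rco.
under eq_tsum => t1 t2 do under eq_tsum => u1 u2 do rewrite R_mul_r.
under eq_tsum => t1 t2 do rewrite tsum_exch.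
rewrite tsum_exch; apply: eq_tsum => b1 b2.
rewrite {2}/ra /rco (lin_out _ _ (lin_amul_l hAlg _)); apply: eq_tsum => t1 t2.
rewrite /ra /rco (lin_out _ _ (lin_amul_r hAlg _)); apply: eq_tsum => u1 u2.
by rewrite amulZl // amulZr // !scalerA mulrC.
Qed.

Lemma la_mul a t u : la a (amul t u) = \tsum_(a1, a2 <- cop a) amul (la a1 t) (la a2 u).
Proof.
rewrite {1}/la (lco_mul hO); last by lin.
rewrite /lco.
under eq_tsum => t1 t2.
  under eq_tsum => u1 u2.
    rewrite R_mul_r (cop_S (F := fun a1 a2 => R a1 (ext_res O u1) *: (R a2 (ext_res O t1) *: amul t2 u2)));
      last by lin.
    over.
  rewrite tsum_exch.
  over.
rewrite tsum_exch; apply: eq_tsum => a1 a2.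
rewrite {1}/la /lco (lin_out _ _ (lin_amul_l hAlg _)); apply: eq_tsum => t1 t2.
rewrite /la /lco (lin_out _ _ (lin_amul_r hAlg _)); apply: eq_tsum => u1 u2.
by rewrite amulZl // amulZr // !scalerA mulrC.
Qed.

(** With [mul_act2], [act2] makes [Omega(A)] a module algebra over [A \ox A] with the
    coproduct of the second factor reversed. *)
Lemma act2_mul a b t u : act2 a b (amul t u) =
  \tsum_(a1, a2 <- cop a) \tsum_(b1, b2 <- cop b) amul (act2 a1 b2 t) (act2 a2 b1 u).
Proof.
rewrite /act2 ra_mul (lin_out _ _ (proj2 bla a)) tsum_exch.
by apply: eq_tsum => b1 b2; rewrite la_mul.
Qed.

Lemma res_la a t : ext_res O (la a t) = \tsum_(t1, t2 <- cop (ext_res O t)) R (S a) t1 *: t2.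
Proof.
rewrite -(res_cop hO (F := fun t1 t2 => R (S a) t1 *: t2)); last by lin.
rewrite /la /lco (lin_out _ _ (lin_res hE)); apply: eq_tsum => t1 t2.
exact: (linZ _ _ (lin_res hE)).
Qed.

Lemma res_ra b t : ext_res O (ra b t) = \tsum_(t1, t2 <- cop (ext_res O t)) R b t2 *: t1.
Proof.
rewrite -(res_cop hO (F := fun t1 t2 => R b t2 *: t1)); last by lin.
rewrite /ra /rco (lin_out _ _ (lin_res hE)); apply: eq_tsum => t1 t2.
exact: (linZ _ _ (lin_res hE)).
Qed.

Lemma la_in a c : la a (ext_in O c) = \tsum_(c1, c2 <- cop c) R (S a) c1 *: ext_in O c2.
Proof. by rewrite /la (lco_in hO) //; lin. Qed.

Lemma ra_in b c : ra b (ext_in O c) = \tsum_(c1, c2 <- cop c) R b c2 *: ext_in O c1.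
Proof. by rewrite /ra (rco_in hO) //; lin. Qed.

(** An action through one coaction moves to the outer leg of a coproduct on its side. *)
Lemma cop_la U (F : O -> O -> U) a t : bilin F ->
  tsum F (eh_cop (la a t)) = \tsum_(t1, t2 <- eh_cop t) F (la a t1) t2.
Proof.
move=> hF; have hl : lin (fun u => tsum F (eh_cop u)) by lin.
rewrite {1}/la /lco (lin_out _ _ hl).
under eq_tsum => t1 t2 do rewrite (linZ _ _ hl) -tsumZ.
rewrite -(eh_assoc hO (F := fun x y z => R (S a) (ext_res O x) *: F y z)); last by lin.
apply: eq_tsum => x z; rewrite /la /lco (lin_out _ _ (proj1 hF z)).
by apply: eq_tsum => x1 x2; rewrite (linZ _ _ (proj1 hF z)).
Qed.

Lemma cop_ra U (F : O -> O -> U) b t : bilin F ->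
  tsum F (eh_cop (ra b t)) = \tsum_(t1, t2 <- eh_cop t) F t1 (ra b t2).
Proof.
move=> hF; have hl : lin (fun u => tsum F (eh_cop u)) by lin.
rewrite {1}/ra /rco (lin_out _ _ hl).
under eq_tsum => t1 t2 do rewrite (linZ _ _ hl) -tsumZ.
rewrite (eh_assoc hO (F := fun x y z => R b (ext_res O z) *: F x y)); last by lin.
apply: eq_tsum => x z; rewrite /ra /rco (lin_out _ _ (proj2 hF x)).
by apply: eq_tsum => x1 x2; rewrite (linZ _ _ (proj2 hF x)).
Qed.

Lemma cop_act2 U (F : O -> O -> U) a b t : bilin F ->
  tsum F (eh_cop (act2 a b t)) = \tsum_(t1, t2 <- eh_cop t) F (la a t1) (ra b t2).
Proof.
by move=> hF; rewrite /act2 cop_la // (cop_ra (F := fun x y => F (la a x) y)) //; lin.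
Qed.

(** The actions that face each other on the two legs of a coproduct meet in
    [R x q1 * R (S y) q2] with [q] the element of [A] between the legs, where [R] cancels
    against its convolution inverse. *)
Lemma ra_la_cancel U (F : O -> O -> U) c t : bilin F ->
  \tsum_(x, y <- cop c) \tsum_(t1, t2 <- eh_cop t) F (ra x t1) (la y t2) =
  eps c *: tsum F (eh_cop t).
Proof.
move=> hF.
pose G x y t1 q r t2 : U :=
  R x (ext_res O q) *: (R (S y) (ext_res O r) *: F t1 t2).
transitivity (\tsum_(x, y <- cop c) \tsum_(t1, t2 <- eh_cop t)
   \tsum_(t11, q <- eh_cop t1) \tsum_(r, t22 <- eh_cop t2) G x y t11 q r t22).
  apply: eq_tsum => x y; apply: eq_tsum => t1 t2.
  rewrite {1}/ra /rco (lin_out _ _ (proj1 hF _)); apply: eq_tsum => t11 q.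
  rewrite (linZ _ _ (proj1 hF _)) /la /lco (lin_out _ _ (proj2 hF _)) -tsumZ.
  by apply: eq_tsum => r t22; rewrite (linZ _ _ (proj2 hF _)).
have E x y : \tsum_(t1, t2 <- eh_cop t) \tsum_(t11, q <- eh_cop t1)
     \tsum_(r, t22 <- eh_cop t2) G x y t11 q r t22 =
   \tsum_(t1, u <- eh_cop t) \tsum_(s, t2 <- eh_cop u)
     \tsum_(s1, s2 <- cop (ext_res O s)) R x s1 *: (R (S y) s2 *: F t1 t2).
  rewrite (eh_assoc hO (F := fun t11 q t2 => \tsum_(r, t22 <- eh_cop t2) G x y t11 q r t22));
    last by rewrite /G; lin.
  apply: eq_tsum => t1 u.
  rewrite -(eh_assoc hO (F := fun q r t22 => G x y t1 q r t22)); last by rewrite /G; lin.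
  apply: eq_tsum => s t2.
  by rewrite -(res_cop hO (F := fun s1 s2 => R x s1 *: (R (S y) s2 *: F t1 t2))); last by lin.
under eq_tsum => x y do rewrite E.
rewrite tsum_exch -tsumZ; apply: eq_tsum => t1 u; rewrite tsum_exch.
under eq_tsum => s t2 do rewrite R_S_r -(eps_res hO).
by rewrite tsumZ (eh_counit_l hO (f := F t1)) //; lin.
Qed.

Lemma eps_act2 a b t : eh_eps (act2 a b t) =
  \tsum_(t1, t2 <- cop (ext_res O t)) (R (S a) t1 * R b t2).
Proof.
have linr := lin_res hE; have linre : lin (@eps k A : A -> k^o) := lin_eps hCA.
rewrite (eps_res hO) /act2 res_la res_ra.
have hl : lin (fun u => eps (\tsum_(t1, t2 <- cop u) R (S a) t1 *: t2) : k^o) by lin.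
rewrite (lin_out _ _ hl).
under eq_tsum => t1 t2.
  rewrite (linZ _ _ hl) (lin_out _ _ linre).
  under eq_tsum => x y do rewrite (linZ _ _ linre) [_ *: _]mulrC.
  rewrite (counit_r hCA t1 (f := fun x => R (S a) x : k^o)); last by lin.
  rewrite [_ *: _]mulrC.
  over.
by [].
Qed.

End Actions.
End RForm.

(** * The two-sided coaction *)

Section Cosum.
Context (k : fieldType) (A : bialgOps k) (O : extHopfOps A).
Implicit Types (U : lmodType k) (a b c : A) (x y : O).

(** The two-sided coaction [x |-> x_(-1) \ox x_(0) \ox x_(1)] in Sweedler form. *)
Definition cosum (U : nmodType) (F : A -> O -> A -> U) (x : O) : U :=
  rco (fun x12 b => lco (fun a x' => F a x' b) x12) x.

Lemma cosum_out U U' (h : U -> U') (F : A -> O -> A -> U) x : lin h ->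
  h (cosum F x) = cosum (fun a x' b => h (F a x' b)) x.
Proof.
move=> hh; rewrite /cosum /rco (lin_out _ _ hh); apply: eq_tsum => x1 x2.
by rewrite /lco (lin_out _ _ hh).
Qed.

Lemma cosumD U (F G : A -> O -> A -> U) x :
  cosum (fun a x' b => F a x' b + G a x' b) x = cosum F x + cosum G x.
Proof.
by rewrite /cosum /rco /lco -tsumD; apply: eq_tsum => x1 x2; rewrite -tsumD.
Qed.

Lemma cosumZ U s (F : A -> O -> A -> U) x :
  cosum (fun a x' b => s *: F a x' b) x = s *: cosum F x.
Proof. by rewrite (cosum_out F x (h := *:%R s)) //; lin. Qed.

Lemma tsum_cosum (V W : lmodType k) U (F : V -> W -> A -> O -> A -> U) t x :
  tsum (fun v w => cosum (F v w) x) t =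
  cosum (fun a x' b => tsum (fun v w => F v w a x' b) t) x.
Proof.
rewrite /cosum /rco /lco tsum_exch; apply: eq_tsum => x1 x2.
by rewrite tsum_exch.
Qed.

Lemma eq_cosum0 U (F G : A -> O -> A -> U) x :
  (forall a x' b, F a x' b = G a x' b) -> cosum F x = cosum G x.
Proof. by move=> h; apply: eq_tsum => x1 x2; apply: eq_tsum => x3 x4. Qed.

End Cosum.

Lemma cosum_exch (k : fieldType) (A : bialgOps k) (O O' : extHopfOps A)
    (U : lmodType k) (F : A -> O -> A -> A -> O' -> A -> U) x y :
  cosum (fun a x' b => cosum (F a x' b) y) x =
  cosum (fun c y' d => cosum (fun a x' b => F a x' b c y' d) x) y.
Proof.
rewrite {1}/cosum /rco /lco.
under eq_tsum => x1 x2 do rewrite tsum_cosum.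
by rewrite tsum_cosum.
Qed.

Ltac lin_unfold ::= progress unfold cosum, lco, rco.

Section CosumLemmas.
Context (k : fieldType) (A : bialgOps k) (O : extHopfOps A).
Context (hO : is_strongly_bicovariant O).
Implicit Types (U : lmodType k) (a b c : A) (x y : O).
Let hE : is_exterior O := sb_exterior hO.
Let hAlg : is_algebra O := ext_algebra hE.
Let hAA : is_algebra A := ext_base hE.
Let gO : is_grading (ext_pr O) := ext_grading hE.
Let hSH : is_super_bialgebra (eh_bialg O) (ext_pr O) := proj1 (sb_super_hopf hO).
Let hC : is_coalgebra (eh_bialg O) := sbialg_coalgebra hSH.
Let hCA : is_coalgebra A := bialg_coalgebra (proj1 (sb_base hO)).

Lemma cosum_one U (F : A -> O -> A -> U) : trilin F ->
  cosum F (aone O) = F (aone A) (aone O) (aone A).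
Proof.
move=> hF; rewrite /cosum (rco_one hO); last by lin.
by rewrite (lco_one hO) //; lin.
Qed.

Lemma cosum_in U (F : A -> O -> A -> U) a : trilin F ->
  cosum F (ext_in O a) =
  \tsum_(a12, a3 <- cop a) \tsum_(a1, a2 <- cop a12) F a1 (ext_in O a2) a3.
Proof.
move=> hF; rewrite /cosum (rco_in hO); last by lin.
by apply: eq_tsum => a12 a3; rewrite (lco_in hO) //; lin.
Qed.

Lemma cosum_mul U (F : A -> O -> A -> U) x y : trilin F ->
  cosum F (amul x y) = cosum (fun a x' b =>
    cosum (fun c y' d => F (amul a c) (amul x' y') (amul b d)) y) x.
Proof.
move=> hF; rewrite /cosum (rco_mul hO); last by lin.
rewrite /rco; apply: eq_tsum => x1 x2; rewrite [RHS]tsum_exch; apply: eq_tsum => y1 y2.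
by rewrite (lco_mul hO) //; lin.
Qed.

Lemma cosum_d U (F : A -> O -> A -> U) x : trilin F ->
  cosum F (ext_d O x) = cosum (fun a x' b => F a (ext_d O x') b) x.
Proof.
move=> hF; rewrite /cosum (rco_d hO); last by lin.
by apply: eq_tsum => x1 x2; rewrite (lco_d hO) //; lin.
Qed.

Lemma eq_cosum U (F G : A -> O -> A -> U) n x : trilin F -> trilin G ->
  homog (ext_pr O) n x ->
  (forall a x' b, homog (ext_pr O) n x' -> F a x' b = G a x' b) ->
  cosum F x = cosum G x.
Proof.
move=> hF hG hx h; apply: (eq_rco hO _ _ hx); [by lin|by lin|] => x' b hx'.
by apply: (eq_lco hO _ _ hx'); [by lin|by lin|] => a x'' hx''; exact: h.
Qed.

(** Coacting once more on the middle leg takes coproducts in [A] on both sides: on the left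
    the new leg is the second one, on the right it is the first one. *)
Lemma cosum_coassoc U (G : A -> A -> O -> A -> A -> U) x :
  (forall c y d b, lin (fun a => G a c y d b)) ->
  (forall a y d b, lin (fun c => G a c y d b)) ->
  (forall a c d b, lin (fun y => G a c y d b)) ->
  (forall a c y b, lin (fun d => G a c y d b)) ->
  (forall a c y d, lin (fun b => G a c y d b)) ->
  cosum (fun a y b => cosum (fun c y' d => G a c y' d b) y) x =
  cosum (fun a y b => \tsum_(a1, a2 <- cop a) \tsum_(b1, b2 <- cop b)
    G a1 a2 y b1 b2) x.
Proof.
move=> h1 h2 h3 h4 h5; rewrite {1}/cosum.
have E x' b : lco (fun a y => cosum (fun c y' d => G a c y' d b) y) x' =
    rco (fun y d => lco (fun a y' => \tsum_(a1, a2 <- cop a) G a1 a2 y' d b) y) x'.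
  rewrite /cosum (lco_rco hO (F := fun a y d => lco (fun c y' => G a c y' d b) y));
    last by lin.
  apply: eq_tsum => x1 x2.
  by rewrite (lco_coassoc hO (F := fun a c y' => G a c y' (ext_res O x2) b)) //; lin.
rewrite /rco; under eq_tsum => x1 x2 do rewrite E.
rewrite -/(rco (fun x' b => rco (fun y d => lco (fun a y' => \tsum_(a1, a2 <- cop a) G a1 a2 y' d b) y) x') x).
rewrite (rco_coassoc hO (F := fun y d b => lco (fun a y' => \tsum_(a1, a2 <- cop a) G a1 a2 y' d b) y));
  last by lin.
apply: eq_tsum => x1 x2; rewrite /lco tsum_exch; apply: eq_tsum => y1 y2.
by rewrite tsum_exch.
Qed.

Lemma cosum_counit U (f : O -> U) x : lin f ->
  cosum (fun a x' b => eps a *: (eps b *: f x')) x = f x.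
Proof.
move=> hf; rewrite -[RHS](rco_counit hO x hf); apply: eq_tsum => x1 x2.
by rewrite -(lco_counit hO x1 (f := fun y => eps (ext_res O x2) *: f y)) //; lin.
Qed.

End CosumLemmas.

(** * Multiplicativity of the coproduct from degree zero *)

(** The actions of [A] and the multiplications by degree zero elements preserve the degree,
    which lets them in and out of signed sums. *)
Lemma koszul_comp_r (k : fieldType) (V W W' U : lmodType k) (pV : nat -> V -> V)
    (pW : nat -> W -> W) (pW' : nat -> W' -> W')
    (gV : is_grading pV) (gW : is_grading pW) (gW' : is_grading pW')
    (F : V -> W' -> U) (g : W -> W') v w : bilin F -> lin g ->
  (forall n w, homog pW n w -> homog pW' n (g w)) ->
  koszul pV pW (fun v w => F v (g w)) v w = koszul pV pW' F v (g w).
Proof.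
move=> hF hg hgh; move: v w; apply: (homog_ext2 gV gW) => [||m n v w hv hw].
- by lin.
- by lin.
rewrite (koszul_homog gV gW _ hv hw); last by lin.
by rewrite (koszul_homog gV gW' hF hv (hgh _ _ hw)).
Qed.

Lemma koszul_comp_l (k : fieldType) (V V' W U : lmodType k) (pV : nat -> V -> V)
    (pV' : nat -> V' -> V') (pW : nat -> W -> W)
    (gV : is_grading pV) (gV' : is_grading pV') (gW : is_grading pW)
    (F : V' -> W -> U) (g : V -> V') v w : bilin F -> lin g ->
  (forall n v, homog pV n v -> homog pV' n (g v)) ->
  koszul pV pW (fun v w => F (g v) w) v w = koszul pV' pW F (g v) w.
Proof.
move=> hF hg hgh; move: v w; apply: (homog_ext2 gV gW) => [||m n v w hv hw].
- by lin.
- by lin.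
rewrite (koszul_homog gV gW _ hv hw); last by lin.
by rewrite (koszul_homog gV' gW hF (hgh _ _ hv) hw).
Qed.

Section CopMul.
Context (k : fieldType) (K : bialgOps k) (E : extHopfOps K) (hE : is_exterior E).
Local Notation p := (ext_pr E).
Let hAlg : is_algebra E := ext_algebra hE.
Let gE : is_grading p := ext_grading hE.

(** The [x] such that [cop (x * y) = cop x * cop y] for all [y] form a subalgebra. If the
    coproduct commutes with the differentials, then it contains [d b] together with [b]
    of degree zero, by [d_in_mul]. *)
Lemma cop_mul_from_base :
  lin (@eh_cop k K E) ->
  (forall b, eh_cop (ext_in E b) = tmap (ext_in E) (ext_in E) (cop b)) ->
  (forall x, eh_cop (ext_d E x) = dtens p (ext_d E) (eh_cop x)) ->
  (forall b y, eh_cop (amul (ext_in E b) y) =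
     stmul p p (eh_cop (ext_in E b)) (eh_cop y)) ->
  forall x y, eh_cop (amul x y) = stmul p p (eh_cop x) (eh_cop y).
Proof.
move=> hl hr hd hb; have [s1 s2] := bilin_stmul hAlg gE.
have hD := lin_dtens gE (lin_d hE).
apply: (exterior_ind hE) => [c x x' hx hx' y|x x' hx hx' y|b y|b y].
- by rewrite amulDl // amulZl // !hl hx hx' (s1 _).
- by rewrite -(alg_assoc hAlg) hx hx' hx (stmul_assoc hAlg gE (ext_mul_degree hE)).
- exact: hb.
rewrite (d_in_mul hE) (linB _ _ hl) hd !hb !hd hr.
apply/eqP; rewrite subr_eq; apply/eqP.
move: (cop b); apply: tens_ext => [||b1 b2]; [by lin|by lin|].
rewrite /tmap tsum_pure; last by split=> *; lin.
exact: (dtens_mul0 hAlg gE (ext_mul_degree hE) (lin_d hE) (ext_d_degree hE)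
  (ext_leibniz hE) _ (homog_in hE b1) (homog_in hE b2)).
Qed.

End CopMul.

(** * Module algebra structures from degree zero *)

Section ActionFromBase.
Context (k : fieldType) (K : bialgOps k) (E : extHopfOps K) (hE : is_exterior E).
Context (B : algOps k) (OB : extOps B) (hB : is_exterior OB).
Context (eact : OB -> E -> OB) (bact : bilin eact).
Local Notation p := (ext_pr E).
Local Notation q := (ext_pr OB).
Local Notation dE := (ext_d E).
Local Notation dB := (ext_d OB).
Hypothesis act_degree : forall m n v a,
  homog q m v -> homog p n a -> homog q (m + n) (eact v a).
Hypothesis act_d : forall n v a, homog q n v ->
  dB (eact v a) = eact (dB v) a + (-1) ^+ n *: eact v (dE a).

Let hAlg : is_algebra E := ext_algebra hE.
Let gE : is_grading p := ext_grading hE.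
Let hAlgB : is_algebra OB := ext_algebra hB.
Let gB : is_grading q := ext_grading hB.
Let hal v := proj1 bact v.
Let har v := proj2 bact v.

(** The compatibility of the action with the differentials, solved for the action of
    [d a]. *)
Lemma act_dE n v a : homog q n v ->
  eact v (dE a) = (-1) ^+ n *: (dB (eact v a) - eact (dB v) a).
Proof.
move=> hv; rewrite (act_d a hv) addrAC subrr add0r scalerA -exprD.
by rewrite -signr_odd oddD addbb scale1r.
Qed.

(** Here and in the next lemma the set of good [x] is again a subalgebra, and it contains
    [d b] because [act_dE] expresses the action of [d b] by that of [b]. *)
Lemma act_mul_from_base :
  (forall b v y, eact v (amul (ext_in E b) y) = eact (eact v (ext_in E b)) y) ->
  forall x v y, eact v (amul x y) = eact (eact v x) y.
Proof.
move=> hb; apply: (exterior_ind hE) => [c x x' hx hx' v y|x x' hx hx' v y|//|b v y].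
- by rewrite amulDl // amulZl // !har hx hx' hal.
- by rewrite -(alg_assoc hAlg) hx hx' hx.
rewrite (d_in_mul hE) (linB _ _ (har _)) hb.
move: v; apply: (homog_ext gB) => [||n v hv]; [by lin|by lin|].
have hvb : homog q n (eact v (ext_in E b)).
  by have := act_degree hv (homog_in hE b); rewrite addn0.
rewrite !(act_dE _ hv) (act_dE _ hvb) !hb -scalerBr (linZ _ _ (hal _)); congr (_ *: _).
by rewrite (linB _ _ (hal _)) opprB addrC addrA subrK.
Qed.

Lemma modalg_from_base :
  is_coalgebra (eh_bialg E) ->
  (forall x v y, eact v (amul x y) = eact (eact v x) y) ->
  (forall b, eh_cop (ext_in E b) = tmap (ext_in E) (ext_in E) (cop b)) ->
  (forall x, eh_cop (dE x) = dtens p dE (eh_cop x)) ->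
  (forall x y, eh_cop (amul x y) = stmul p p (eh_cop x) (eh_cop y)) ->
  (forall b v w, eact (amul v w) (ext_in E b) =
    \tsum_(b1, b2 <- cop b) amul (eact v (ext_in E b1)) (eact w (ext_in E b2))) ->
  forall x v w, eact (amul v w) x =
    \tsum_(x1, x2 <- eh_cop x)
      koszul q p (fun w x1 => amul (eact v x1) (eact w x2)) w x1.
Proof.
move=> hC hm hr hd hM hb.
have bk v w : bilin (fun x1 x2 => koszul q p (fun w x1 => amul (eact v x1) (eact w x2)) w x1) by lin.
have Hin b v w : \tsum_(x1, x2 <- eh_cop (ext_in E b))
      koszul q p (fun w x1 => amul (eact v x1) (eact w x2)) w x1 =
    \tsum_(b1, b2 <- cop b) amul (eact v (ext_in E b1)) (eact w (ext_in E b2)).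
  rewrite hr tsum_tmap //; apply: eq_tsum => b1 b2.
  by rewrite (koszul0r gB gE) //; [lin|exact: homog_in].
apply: (exterior_ind hE) => [c x y hx hy v w|x y hx hy v w|b v w|b v w].
- by rewrite har hx hy (lin_eh_cop hC) (lin_tsum (bk v w)).
- rewrite hm hx (lin_out _ _ (hal y)) hM /stmul tsum_tsum //.
  apply: eq_tsum => x1 x2; rewrite tsum_tsum //.
  move: w x1; apply: (homog_ext2 gB gE) => [||m i w x1 hw hx1].
  + by lin.
  + by lin.
  rewrite (koszul_homog gB gE _ hw hx1); last by lin.
  rewrite (linZ _ _ (hal y)) hy -tsumZ.
  move: x2; apply: (homog_ext gE) => [||j x2 hx2]; [by lin|by lin|].
  apply: eq_tsum => y1 y2.
  move: y1; apply: (homog_ext gE) => [||n y1 hy1]; [by lin|by lin|].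
  rewrite (koszul_homog gB gE _ (act_degree hw hx2) hy1); last by lin.
  rewrite (lin_koszul_out gE gE); [|by lin|exact: (lin_tsum (bk v w))].
  rewrite (koszul_homog gE gE _ hx2 hy1); last by lin.
  rewrite tsum_pure // (koszul_homog gB gE _ hw (ext_mul_degree hE hx1 hy1)); last by lin.
  by rewrite !scalerA -!exprD !hm; sgn.
- by rewrite hb Hin.
rewrite hd hr.
move: v w; apply: (homog_ext2 gB gB) => [||m n v w hv hw]; [by lin|by lin|].
rewrite (act_dE _ (ext_mul_degree hB hv hw)) hb (ext_leibniz hB _ hv).
rewrite (linD _ _ (hal _)) (linZ _ _ (hal _)) !hb.
have hD := lin_dtens gE (lin_d hE).
rewrite /tmap (lin_out _ _ hD) tsum_tsum; last exact: bk.
rewrite (lin_out _ _ (lin_d hB)) -tsumZ -tsumD -tsumB -tsumZ; apply: eq_tsum => b1 b2.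
have h1 := homog_in hE b1.
have hvb : homog q m (eact v (ext_in E b1)).
  by have := act_degree hv h1; rewrite addn0.
rewrite (ext_leibniz hB _ hvb) (dtens_tens gE (lin_d hE) _ h1) scale1r.
rewrite (linD _ _ (lin_tsum (bk v w))) !tsum_pure //.
rewrite (koszul_homog gB gE _ hw (ext_d_degree hE h1)); last by lin.
rewrite (koszul_homog gB gE _ hw h1); last by lin.
rewrite muln1 muln0 scale1r (act_dE _ hv) (act_dE _ hw).
rewrite amulZl // amulZr // (linB _ _ (lin_amul_l hAlgB _)) (linB _ _ (lin_amul_r hAlgB _)).
rewrite opprD addrACA -scalerBr scalerDr !scalerA -!exprD.
by apply: eq_add; sgn.
Qed.

End ActionFromBase.

(** * Restriction to degree zero *)

Section DegreeZero.
Context (k : fieldType) (K : bialgOps k) (E : extHopfOps K) (hE : is_exterior E).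
Context (hSH : is_super_bialgebra (eh_bialg E) (ext_pr E)).
Hypothesis cop_restr : forall b,
  eh_cop (ext_in E b) = tmap (ext_in E) (ext_in E) (cop b).
Hypothesis eps_restr : forall b, eh_eps (ext_in E b) = eps b.
Local Notation i := (ext_in E).
Local Notation r := (ext_res E).
Let hAlg : is_algebra E := ext_algebra hE.
Let hK : is_algebra K := ext_base hE.
Let gE : is_grading (ext_pr E) := ext_grading hE.
Let hC : is_coalgebra (eh_bialg E) := sbialg_coalgebra hSH.

(** The structure maps of [K] are those of [E] conjugated by the inclusion and its
    retraction [ext_res], so every axiom can be pulled back. *)
Lemma tmap_inK : cancel (tmap i i) (tmap r r).
Proof.
have h1 : lin (tmap i i) by lin.
have h2 : lin (tmap r r) by lin.
move=> t; move: t; apply: tens_ext => [||a b]; [by lin|by lin|].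
rewrite /tmap !tsum_pure; [|by lin..].
by rewrite !(ext_res_in hE).
Qed.

Lemma tsum_restr (U : lmodType k) (F : E -> E -> U) b : bilin F ->
  tsum F (eh_cop (i b)) = \tsum_(b1, b2 <- cop b) F (i b1) (i b2).
Proof. by move=> hF; rewrite cop_restr tsum_tmap. Qed.

Lemma lin_cop_restr : lin (@cop k K).
Proof.
have h2 : lin (tmap r r) by lin.
by move=> a x y; apply: (can_inj tmap_inK); rewrite -!cop_restr (lin_in hE) (lin_eh_cop hC)
  !cop_restr (_ : lin (tmap i i)) //; lin.
Qed.

Lemma degree0_coalgebra : is_coalgebra K.
Proof.
have hc := lin_cop_restr.
have he : lin (@eps k K : K -> k^o).
  by move=> a x y; rewrite -!eps_restr (lin_in hE) (lin_eh_eps hC).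
have hr : lin r by lin.
have hr3 : trilin (fun x1 x2 x3 : E => r x1 \ox (r x2 \ox r x3)) by lin.
split=> // x.
- transitivity (\tsum_(x12, x3 <- eh_cop (i x)) \tsum_(x1, x2 <- eh_cop x12)
      r x1 \ox (r x2 \ox r x3)).
    rewrite tsum_restr; last by lin.
    apply: eq_tsum => x12 x3; rewrite tsum_restr; last by lin.
    by apply: eq_tsum => x1 x2; rewrite !(ext_res_in hE).
  rewrite (cop_assoc hC (i x) hr3) tsum_restr; last by lin.
  apply: eq_tsum => x1 x23; rewrite tsum_restr; last by lin.
  by apply: eq_tsum => x2 x3; rewrite !(ext_res_in hE).
- rewrite -[RHS](ext_res_in hE) -(counit_l hC (i x) hr) tsum_restr; last by lin.
  by apply: eq_tsum => x1 x2; rewrite /= (ext_res_in hE) eps_restr.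
- rewrite -[RHS](ext_res_in hE) -(counit_r hC (i x) hr) tsum_restr; last by lin.
  by apply: eq_tsum => x1 x2; rewrite /= (ext_res_in hE) eps_restr.
Qed.

Lemma degree0_bialgebra : is_bialgebra K.
Proof.
have hKC := degree0_coalgebra.
have li : lin (tmap i i) by lin.
have [s1 s2] := bilin_stmul hAlg gE; have [t1 t2] := bilin_tmul hK.
split=> // [x y||x y|].
- apply: (can_inj tmap_inK); rewrite -cop_restr (ext_in_mul hE).
  have :=
    sbialg_cop_mul hSH (i x) (i y); rewrite /= => ->; rewrite !cop_restr; move: (cop x) (cop y) => s t.
  move: s; apply: tens_ext => [||a b]; [by lin|by lin|].
  move: t; apply: tens_ext => [||c e]; [by lin|by lin|].
  rewrite tmul_tens // /tmap !tsum_pure; [|by lin..].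
  by rewrite (stmul0l hAlg gE) ?(ext_in_mul hE) //; exact: homog_in.
- apply: (can_inj tmap_inK); rewrite -cop_restr (ext_in_one hE).
  have := sbialg_cop_one hSH; rewrite /= => ->; rewrite /tmap tsum_pure; last by lin.
  by rewrite (ext_in_one hE).
- by rewrite -!eps_restr (ext_in_mul hE); exact: (sbialg_eps_mul hSH).
- by rewrite -eps_restr (ext_in_one hE); exact: (sbialg_eps_one hSH).
Qed.

Lemma degree0_hopf : (exists SE, is_antipode (eh_bialg E) SE) -> is_hopf K.
Proof.
move=> [SE hSE]; split; first exact: degree0_bialgebra.
have lS : lin (SE : E -> E) by move=> a x y; exact: (antip_linear hSE).
have hr := lin_res hE.
exists (fun b => r (SE (i b))); split=> [|x|x].
- exact: (lin_comp hr (lin_comp lS (lin_in hE))).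
- have := antip_l hSE (i x); rewrite /= tsum_restr; last by lin.
  rewrite eps_restr => /(congr1 r); rewrite (lin_out _ _ hr) (linZ _ _ hr) (res_one hE) => <-.
  by apply: eq_tsum => x1 x2; rewrite (res_mul_in hE).
- have := antip_r hSE (i x); rewrite /= tsum_restr; last by lin.
  rewrite eps_restr => /(congr1 r); rewrite (lin_out _ _ hr) (linZ _ _ hr) (res_one hE) => <-.
  by apply: eq_tsum => x1 x2; rewrite (res_mul hE) (ext_res_in hE).
Qed.

Lemma degree0_module_algebra (B : algOps k) (OB : extOps B) (hB : is_exterior OB)
    (act : B -> K -> B) (eact : OB -> E -> OB) :
  is_super_module_algebra (eh_bialg E) OB (ext_pr E) (ext_pr OB) eact ->
  (forall b h, eact (ext_in OB b) (i h) = ext_in OB (act b h)) ->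
  is_module_algebra K B act.
Proof.
move=> hact hin; have gB := ext_grading hB; have hAB := ext_algebra hB.
have beact : bilin eact by apply/bilin_for; exact: (smodalg_bilinear hact).
have inj := can_inj (ext_res_in hB).
split=> [|v|v a b|a|v w a].
- apply/bilin_for; split=> [h|b] a x y; apply: inj; rewrite -hin !(lin_in hB, lin_in hE).
    by rewrite (proj1 beact) !hin.
  by rewrite (proj2 beact) !hin.
- by apply: inj; rewrite -hin (ext_in_one hE); exact: (smodalg_act_one hact).
- by apply: inj; rewrite -!hin (ext_in_mul hE); exact: (smodalg_act_mul hact).
- apply: inj; rewrite -hin (ext_in_one hB) (linZ _ _ (lin_in hB)) (ext_in_one hB) -eps_restr.
  exact: (smodalg_one hact).
- apply: inj; rewrite -hin (ext_in_mul hB).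
  have := smodalg_mul hact (ext_in OB v) (ext_in OB w) (i a); rewrite /= => ->.
  rewrite tsum_restr; last by lin.
  rewrite (lin_out _ _ (lin_in hB)); apply: eq_tsum => a1 a2.
  rewrite (koszul0r gB gE); [|by lin|exact: homog_in].
  by rewrite (ext_in_mul hB) -!hin.
Qed.

End DegreeZero.

(** * The double cross product algebra *)

(** Unlike [tens_homog_ext], this keeps track of the total degree. *)
Lemma homog_tens_ind (k : fieldType) (V W : lmodType k)
    (pV : nat -> V -> V) (pW : nat -> W -> W)
    (gV : is_grading pV) (gW : is_grading pW) n (P : tensor V W -> Prop) :
  (forall x y, P x -> P y -> P (x + y)) -> P 0 ->
  (forall i j v w, (i + j)%N = n -> homog pV i v -> homog pW j w -> P (v \ox w)) ->
  forall x, homog (tpr pV pW) n x -> P x.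
Proof.
move=> hD h0 hP x hx; rewrite -hx /tpr.
elim/big_ind: _ => // i _; rewrite /tmap /tsum.
elim/big_ind: _ => // q _.
by apply: (hP i (n - i)%N); [rewrite subnKC // -ltnS|exact: homog_pr..].
Qed.

Section DoubleCross.
Context (k : fieldType) (A : bialgOps k) (S : A -> A) (R : A -> A -> k).
Context (O' O : extHopfOps A) (SO : O -> O).
Context (hR : is_coquasitriangular A R) (hS : is_antipode A S).
Context (hO' : is_strongly_bicovariant O') (hO : is_strongly_bicovariant O).
Context (hSO : is_super_antipode (eh_bialg O) (ext_pr O) SO).

Local Notation p := (ext_pr O).
Local Notation p' := (ext_pr O').
Local Notation V := (tensor O' O).
Local Notation pV := (tpr (ext_pr O') (ext_pr O)).
Local Notation bmul := (@ebowtie_mul k A R O' O SO).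
Local Notation dV := (@ebowtie_d k A O' O).
Local Notation act := (@act2 k A S R O').

Let hBA : is_bialgebra A := proj1 (cqt_hopf hR).
Let hAA : is_algebra A := bialg_algebra hBA.
Let hCA : is_coalgebra A := bialg_coalgebra hBA.
Let linS : lin S := lin_S hS.
Let bR : bilin (R : A -> A -> k^o) := bilin_R hR.
Let hE' : is_exterior O' := sb_exterior hO'.
Let hAlg' : is_algebra O' := ext_algebra hE'.
Let gO' : is_grading p' := ext_grading hE'.
Let hC' : is_coalgebra (eh_bialg O') := sbialg_coalgebra (proj1 (sb_super_hopf hO')).
Let hE : is_exterior O := sb_exterior hO.
Let hAlg : is_algebra O := ext_algebra hE.
Let gO : is_grading p := ext_grading hE.
Let hC : is_coalgebra (eh_bialg O) := sbialg_coalgebra (proj1 (sb_super_hopf hO)).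
Let gV : is_grading pV := tpr_grading gO' gO.
Let linSO : lin SO := lin_SO hSO.
Let tact : trilin act := trilin_act2 hR hS hO'.

(** Restriction of [SO_mul_in] to degree zero. *)
Lemma S_mul a b : S (amul a b) = amul (S b) (S a).
Proof.
apply: (can_inj (ext_res_in hE)); rewrite -(SO_in hO hS hSO) (ext_in_mul hE).
by rewrite (SO_mul_in hO hS hSO) !(SO_in hO hS hSO) (ext_in_mul hE).
Qed.

(** The product of [w \ox e] and [t \ox z] without its sign, as a smash product. *)
Let cross w e t z : V :=
  cosum (fun a e' b => amul w (act a b t) \ox amul e' z) e.

(** In the definition of the product, the outer legs of [e] and [t] are only seen through
    [R], hence through the coactions. *)
Lemma crossE w e t z :
  \tsum_(e12, e3 <- eh_cop e) \tsum_(e1, e2 <- eh_cop e12)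
  \tsum_(t12, t3 <- eh_cop t) \tsum_(t1, t2 <- eh_cop t12)
    (R_ext R (SO e1) t1 * R_ext R e3 t3) *: (amul w t2 \ox amul e2 z) =
  cross w e t z.
Proof.
rewrite /cross /cosum /rco /lco; apply: eq_tsum => e12 e3; apply: eq_tsum => e1 e2.
have hl : lin (fun u => amul w u \ox amul e2 z) by lin.
have hla := proj2 (bilin_la hR hS hO') (ext_res O e1).
rewrite /act2 /ra /rco (lin_out _ _ hla) (lin_out _ _ hl); apply: eq_tsum => t12 t3.
rewrite (linZ _ _ hla) (linZ _ _ hl) /la /lco (lin_out _ _ hl) -tsumZ.
apply: eq_tsum => t1 t2.
by rewrite (linZ _ _ hl) scalerA mulrC /R_ext (res_SO hO hS hSO).
Qed.

Lemma lin_cross1 e t z : lin (fun w => cross w e t z).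
Proof. by rewrite /cross; lin. Qed.
Lemma lin_cross2 w t z : lin (fun e => cross w e t z).
Proof. by rewrite /cross; lin. Qed.
Lemma lin_cross3 w e z : lin (fun t => cross w e t z).
Proof. by rewrite /cross; lin. Qed.
Lemma lin_cross4 w e t : lin (cross w e t).
Proof. by rewrite /cross; lin. Qed.
Let l1 := lin_cross1. Let l2 := lin_cross2. Let l3 := lin_cross3. Let l4 := lin_cross4.

Lemma ebowtie_mulE (x y : V) : bmul x y =
  \tsum_(w, e <- x) \tsum_(t, z <- y) koszul p p' (fun e t => cross w e t z) e t.
Proof.
apply: eq_tsum => w e; apply: eq_tsum => t z; apply: eq_koszul => {}e {}t.
exact: crossE.
Qed.

Lemma bilin_ebowtie_mul : bilin bmul.
Proof.
have h w z : bilin (fun e t => cross w e t z) by split=> *; [exact: l2|exact: l3].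
by split=> [w|v] a x y; rewrite !ebowtie_mulE; move: a x y;
  [change (lin (fun x => \tsum_(w0, e <- x) \tsum_(t, z <- w)
     koszul p p' (fun e t => cross w0 e t z) e t))
  |change (lin (fun y => \tsum_(w, e <- v) \tsum_(t, z <- y)
     koszul p p' (fun e t => cross w e t z) e t))]; lin.
Qed.
Let bbmul := bilin_ebowtie_mul.

Lemma ebowtie_mul_tens m n w e t z : homog p m e -> homog p' n t ->
  bmul (w \ox e) (t \ox z) = (-1) ^+ (m * n) *:
  cosum (fun a e' b => amul w (act a b t) \ox amul e' z) e.
Proof.
have h w0 z0 : bilin (fun e t => cross w0 e t z0) by split=> *; [exact: l2|exact: l3].
move=> he ht; rewrite ebowtie_mulE tsum_pure; last by lin.
rewrite tsum_pure; last by lin.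
by rewrite (koszul_homog gO gO' (h w z) he ht).
Qed.

(** Both bracketings reduce to [w . act2 e t . act2 (e' z) u \ox e'' z' y] with the legs of
    [e] split once by [cosum_mul] and [cosum_coassoc], once by [act2_mul]. The sign is
    in both cases that of moving [e] past [t] and [u], and [z] past [u]. *)
Lemma ebowtie_mulA : associative bmul.
Proof.
have [bl br] := bbmul; move=> x y z.
move: x; apply: (tens_homog_ext gO' gO) => [||j0 m w e hw he]; [by lin|by lin|].
move: y; apply: (tens_homog_ext gO' gO) => [||n q t z0 ht hz]; [by lin|by lin|].
move: z; apply: (tens_homog_ext gO' gO) => [||l j1 u y hu hy]; [by lin|by lin|].
rewrite (ebowtie_mul_tens _ _ he ht) (ebowtie_mul_tens _ _ hz hu).
rewrite (linZ _ _ (bl _)) (linZ _ _ (br _)) (cosum_out _ _ (bl _)) (cosum_out _ _ (br _)).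
transitivity ((-1) ^+ (q * l) *: ((-1) ^+ (m * (n + l)) *: cosum (fun c f d =>
    cosum (fun a e' b => amul w (act a b (amul t (act c d u))) \ox amul e' (amul f y)) e) z0)).
  congr (_ *: _); rewrite -cosumZ; apply: eq_cosum0 => c f d.
  rewrite (ebowtie_mul_tens _ _ he (n := (n + l)%N)) //.
  by apply: (ext_mul_degree hE') ht _; exact: (act2_homog S hR hO').
transitivity ((-1) ^+ (m * n) *: ((-1) ^+ ((m + q) * l) *: cosum (fun a e' b =>
    cosum (fun c f d => amul (amul w (act a b t)) (act c d u) \ox amul f y)
      (amul e' z0)) e)); last first.
  congr (_ *: _); rewrite -cosumZ; apply: (eq_cosum hO _ _ he); [by lin|by lin|].
  move=> a e' b he'; rewrite (ebowtie_mul_tens _ _ (m := (m + q)%N) _ hu) //.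
  exact: (ext_mul_degree hE) he' hz.
rewrite !scalerA -!exprD; apply: sign_scale; first by sgn_odd.
transitivity (cosum (fun a e' b => cosum (fun c f d =>
    \tsum_(a1, a2 <- cop a) \tsum_(b1, b2 <- cop b)
    amul (amul w (act a1 b2 t)) (act (amul a2 c) (amul b1 d) u) \ox
      amul (amul e' f) y) z0) e).
  rewrite cosum_exch; apply: eq_cosum0 => a e' b; apply: eq_cosum0 => c f d.
  have hl : lin (fun v => amul w v \ox amul e' (amul f y)) by lin.
  rewrite (act2_mul hR hS hO') (lin_out _ _ hl); apply: eq_tsum => a1 a2.
  rewrite (lin_out _ _ hl); apply: eq_tsum => b1 b2.
  by rewrite (mul_act2 hR hS hO') ?S_mul // !(alg_assoc hAlg) !(alg_assoc hAlg').
transitivity (cosum (fun a e' b => \tsum_(a1, a2 <- cop a) \tsum_(b1, b2 <- cop b)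
    cosum (fun c f d =>
    amul (amul w (act a1 b2 t)) (act (amul a2 c) (amul b1 d) u) \ox
      amul (amul e' f) y) z0) e).
  apply: eq_cosum0 => a e' b; rewrite -tsum_cosum; apply: eq_tsum => a1 a2.
  by rewrite tsum_cosum.
rewrite -(cosum_coassoc hO (G := fun a1 a2 e' b1 b2 => cosum (fun c f d =>
    amul (amul w (act a1 b2 t)) (act (amul a2 c) (amul b1 d) u) \ox
      amul (amul e' f) y) z0)); [|by lin..].
apply: eq_cosum0 => a e' b.
by rewrite (cosum_mul hO) //; lin.
Qed.

Lemma ebowtie_mul1l : left_id (aone O' \ox aone O) bmul.
Proof.
have [bl br] := bbmul; move=> x.
move: x; apply: (tens_homog_ext gO' gO) => [||n q t z ht hz]; [by lin|by lin|].
rewrite (ebowtie_mul_tens _ _ (homog_one hE) ht) mul0n scale1r (cosum_one hO); last by lin.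
by rewrite (one_act2 hR hS hO') !(alg_one_l hAlg) (alg_one_l hAlg').
Qed.

Lemma ebowtie_mul1r : right_id (aone O' \ox aone O) bmul.
Proof.
have [bl br] := bbmul; move=> x.
move: x; apply: (tens_homog_ext gO' gO) => [||n m w e hw he]; [by lin|by lin|].
rewrite (ebowtie_mul_tens _ _ he (homog_one hE')) muln0 scale1r.
rewrite -[RHS](cosum_counit hO e (f := fun e => w \ox e)); last by lin.
apply: eq_cosum0 => a e' b; rewrite (act2_one hR hS hO') !amulZr //.
by rewrite !tensZl (alg_one_r hAlg) (alg_one_r hAlg').
Qed.

(** ** The factors [Omega'(A)] and [Omega(A)], and the generators *)

Lemma mul_left w t z : bmul (w \ox aone O) (t \ox z) = amul w t \ox z.
Proof.
move: t; apply: (homog_ext gO') => [||n t ht]; [by case: bbmul; lin|by lin|].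
rewrite (ebowtie_mul_tens _ _ (homog_one hE) ht) mul0n scale1r (cosum_one hO); last by lin.
by rewrite (one_act2 hR hS hO') !(alg_one_l hAlg).
Qed.

Lemma mul_right w e z : bmul (w \ox e) (aone O' \ox z) = w \ox amul e z.
Proof.
move: e; apply: (homog_ext gO) => [||n e he]; [by case: bbmul; lin|by lin|].
rewrite (ebowtie_mul_tens _ _ he (homog_one hE')) muln0 scale1r.
rewrite -[RHS](cosum_counit hO e (f := fun e => w \ox amul e z)); last by lin.
apply: eq_cosum0 => a e' b; rewrite (act2_one hR hS hO') !amulZr //.
by rewrite !tensZl (alg_one_r hAlg').
Qed.

Lemma tens_mul w z : w \ox z = bmul (w \ox aone O) (aone O' \ox z).
Proof. by rewrite mul_left (alg_one_r hAlg'). Qed.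

(** ** Grading and differential *)

Lemma ebowtie_mul_degree m n x y :
  homog pV m x -> homog pV n y -> homog pV (m + n) (bmul x y).
Proof.
have [bl br] := bbmul; move=> hx hy.
move: x hx; apply: (homog_tens_ind gO' gO) => [x x' hx hx'||i j w e ij hw he].
- by rewrite (linD _ _ (bl _)); exact: homogD.
- by rewrite (lin0 (bl _)); exact: homog0.
move: y hy; apply: (homog_tens_ind gO' gO) => [x x' hx hx'||i' j' t z ij' ht hz].
- by rewrite (linD _ _ (br _)); exact: homogD.
- by rewrite (lin0 (br _)); exact: homog0.
rewrite (ebowtie_mul_tens _ _ he ht); apply: homogZ => //.
rewrite /homog (cosum_out _ _ (lin_pr gV _)).
apply: (eq_cosum hO _ _ he); [by lin|by lin|] => a e' b he'.
rewrite -ij -ij' -addnACA; apply: (homog_tens gO' gO).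
- by apply: (ext_mul_degree hE') hw _; exact: (act2_homog S hR hO').
- exact: (ext_mul_degree hE) he' hz.
Qed.

Lemma bilin_dV : bilin (fun w e =>
  ext_d O' w \ox e + dsign p' (fun w => w \ox ext_d O e) w).
Proof. by split=> [w|v]; lin. Qed.

Lemma lin_dV : lin dV.
Proof. exact: (lin_tsum bilin_dV). Qed.

Lemma dV_tens m w e : homog p' m w ->
  dV (w \ox e) = ext_d O' w \ox e + (-1) ^+ m *: (w \ox ext_d O e).
Proof.
move=> hw; rewrite /ebowtie_d (tsum_pure _ _ bilin_dV).
by rewrite (dsign_homog gO' (f := fun w => w \ox ext_d O e) _ hw) //; lin.
Qed.

Lemma dV_degree n x : homog pV n x -> homog pV n.+1 (dV x).
Proof.
have hd := lin_dV.
move: x; apply: (homog_tens_ind gO' gO) => [x x' hx hx'||i j w e <- hw he].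
- by rewrite (linD _ _ hd); exact: homogD.
- by rewrite (lin0 hd); exact: homog0.
rewrite (dV_tens _ hw); apply: homogD => //; last apply: homogZ => //.
- exact: (homog_tens gO' gO (ext_d_degree hE' hw) he).
- by rewrite -addnS; exact: (homog_tens gO' gO hw (ext_d_degree hE he)).
Qed.

Lemma dV_square x : dV (dV x) = 0.
Proof.
have hd := lin_dV.
move: x; apply: (tens_homog_ext gO' gO) => [||m n w e hw he]; [by lin|exact: lin_cst0|].
rewrite (dV_tens _ hw) (linD _ _ hd) (linZ _ _ hd) (dV_tens _ hw).
rewrite (dV_tens _ (ext_d_degree hE' hw)) (ext_d_square hE') (ext_d_square hE).
rewrite (lin0 (lin_tensl _)) (lin0 (lin_tensr _)) scaler0 addr0 add0r.
by rewrite exprS mulN1r scaleNr addNr.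
Qed.

(** The differential falls on one of the four factors of [(w . act2 t) \ox (e . z)]. It
    commutes with [act2] and with the coaction, so each term is one of the right-hand
    side up to its sign. *)
Lemma dV_leibniz n x y : homog pV n x ->
  dV (bmul x y) = bmul (dV x) y + (-1) ^+ n *: bmul x (dV y).
Proof.
have hd := lin_dV; have [bl br] := bbmul.
move: x; apply: (homog_tens_ind gO' gO) => [x x' hx hx'||i j w e <- hw he].
- by rewrite !(linD _ _ (bl _)) !(linD _ _ hd) (linD _ _ (bl _)) hx hx' scalerDr addrACA.
- by rewrite (lin0 hd) !(lin0 (bl _)) (lin0 hd) scaler0 addr0.
move: y; apply: (tens_homog_ext gO' gO) => [||m n' t z ht hz]; [by lin|by lin|].
have hdt := ext_d_degree hE' ht; have hde := ext_d_degree hE he.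
rewrite (ebowtie_mul_tens _ _ he ht) (dV_tens _ hw) (dV_tens _ ht).
rewrite (linZ _ _ hd) (cosum_out _ _ hd).
rewrite (linD _ _ (bl _)) (linD _ _ (br _)) (linZ _ _ (bl _)) (linZ _ _ (br _)).
rewrite (ebowtie_mul_tens _ _ he ht) (ebowtie_mul_tens _ _ hde ht).
rewrite (ebowtie_mul_tens _ _ he hdt) (ebowtie_mul_tens _ _ he ht).
rewrite (cosum_d hO); last by lin.
rewrite [in RHS]scalerDr !scalerA -!exprD -!cosumZ -!cosumD.
apply: (eq_cosum hO _ _ he); [by lin|by lin|] => a e' b he'.
have hat : homog p' m (act a b t) by exact: (act2_homog S hR hO').
rewrite (dV_tens _ (ext_mul_degree hE' hw hat)).
rewrite (ext_leibniz hE' _ hw) (ext_leibniz hE _ he') (act2_d S hR hO').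
rewrite (linD _ _ (lin_tensl _)) (linD _ _ (lin_tensr _)) tensZl tensZr.
rewrite !scalerDr !scalerA -!exprD -!addrA; apply: eq_add; first by [].
by rewrite [in LHS]addrCA; apply: eq_add; [sgn|apply: eq_add; sgn].
Qed.

(** ** The exterior algebra structure *)

Local Notation in2 := (tmap (ext_in O') (ext_in O) : tensor A A -> V).
Local Notation res2 := (tmap (ext_res O') (ext_res O) : V -> tensor A A).
Local Notation Bmul := (@bowtie_mul k A R S).

Lemma bilin_bowtie_mul : bilin Bmul.
Proof. by rewrite /bowtie_mul; lin. Qed.

Lemma lin_in2 : lin in2. Proof. by lin. Qed.
Lemma lin_res2 : lin res2. Proof. by lin. Qed.
Let linin2 := lin_in2. Let linres2 := lin_res2.

Lemma in2_tens a b : in2 (a \ox b) = ext_in O' a \ox ext_in O b.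
Proof. by rewrite /tmap tsum_pure //; lin. Qed.

Lemma res2_tens w e : res2 (w \ox e) = ext_res O' w \ox ext_res O e.
Proof. by rewrite /tmap tsum_pure //; lin. Qed.

Lemma res2K : cancel in2 res2.
Proof.
move=> x; move: x; apply: tens_ext => [||a b]; [by lin|by lin|].
by rewrite in2_tens res2_tens (ext_res_in hE') (ext_res_in hE).
Qed.

Lemma in2_mul x y : in2 (Bmul x y) = bmul (in2 x) (in2 y).
Proof.
have [bl br] := bbmul; have [cl cr] := bilin_bowtie_mul.
move: x; apply: tens_ext => [||a b]; [by lin|by lin|].
move: y; apply: tens_ext => [||c d]; [by lin|by lin|].
rewrite !in2_tens (ebowtie_mul_tens _ _ (homog_in hE b) (homog_in hE' c)).
rewrite mul0n scale1r (cosum_in hO); last by lin.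
rewrite /bowtie_mul tsum_pure; last by lin.
rewrite tsum_pure; last by lin.
rewrite (lin_out _ _ linin2); apply: eq_tsum => b12 b3.
rewrite (lin_out _ _ linin2); apply: eq_tsum => b1 b2.
have hl : lin (fun u => amul (ext_in O' a) u \ox amul (ext_in O b2) (ext_in O d)) by lin.
have hla := proj2 (bilin_la hR hS hO') b1.
rewrite /act2 (ra_in hR hO') (lin_out _ _ hla) (lin_out _ _ hl) (lin_out _ _ linin2).
apply: eq_tsum => c12 c3.
rewrite (linZ _ _ hla) (linZ _ _ hl) (la_in S hR hO') (lin_out _ _ hl) -tsumZ (lin_out _ _ linin2).
apply: eq_tsum => c1 c2; rewrite (linZ _ _ hl) (linZ _ _ linin2) in2_tens.
by rewrite scalerA mulrC (ext_in_mul hE) (ext_in_mul hE').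
Qed.

Lemma in2_one : in2 (aone A \ox aone A) = aone O' \ox aone O.
Proof. by rewrite in2_tens (ext_in_one hE) (ext_in_one hE'). Qed.

Lemma in2_res2 x : in2 (res2 x) = pV 0 x.
Proof.
move: x; apply: (tens_homog_ext gO' gO) => [||i j w e hw he]; [by lin|by lin|].
rewrite res2_tens in2_tens (tpr_tens gO' gO _ hw he).
case: i hw => [|i] hw; last first.
  by rewrite (res_homog hE' hw) (lin0 (lin_in hE')) (lin0 (lin_tensl _)).
case: j he => [|j] he; last first.
  by rewrite (res_homog hE he) (lin0 (lin_in hE)) (lin0 (lin_tensr _)).
by rewrite !in_res_homog.
Qed.

Lemma bowtie_algebra : is_algebra (bowtie R S).
Proof.
split=> [|x y z|x|x] /=.
- by apply/bilin_for; exact: bilin_bowtie_mul.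
- by apply: (can_inj res2K); rewrite !in2_mul ebowtie_mulA.
- by apply: (can_inj res2K); rewrite in2_mul in2_one ebowtie_mul1l.
- by apply: (can_inj res2K); rewrite in2_mul in2_one ebowtie_mul1r.
Qed.

Lemma ebowtie_algebra : is_algebra (ebowtie_ext R S O' SO).
Proof.
split; [by apply/bilin_for; exact: bbmul|exact: ebowtie_mulA|exact: ebowtie_mul1l|].
exact: ebowtie_mul1r.
Qed.

(** A one-form [a . db \ox c] is brought to the form [x . dy] by the Leibniz rule:
    [db \ox c = d (b \ox c) - b \ox dc]. *)
Lemma ebowtie_span1 x : homog pV 1 x -> exists s : seq (tensor A A * tensor A A),
  x = \sum_(q <- s) bmul (in2 q.1) (dV (in2 q.2)).
Proof.
have [bl br] := bbmul; have hd := lin_dV.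
pose P x := exists s : seq (tensor A A * tensor A A),
  x = \sum_(q <- s) bmul (in2 q.1) (dV (in2 q.2)).
have PD y z : P y -> P z -> P (y + z).
  by move=> [s ->] [t ->]; exists (s ++ t); rewrite big_cat.
have P0 : P 0 by exists [::]; rewrite big_nil.
have P1 y z : P (bmul (in2 y) (dV (in2 z))) by exists [:: (y, z)]; rewrite big_seq1.
have Psum I (r : seq I) (F : I -> V) : (forall i, P (F i)) -> P (\sum_(i <- r) F i).
  by move=> h; elim/big_ind: _ => // i _; exact: h.
have d2 c : aone O' \ox ext_d O (ext_in O c) = dV (in2 (aone A \ox c)).
  rewrite in2_tens (ext_in_one hE') (dV_tens _ (homog_one hE')) scale1r (d_one hO').
  by rewrite (lin0 (lin_tensl _)) add0r.
apply: (homog_tens_ind gO' gO (n := 1) (P := P)) => // -[|[|i]] [|[|j]] w e // _ hw he.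
- have [s ->] := ext_span1 hE he; rewrite (lin_sum _ _ (lin_tensr _)); apply: Psum => q.
  by rewrite -(in_res_homog hE' hw) -mul_right d2 -in2_tens.
- have [s ->] :=
  ext_span1 hE' hw; rewrite (lin_sum _ _ (lin_tensl _)); apply: Psum => -[a b] /=.
  rewrite -(in_res_homog hE he); move: (ext_res O e) => {e he} c.
  rewrite -mul_left.
  have -> : ext_d O' (ext_in O' b) \ox ext_in O c =
      dV (in2 (b \ox c)) - bmul (in2 (b \ox aone A)) (dV (in2 (aone A \ox c))).
    rewrite -d2 in2_tens (dV_tens _ (homog_in hE' b)) scale1r in2_tens mul_right.
    by rewrite (ext_in_one hE) (alg_one_l hAlg) addrK.
  have -> : ext_in O' a \ox aone O = in2 (a \ox aone A) by rewrite in2_tens (ext_in_one hE).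
  rewrite (linB _ _ (br _)); apply: PD => //.
  by rewrite -(linN _ (br _)) -(linN _ (bl _)) ebowtie_mulA -(linN _ linin2) -in2_mul.
Qed.

Lemma ebowtie_exterior : is_exterior (ebowtie R S O' SO).
Proof.
have [bl br] := bbmul; have hd := lin_dV.
split.
- exact: bowtie_algebra.
- exact: ebowtie_algebra.
- exact: gV.
- exact: ebowtie_mul_degree.
- exact: linin2.
- exact: in2_mul.
- exact: in2_one.
- exact: in2_res2.
- exact: res2K.
- exact: lin_dV.
- exact: dV_degree.
- exact: dV_square.
- exact: dV_leibniz.
- exact: ebowtie_span1.
move=> P Pin P1 Plin Pmul x.
have Pl w : P (w \ox aone O).
  move: w; apply: (ext_generated hE') => [a|w hw|c w w' hw hw'|w w' hw hw'].
  - by have := Pin (a \ox aone A); rewrite /= in2_tens (ext_in_one hE).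
  - by apply: P1; exact: (homog_tens gO' gO hw (homog_one hE)).
  - by rewrite (lin_tensl (aone O)); exact: Plin.
  - by have := Pmul _ _ hw hw'; rewrite /= mul_left.
have Pr e : P (aone O' \ox e).
  move: e; apply: (ext_generated hE) => [a|w hw|c w w' hw hw'|w w' hw hw'].
  - by have := Pin (aone A \ox a); rewrite /= in2_tens (ext_in_one hE').
  - by apply: P1; exact: (homog_tens gO' gO (homog_one hE') hw).
  - by rewrite (lin_tensr (aone O')); exact: Plin.
  - by have := Pmul _ _ hw hw'; rewrite /= mul_right.
rewrite [x](tensorE (x : V)).
elim/big_ind: _ => [|y z hy hz|q _].
- have := Plin (-1) _ _ (Pl 0) (Pl 0); rewrite scaleN1r addNr; exact.
- by rewrite -[y]scale1r; exact: Plin.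
- by rewrite tens_mul; exact: Pmul.
Qed.

(** * The double cross coproduct *)

Local Notation copV := (@ebowtie_cop k A O' O).
Local Notation epsV := (@ebowtie_eps k A O' O).

Lemma lin_copV : lin copV.
Proof. by rewrite /ebowtie_cop; lin. Qed.

Lemma lin_epsV : lin (epsV : V -> k^o).
Proof. by rewrite /ebowtie_eps; lin. Qed.

Let lincopV := lin_copV. Let linepsV := lin_epsV.

Lemma tsum_copV (U : lmodType k) (F : V -> V -> U) w e : bilin F ->
  tsum F (copV (w \ox e)) =
  \tsum_(w1, w2 <- eh_cop w) \tsum_(e1, e2 <- eh_cop e)
    koszul p p' (fun e1 w2 => F (w1 \ox e1) (w2 \ox e2)) e1 w2.
Proof.
move=> hF; rewrite /ebowtie_cop tsum_pure; last by lin.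
rewrite tsum_tsum //; apply: eq_tsum => w1 w2.
rewrite tsum_tsum //; apply: eq_tsum => e1 e2.
rewrite (lin_koszul_out gO gO'); [|by lin|by lin].
by apply: eq_koszul => u v; rewrite tsum_pure.
Qed.

Lemma epsV_tens w e : epsV (w \ox e) = eh_eps w * eh_eps e.
Proof. by rewrite /ebowtie_eps (tsum_pure (U := k^o)) //; split=> *; lin. Qed.

(** Both sides carry one sign for each pair [e_i], [w_j] with [i < j], namely for each
    crossing of the tensor factors; [T] is the summand with these three signs. *)
Lemma copV_coassoc (U : lmodType k) (F : V -> V -> V -> U) x : trilin F ->
  \tsum_(x12, x3 <- copV x) \tsum_(x1, x2 <- copV x12) F x1 x2 x3 =
  \tsum_(x1, x23 <- copV x) \tsum_(x2, x3 <- copV x23) F x1 x2 x3.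
Proof.
move=> hF; move: x; apply: tens_ext => [||w e]; [by lin|by lin|].
rewrite !tsum_copV; [|by lin..].
pose T w1 w2 w3 e1 e2 e3 :=
  koszul p p' (fun e1 w2 => koszul p p' (fun e1 w3 => koszul p p' (fun e2 w3 =>
    F (w1 \ox e1) (w2 \ox e2) (w3 \ox e3)) e2 w3) e1 w3) e1 w2.
have TE i j a b c w1 w2 w3 e1 e2 e3 :
    homog p i e1 -> homog p j e2 -> homog p' a w2 -> homog p' b w3 ->
    c = (i * a + i * b + j * b)%N ->
    T w1 w2 w3 e1 e2 e3 = (-1) ^+ c *: F (w1 \ox e1) (w2 \ox e2) (w3 \ox e3).
  move=> h1 h2 ha hb ->; rewrite /T (koszul_homog gO gO' _ h1 ha); last by lin.
  rewrite (koszul_homog gO gO' _ h1 hb); last by lin.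
  rewrite (koszul_homog gO gO' _ h2 hb); last by lin.
  by rewrite !scalerA -!exprD.
transitivity (\tsum_(w12, w3 <- eh_cop w) \tsum_(w1, w2 <- eh_cop w12)
    \tsum_(e12, e3 <- eh_cop e) \tsum_(e1, e2 <- eh_cop e12) T w1 w2 w3 e1 e2 e3).
  apply: eq_tsum => w12 w3; rewrite tsum_exch; apply: eq_tsum => e12 e3.
  move: e12 w3; apply: (homog_ext2 gO gO') => [||n m e12 w3 he hw3].
  - by lin.
  - by rewrite /T; lin.
  rewrite (koszul_homog gO gO' _ he hw3); last by lin.
  rewrite tsum_copV; last by lin.
  rewrite -tsumZ; apply: eq_tsum => w1 w2; rewrite -tsumZ.
  apply: (eq_tsum_homog gO gO _ _ (sb_cop_degree hO he)) => [||i j e1 e2 ij h1 h2].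
  - by lin.
  - by rewrite /T; lin.
  move: w2; apply: (homog_ext gO') => [||l w2 hw2]; [by lin|by rewrite /T; lin|].
  rewrite (koszul_homog gO gO' _ h1 hw2); last by lin.
  rewrite (TE _ _ _ _ _ _ _ _ _ _ _ h1 h2 hw2 hw3 (erefl _)) scalerA -exprD -ij.
  by sgn.
transitivity (\tsum_(w1, w23 <- eh_cop w) \tsum_(w2, w3 <- eh_cop w23)
    \tsum_(e1, e23 <- eh_cop e) \tsum_(e2, e3 <- eh_cop e23) T w1 w2 w3 e1 e2 e3).
  rewrite (eh_assoc hO'); last by rewrite /T; lin.
  apply: eq_tsum => w1 w23; apply: eq_tsum => w2 w3.
  by rewrite (eh_assoc hO) //; rewrite /T; lin.
apply: eq_tsum => w1 w23; rewrite tsum_exch; apply: eq_tsum => e1 e23.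
move: e1 w23; apply: (homog_ext2 gO gO') => [||n m e1 w23 he hw].
- by rewrite /T; lin.
- by lin.
rewrite (koszul_homog gO gO' _ he hw); last by lin.
rewrite tsum_copV; last by lin.
rewrite -tsumZ.
apply: (eq_tsum_homog gO' gO' _ _ (sb_cop_degree hO' hw)) => [||a b w2 w3 ab hw2 hw3].
- by rewrite /T; lin.
- by lin.
rewrite -tsumZ; apply: eq_tsum => e2 e3.
move: e2; apply: (homog_ext gO) => [||l e2 he2]; [by rewrite /T; lin|by lin|].
rewrite (koszul_homog gO gO' _ he2 hw3); last by lin.
rewrite (TE _ _ _ _ _ _ _ _ _ _ _ he he2 hw2 hw3 (erefl _)) scalerA -exprD -ab.
by sgn.
Qed.

Lemma copV_counit_l x : \tsum_(x1, x2 <- copV x) epsV x1 *: x2 = x.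
Proof.
move: x; apply: tens_ext => [||w e]; [by lin|by lin|].
rewrite tsum_copV; last by lin.
rewrite -[in RHS](@eh_counit_l _ _ _ hO' _ (fun w => w \ox e) w); last by lin.
apply: eq_tsum => w1 w2.
rewrite -(@eh_counit_l _ _ _ hO _ (fun e => eh_eps w1 *: (w2 \ox e)) e); last by lin.
apply: eq_tsum => e1 e2; rewrite (eq_koszul0 gO gO') => [||m n v u hv hu].
- by rewrite epsV_tens scalerA mulrC.
- by lin.
case: m hv => // m hv _.
by rewrite epsV_tens (eps_homog hO hv) mulr0 scale0r.
Qed.

Lemma copV_counit_r x : \tsum_(x1, x2 <- copV x) epsV x2 *: x1 = x.
Proof.
move: x; apply: tens_ext => [||w e]; [by lin|by lin|].
rewrite tsum_copV; last by lin.
rewrite -[in RHS](@eh_counit_r _ _ _ hO' _ (fun w => w \ox e) w); last by lin.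
apply: eq_tsum => w1 w2.
rewrite -(@eh_counit_r _ _ _ hO _ (fun e => eh_eps w2 *: (w1 \ox e)) e); last by lin.
apply: eq_tsum => e1 e2; rewrite (eq_koszul0 gO gO') => [||m n v u hv hu].
- by rewrite epsV_tens scalerA mulrC.
- by lin.
case: n hu => [|n] hu; rewrite ?muln0 // => _.
by rewrite epsV_tens (eps_homog hO' hu) mul0r scale0r.
Qed.

Lemma ebowtie_coalgebra : is_coalgebra (eh_bialg (ebowtie R S O' SO)).
Proof.
split.
- exact: lincopV.
- exact: linepsV.
- by move=> x; apply: (copV_coassoc (F := fun x y z => x \ox (y \ox z))); lin.
- exact: copV_counit_l.
- exact: copV_counit_r.
Qed.

Lemma copV_degree n x : homog pV n x -> homog (tpr pV pV) n (copV x).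
Proof.
have gVV := tpr_grading gV gV.
move: x; apply: (homog_tens_ind gO' gO) => [x y hx hy||i j w e <- hw he].
- by rewrite (linD _ _ lincopV); exact: homogD.
- by rewrite (lin0 lincopV); exact: homog0.
rewrite -[copV _]tsum_id tsum_copV; last by lin.
apply: (homog_tsum gO' gO' gVV _ (sb_cop_degree hO' hw)) => [|a b w1 w2 ab hw1 hw2].
  by lin.
apply: (homog_tsum gO gO gVV _ (sb_cop_degree hO he)) => [|c d e1 e2 cd he1 he2].
  by lin.
rewrite (koszul_homog gO gO' _ he1 hw2); last by lin.
apply: homogZ => //; rewrite -ab -cd addnACA.
by apply: (homog_tens gV gV); exact: (homog_tens gO' gO).
Qed.

Lemma copV_in x : copV (in2 x) = tmap in2 in2 (@bowtie_cop k A x).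
Proof.
have hb : lin (@bowtie_cop k A) by rewrite /bowtie_cop; lin.
move: x; apply: tens_ext => [||a b]; [by lin|by lin|].
rewrite in2_tens -[copV _]tsum_id tsum_copV; last by lin.
rewrite (tsum_cop_in hO'); last by lin.
rewrite /bowtie_cop tsum_pure; last by lin.
rewrite /tmap tsum_tsum; last by split=> *; lin.
apply: eq_tsum => a1 a2; rewrite (tsum_cop_in hO); last by lin.
rewrite tsum_tsum; last by split=> *; lin.
apply: eq_tsum => b1 b2; rewrite (koszul0l gO gO'); [|by lin|exact: homog_in].
rewrite tsum_pure; last by split=> *; lin.
by rewrite -!in2_tens.
Qed.

Local Notation VA := (ext_alg (ebowtie_ext R S O' SO)).

(** Four terms appear on both sides, in which [d] falls on [w1], [w2], [e1] or [e2]. *)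
Lemma copV_d x : copV (dV x) = @dtens k VA pV dV (copV x).
Proof.
have hd := lin_dV; have hD := @lin_dtens k VA pV gV dV hd.
have bd := bilin_dtens_fun gO (lin_d hE); have bd' := bilin_dtens_fun gO' (lin_d hE').
move: x; apply: (tens_homog_ext gO' gO) => [||m n w e hw he]; [by lin|by lin|].
rewrite (dV_tens _ hw) (linD _ _ lincopV) (linZ _ _ lincopV).
rewrite -[copV (ext_d O' w \ox e)]tsum_id -[copV (w \ox ext_d O e)]tsum_id.
rewrite -[in RHS](tsum_id (copV _)) !tsum_copV; [|by lin..].
rewrite (sb_cop_d hO') tsum_tsum; last by lin.
rewrite (lin_out _ _ hD) -tsumZ -tsumD.
apply: (eq_tsum_homog gO' gO' _ _ (sb_cop_degree hO' hw)) => [||i j w1 w2 ij h1 h2].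
- by lin.
- by lin.
rewrite (sb_cop_d hO) tsum_tsum; last by lin.
rewrite (linD _ _ (lin_tsum _)); last by lin.
rewrite tsum_pure; last by lin.
rewrite (dsign_homog gO' _ h1); last by lin.
rewrite (linZ _ _ (lin_tsum _)); last by lin.
rewrite tsum_pure; last by lin.
rewrite (lin_out _ _ hD) -!tsumZ -!tsumD.
apply: (eq_tsum_homog gO gO _ _ (sb_cop_degree hO he)) => [||a b e1 e2 ab ha hb].
- by lin.
- by lin.
have dw2 := ext_d_degree hE' h2; have de1 := ext_d_degree hE ha.
rewrite (linD _ _ (lin_tsum _)); last by lin.
rewrite tsum_pure; last by lin.
rewrite (dsign_homog gO _ ha); last by lin.
rewrite (linZ _ _ (lin_tsum _)); last by lin.
rewrite tsum_pure; last by lin.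
rewrite (koszul_homog gO gO' _ ha h2); last by lin.
rewrite (koszul_homog gO gO' _ ha dw2); last by lin.
rewrite (koszul_homog gO gO' _ de1 h2); last by lin.
rewrite (koszul_homog gO gO' _ ha h2); last by lin.
rewrite (koszul_homog gO gO' _ ha h2); last by lin.
rewrite (linZ _ _ hD) (@dtens_tens k VA pV gV dV hd _ _ _ (homog_tens gO' gO h1 ha)).
rewrite !(dV_tens _ h1, dV_tens _ h2) !(linD _ _ (lin_tensl _)) !(linD _ _ (lin_tensr _)).
rewrite !(tensZl, tensZr) !scalerDr !scalerA -!exprD -!addrA.
apply: eq_add; first by sgn.
rewrite addrCA; apply: eq_add; first by rewrite -ij; sgn.
by apply: eq_add; rewrite -?ij; sgn.
Qed.

Let hVA : is_algebra VA := ebowtie_algebra.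

Local Notation smul := (@stmul k VA VA pV pV).

Lemma copV_left a : copV (ext_in O' a \ox aone O) =
  \tsum_(a1, a2 <- cop a) (ext_in O' a1 \ox aone O) \ox (ext_in O' a2 \ox aone O).
Proof.
rewrite -[LHS]tsum_id tsum_copV; last by lin.
rewrite (tsum_cop_in hO'); last by lin.
apply: eq_tsum => a1 a2; rewrite (tsum_cop_one hO); last by lin.
by rewrite (koszul0l gO gO') //; [lin|exact: homog_one].
Qed.

Lemma copV_right c : copV (aone O' \ox ext_in O c) =
  \tsum_(c1, c2 <- cop c) (aone O' \ox ext_in O c1) \ox (aone O' \ox ext_in O c2).
Proof.
rewrite -[LHS]tsum_id tsum_copV; last by lin.
rewrite (tsum_cop_one hO'); last by lin.
rewrite (tsum_cop_in hO); last by lin.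
by apply: eq_tsum => c1 c2; rewrite (koszul0l gO gO') //; [lin|exact: homog_in].
Qed.

(** [x2] is what crosses the first leg of the coproduct, without a sign in degree zero. *)
Lemma smul_copV (x1 x2 : V) t z : homog pV 0 x2 ->
  smul (x1 \ox x2) (copV (t \ox z)) =
  \tsum_(t1, t2 <- eh_cop t) \tsum_(z1, z2 <- eh_cop z)
    koszul p p' (fun z1 t2 => bmul x1 (t1 \ox z1) \ox bmul x2 (t2 \ox z2)) z1 t2.
Proof.
have [bl br] := bbmul; have [sl sr] := @bilin_stmul k VA pV hVA gV.
move=> hx2; rewrite -[copV _]tsum_id tsum_copV; last by lin.
rewrite (lin_out _ _ (sr _)); apply: eq_tsum => t1 t2.
rewrite (lin_out _ _ (sr _)); apply: eq_tsum => z1 z2.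
rewrite (lin_koszul_out gO gO'); [|by lin|exact: sr].
by apply: eq_koszul => u v; exact: (@stmul0l k VA pV hVA gV).
Qed.

(** No braiding occurs here, only the multiplicativity of the coproduct of [Omega'(A)]. *)
Lemma copV_mul_left a y : copV (bmul (ext_in O' a \ox aone O) y) =
  smul (copV (ext_in O' a \ox aone O)) (copV y).
Proof.
have [bl br] := bbmul; have [sl sr] := @bilin_stmul k VA pV hVA gV.
move: y; apply: tens_ext => [||t z]; [by lin|by lin|].
rewrite mul_left copV_left (lin_out _ _ (sl _)).
rewrite -[LHS]tsum_id tsum_copV; last by lin.
rewrite (tsum_cop_in_mul hO'); last by lin.
apply: eq_tsum => a1 a2.
rewrite (smul_copV _ _ _ (homog_tens gO' gO (homog_in hE' a2) (homog_one hE))).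
apply: eq_tsum => t1 t2; apply: eq_tsum => z1 z2.
rewrite -(koszul_comp_r gO gO' gO' (g := amul (ext_in O' a2))) //; last 3 first.
- by lin.
- by lin.
- by move=> n w hw; exact: (ext_mul_degree hE' (homog_in hE' a2) hw).
by apply: eq_koszul => u v; rewrite !mul_left.
Qed.

Lemma mul_right_in c t z : bmul (aone O' \ox ext_in O c) (t \ox z) =
  \tsum_(c12, c3 <- cop c) \tsum_(c1, c2 <- cop c12)
    act c1 c3 t \ox amul (ext_in O c2) z.
Proof.
have [bl br] := bbmul.
move: t; apply: (homog_ext gO') => [||n t ht]; [by lin|by lin|].
rewrite (ebowtie_mul_tens _ _ (homog_in hE c) ht) mul0n scale1r (cosum_in hO); last by lin.
by apply: eq_tsum => c12 c3; apply: eq_tsum => c1 c2; rewrite (alg_one_l hAlg').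
Qed.

(** On the left, the coproduct of [act2 c1 c4 t] is [la c1 t1 \ox ra c4 t2] by [cop_act2]. On
    the right, [act2 c1 c3 t1 \ox act2 c4 c6 t2] occurs, where [ra c3] and [la c4] cancel.
    The summand common to both sides is [G]. *)
Lemma copV_mul_right c y : copV (bmul (aone O' \ox ext_in O c) y) =
  smul (copV (aone O' \ox ext_in O c)) (copV y).
Proof.
have [bl br] := bbmul; have [sl sr] := @bilin_stmul k VA pV hVA gV.
have bla := bilin_la hR hS hO'; have bra := bilin_ra hR hO'.
move: y; apply: tens_ext => [||t z]; [by lin|by lin|].
pose G c1 c2 c3 c4 t1 t2 z1 z2 : tensor V V := koszul p p' (fun z1 t2 =>
  (la S R c1 t1 \ox amul (ext_in O c2) z1) \ox (ra R c4 t2 \ox amul (ext_in O c3) z2)) z1 t2.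
pose H c1 c2 c3 c4 t1 t2 := \tsum_(z1, z2 <- eh_cop z) G c1 c2 c3 c4 t1 t2 z1 z2.
transitivity (\tsum_(q, r <- cop c) \tsum_(c1, c2 <- cop q) \tsum_(c3, c4 <- cop r)
    \tsum_(t1, t2 <- eh_cop t) H c1 c2 c3 c4 t1 t2).
  rewrite mul_right_in (lin_out _ _ lincopV).
  transitivity (\tsum_(c12, c4 <- cop c) \tsum_(c1, c23 <- cop c12)
      \tsum_(c2, c3 <- cop c23) \tsum_(t1, t2 <- eh_cop t) H c1 c2 c3 c4 t1 t2).
    apply: eq_tsum => c12 c4; rewrite (lin_out _ _ lincopV); apply: eq_tsum => c1 c23.
    rewrite -[LHS]tsum_id tsum_copV; last by lin.
    rewrite (cop_act2 hR hS hO'); last by lin.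
    rewrite [RHS]tsum_exch; apply: eq_tsum => t1 t2.
    rewrite (tsum_cop_in_mul hO); last by lin.
    apply: eq_tsum => c2 c3; apply: eq_tsum => z1 z2; rewrite /G.
    rewrite -(koszul_comp_r gO gO' gO' (g := ra R c4)
      (F := fun e w => (la S R c1 t1 \ox e) \ox (w \ox amul (ext_in O c3) z2))); last 3 first.
    - by lin.
    - by lin.
    - by move=> n w hw; exact: (ra_homog hR hO').
    rewrite -(koszul_comp_l gO gO gO' (g := amul (ext_in O c2))
      (F := fun e w => (la S R c1 t1 \ox e) \ox (ra R c4 w \ox amul (ext_in O c3) z2))) //.
    - by lin.
    - by lin.
    - by move=> n w hw; exact: (ext_mul_degree hE (homog_in hE c2) hw).
  by rewrite (cop_assoc_pairs hCA (F := fun c1 c2 c3 c4 =>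
    \tsum_(t1, t2 <- eh_cop t) H c1 c2 c3 c4 t1 t2)) // /H /G; lin.
rewrite copV_right (lin_out _ _ (sl _)); apply: esym.
pose M u12 u3 v1 v23 := \tsum_(u1, u2 <- cop u12) \tsum_(v2, v3 <- cop v23)
  \tsum_(t1, t2 <- eh_cop t) H u1 u2 v2 v3 (ra R u3 t1) (la S R v1 t2).
transitivity (\tsum_(u, v <- cop c) \tsum_(u12, u3 <- cop u) \tsum_(v1, v23 <- cop v)
    M u12 u3 v1 v23).
  apply: eq_tsum => u v.
  rewrite (smul_copV _ _ _ (homog_tens gO' gO (homog_one hE') (homog_in hE v))).
  transitivity (\tsum_(u12, u3 <- cop u) \tsum_(u1, u2 <- cop u12)
    \tsum_(v1, v23 <- cop v) \tsum_(v2, v3 <- cop v23) \tsum_(t1, t2 <- eh_cop t)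
    H u1 u2 v2 v3 (ra R u3 t1) (la S R v1 t2)); last first.
    apply: eq_tsum => u12 u3; rewrite [LHS]tsum_exch; apply: eq_tsum => v1 v23.
    by apply: eq_tsum => u1 u2.
  pose X t1 t2 z1 z2 u1 u2 u3 v1 v2 v3 : tensor V V := koszul p p' (fun z1 t2 =>
    (act u1 u3 t1 \ox amul (ext_in O u2) z1) \ox (act v1 v3 t2 \ox amul (ext_in O v2) z2)) z1 t2.
  transitivity (\tsum_(t1, t2 <- eh_cop t) \tsum_(z1, z2 <- eh_cop z)
    \tsum_(u12, u3 <- cop u) \tsum_(u1, u2 <- cop u12)
    \tsum_(v1, v23 <- cop v) \tsum_(v2, v3 <- cop v23) X t1 t2 z1 z2 u1 u2 u3 v1 v2 v3).
    apply: eq_tsum => t1 t2; apply: eq_tsum => z1 z2.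
    under eq_koszul => z1' t2'.
      rewrite !mul_right_in (lin_out _ _ (lin_tensl _)).
      under eq_tsum => u12 u3.
        rewrite (lin_out _ _ (lin_tensl _)).
        under eq_tsum => u1 u2.
          rewrite (cop_assoc hCA (F := fun v1 v2 v3 => act v1 v3 t2' \ox amul (ext_in O v2) z2));
            last by lin.
          rewrite (lin_out _ _ (lin_tensr _)).
          under eq_tsum => v1 v23 do rewrite (lin_out _ _ (lin_tensr _)).
          over.
        over.
      over.
    rewrite (koszul_tsum gO gO'); last by move=> *; lin.
    apply: eq_tsum => u12 u3; rewrite (koszul_tsum gO gO'); last by move=> *; lin.
    apply: eq_tsum => u1 u2; rewrite (koszul_tsum gO gO'); last by move=> *; lin.
    by apply: eq_tsum => v1 v23; rewrite (koszul_tsum gO gO') //; move=> *; lin.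
  transitivity (\tsum_(t1, t2 <- eh_cop t)
    \tsum_(u12, u3 <- cop u) \tsum_(u1, u2 <- cop u12)
    \tsum_(v1, v23 <- cop v) \tsum_(v2, v3 <- cop v23)
    \tsum_(z1, z2 <- eh_cop z) X t1 t2 z1 z2 u1 u2 u3 v1 v2 v3).
    by apply: eq_tsum => t1 t2; do 4! (rewrite [LHS]tsum_exch; apply: eq_tsum => ? ?).
  rewrite [LHS]tsum_exch; apply: eq_tsum => u12 u3.
  rewrite [LHS]tsum_exch; apply: eq_tsum => u1 u2.
  rewrite [LHS]tsum_exch; apply: eq_tsum => v1 v23.
  rewrite [LHS]tsum_exch; apply: eq_tsum => v2 v3.
  apply: eq_tsum => t1 t2; apply: eq_tsum => z1 z2; rewrite /X /G.
  rewrite -(koszul_comp_r gO gO' gO' (g := la S R v1)); last 3 first.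
  - by lin.
  - by lin.
  - by move=> n w hw; exact: (la_homog S hR hO').
  by apply: eq_koszul => z1' t2'; rewrite -(la_ra hR hS hO').
rewrite (cop_assoc_mid hCA (F := M)); last 4 first.
- by rewrite /M /H /G; lin.
- by rewrite /M /H /G; lin.
- by rewrite /M /H /G; lin.
- by rewrite /M /H /G; lin.
apply: eq_tsum => u12 r.
transitivity (\tsum_(s, v23 <- cop r) eps s *: (\tsum_(u1, u2 <- cop u12)
  \tsum_(v2, v3 <- cop v23) \tsum_(t1, t2 <- eh_cop t) H u1 u2 v2 v3 t1 t2)).
  apply: eq_tsum => s v23; rewrite /M [LHS]tsum_exch -tsumZ; apply: eq_tsum => u1 u2.
  rewrite [LHS]tsum_exch -tsumZ; apply: eq_tsum => v2 v3.
  by rewrite (ra_la_cancel hR hS hO' (F := H u1 u2 v2 v3)) // /H /G; lin.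
by rewrite (counit_l hCA (f := fun v23 => \tsum_(u1, u2 <- cop u12)
  \tsum_(v2, v3 <- cop v23) \tsum_(t1, t2 <- eh_cop t) H u1 u2 v2 v3 t1 t2)) // /H /G; lin.
Qed.

Lemma copV_mul x y : copV (bmul x y) = smul (copV x) (copV y).
Proof.
have [bl br] := bbmul; have [sl sr] := @bilin_stmul k VA pV hVA gV.
apply: (@cop_mul_from_base k _ (ebowtie R S O' SO) ebowtie_exterior lincopV copV_in copV_d).
move=> b {}y; rewrite /=; move: b; apply: tens_ext => [||a c]; [by lin|by lin|].
have smulA := @stmul_assoc k VA pV hVA gV ebowtie_mul_degree.
rewrite in2_tens tens_mul -ebowtie_mulA !copV_mul_left copV_mul_right.
by rewrite -smulA.
Qed.

(** By [eps_act2] the counit of [act2 e_(-1) e_(1) t] is the convolution of [R] with its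
    inverse. *)
Lemma epsV_mul x y : epsV (bmul x y) = epsV x * epsV y.
Proof.
have [bl br] := bbmul.
move: x; apply: (tens_homog_ext gO' gO (U := k^o)) => [||i m w e hw he]; [by lin|by lin|].
move: y; apply: (tens_homog_ext gO' gO (U := k^o)) => [||n j t z ht hz]; [by lin|by lin|].
rewrite (ebowtie_mul_tens _ _ he ht) (linZ _ _ linepsV) (cosum_out _ _ linepsV) !epsV_tens.
have eM : forall u v : O, eh_eps (amul u v) = eh_eps u * eh_eps v.
  exact: (sbialg_eps_mul (proj1 (sb_super_hopf hO))).
have eM' : forall u v : O', eh_eps (amul u v) = eh_eps u * eh_eps v.
  exact: (sbialg_eps_mul (proj1 (sb_super_hopf hO'))).
transitivity ((-1) ^+ (m * n) * ((eh_eps w * eh_eps z) *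
    cosum (fun a e' b => eh_eps (act a b t) * eh_eps e' : k) e)).
  congr (_ * _); rewrite -[RHS]/((eh_eps w * eh_eps z) *: (_ : k^o)).
  rewrite -(@cosumZ _ _ _ k^o); apply: eq_cosum0 => a e' b.
  rewrite epsV_tens eM eM' /GRing.scale /= -!mulrA; congr (_ * _).
  by rewrite [RHS]mulrC mulrA.
have -> : cosum (fun a e' b => eh_eps (act a b t) * eh_eps e' : k) e = eh_eps e * eh_eps t.
  have bact : bilin (fun a b => eh_eps (act a b t) : k^o) by lin.
  transitivity (\tsum_(e1, e2 <- eh_cop e)
      (eh_eps (act (ext_res O e1) (ext_res O e2) t) : k^o)).
    apply: eq_tsum => e1 e2.
    rewrite -(eh_counit_r hO e1 (f := fun e1 => eh_eps (act (ext_res O e1) (ext_res O e2) t) : k^o));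
      last by lin.
    by apply: eq_tsum => e3 e4; rewrite [LHS]mulrC.
  rewrite (res_cop hO (F := fun a b => eh_eps (act a b t) : k^o)) //.
  rewrite (eps_res hO' t) (eps_res hO e).
  have := R_S_l hR hS (ext_res O e) (ext_res O' t) (1 : k^o).
  rewrite /GRing.scale /= mulr1 => <-; apply: eq_tsum => a b.
  by rewrite (eps_act2 S hR hO'); apply: eq_tsum => t1 t2; rewrite mulr1.
rewrite -mulrA -[RHS]mulrA [eh_eps z * _]mulrC.
case: n ht => [|n] ht; first by rewrite muln0 mul1r !mulrA.
by rewrite (eps_homog hO' ht) !(mulr0, mul0r).
Qed.

(** ** The antipode *)

Lemma ebowtie_super_bialgebra :
  is_super_bialgebra (eh_bialg (ebowtie R S O' SO)) pV.
Proof.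
have gVV := tpr_grading gV gV.
split=> /=.
- exact: hVA.
- exact: ebowtie_coalgebra.
- move=> b c x y; exact: (parity_bilin gV gV gV bbmul ebowtie_mul_degree).
- exact: (parity_homog gV (homog_tens gO' gO (homog_one hE') (homog_one hE))).
- move=> b x; exact: (parity_lin gV gVV lincopV copV_degree).
- move=> x hx.
  have H n y : homog pV n y -> odd n -> epsV y = 0 :> k.
    move=> hy on; move: y hy.
    apply: (homog_tens_ind gO' gO) => [y z hy hz||i j w e ij hw he].
    - by rewrite (linD _ _ linepsV) hy hz addr0.
    - exact: (lin0 linepsV).
    rewrite epsV_tens; case: i ij hw => [|i] ij hw; last first.
      by rewrite (eps_homog hO' hw) mul0r.
    by case: j ij he => [ij|j _ he]; [rewrite -ij in on|rewrite (eps_homog hO he) mulr0].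
  have [N hN] := pr_bound gV x; rewrite (pr_sum gV hN) (lin_sum _ _ linepsV) big1 // => i _.
  case oi: (odd i); first exact: (H i _ (homog_pr gV i x) oi).
  by rewrite hx ?oi // (lin0 linepsV).
- exact: copV_mul.
- rewrite -[LHS]tsum_id tsum_copV; last by lin.
  rewrite (tsum_cop_one hO'); last by lin.
  rewrite (tsum_cop_one hO); last by lin.
  by rewrite (koszul0l gO gO') //; [lin|exact: homog_one].
- exact: epsV_mul.
- rewrite epsV_tens; have := sbialg_eps_one (proj1 (sb_super_hopf hO)).
  have := sbialg_eps_one (proj1 (sb_super_hopf hO')).
  by rewrite /= => -> ->; rewrite mulr1.
Qed.

Section Antipode.
Context (SO' : O' -> O') (hSO' : is_super_antipode (eh_bialg O') p' SO').
Let linSO' : lin SO' := lin_SO hSO'.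

(** The anti-multiplicative extension of the antipodes of the two factors. *)
Definition ebowtie_antipode (x : V) : V :=
  \tsum_(w, e <- x) koszul p p' (fun e w =>
    bmul (aone O' \ox SO e) (SO' w \ox aone O)) e w.
Local Notation SV := ebowtie_antipode.

Let bilin_anti : bilin (fun e w => bmul (aone O' \ox SO e) (SO' w \ox aone O)).
Proof. by have [bl br] := bbmul; lin. Qed.

Lemma lin_SV : lin SV.
Proof.
apply: lin_tsum; split=> [e|w]; first exact: (lin_koszul_r gO gO' e bilin_anti).
exact: (lin_koszul_l gO gO' w bilin_anti).
Qed.

Lemma SV_tens m n w e : homog p' m w -> homog p n e ->
  SV (w \ox e) = (-1) ^+ (n * m) *: bmul (aone O' \ox SO e) (SO' w \ox aone O).
Proof.
move=> hw he; rewrite /ebowtie_antipode tsum_pure.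
  by rewrite (koszul_homog gO gO' bilin_anti he hw).
split=> [e0|w0]; first exact: (lin_koszul_r gO gO' e0 bilin_anti).
exact: (lin_koszul_l gO gO' w0 bilin_anti).
Qed.

Lemma SV_homog n x : homog pV n x -> homog pV n (SV x).
Proof.
have hl := lin_SV.
move: x; apply: (homog_tens_ind gO' gO) => [x y hx hy||i j w e <- hw he].
- by rewrite (linD _ _ hl); exact: homogD.
- by rewrite (lin0 hl); exact: homog0.
rewrite (SV_tens hw he); apply: homogZ => //; rewrite addnC.
apply: ebowtie_mul_degree.
- rewrite -[j]add0n; apply: (homog_tens gO' gO (homog_one hE')).
  exact: (SO_homog hO hSO he).
- rewrite -[i]addn0; apply: (homog_tens gO' gO _ (homog_one hE)).
  exact: (SO_homog hO' hSO' hw).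
Qed.

(** [S (w1 \ox e1) (w2 \ox e2)] contains [S' w1 * w2] between elements of [Omega(A)], and then
    [S e1 * e2]. *)
Lemma SV_l x : \tsum_(x1, x2 <- copV x) bmul (SV x1) x2 = epsV x *: (aone O' \ox aone O).
Proof.
have [bl br] := bbmul; have hl := lin_SV.
move: x; apply: (tens_homog_ext gO' gO) => [||m n w e hw he]; [by lin|by lin|].
rewrite tsum_copV; last by lin.
rewrite tsum_exch.
pose T (w' : O') e1 e2 := bmul (aone O' \ox SO e1) (bmul (w' \ox aone O) (aone O' \ox e2)).
have bT1 e1 e2 : lin (fun w' => T w' e1 e2) by rewrite /T; lin.
have bT2 w' : bilin (T w') by rewrite /T; lin.
(* The sum over the coproduct of [w] gives a counit, so only [m = 0] survives. *)
transitivity (\tsum_(e1, e2 <- eh_cop e) eh_eps w *: T (aone O') e1 e2).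
  apply: (eq_tsum_homog gO gO _ _ (sb_cop_degree hO he)) => [||a b e1 e2 ab ha hb].
  - by lin.
  - by lin.
  transitivity ((-1) ^+ (a * m) *: (eh_eps w *: T (aone O') e1 e2)); last first.
    case: m hw => [|m] hw; first by rewrite muln0 scale1r.
    by rewrite (eps_homog hO' hw) scale0r scaler0.
  rewrite -(linZ _ _ (bT1 e1 e2)) -(SO_l hSO') (lin_out _ _ (bT1 e1 e2)) -tsumZ.
  apply: (eq_tsum_homog gO' gO' _ _ (sb_cop_degree hO' hw)) => [||i j w1 w2 ij h1 h2].
  - by lin.
  - by lin.
  rewrite (koszul_homog gO gO' _ ha h2); last by lin.
  rewrite (SV_tens h1 ha) (linZ _ _ (bl _)) scalerA -exprD /T.
  rewrite -mul_left -!ebowtie_mulA -tens_mul; apply: sign_scale => //.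
  by rewrite -ij; sgn_odd.
rewrite tsumZ epsV_tens -scalerA.
under eq_tsum => e1 e2 do rewrite /T -tens_mul mul_right.
by rewrite -(lin_out _ _ (lin_tensr _)) (SO_l hSO) tensZr.
Qed.

Lemma SV_r x : \tsum_(x1, x2 <- copV x) bmul x1 (SV x2) = epsV x *: (aone O' \ox aone O).
Proof.
have [bl br] := bbmul; have hl := lin_SV.
move: x; apply: (tens_homog_ext gO' gO) => [||m n w e hw he]; [by lin|by lin|].
rewrite tsum_copV; last by lin.
pose T w1 e' w2 := bmul (w1 \ox e') (SO' w2 \ox aone O).
have bT1 w1 w2 : lin (fun e' => T w1 e' w2) by rewrite /T; lin.
have bT2 e' : bilin (fun w1 => T w1 e') by rewrite /T; lin.
transitivity (\tsum_(w1, w2 <- eh_cop w) eh_eps e *: T w1 (aone O) w2).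
  apply: (eq_tsum_homog gO' gO' _ _ (sb_cop_degree hO' hw)) => [||i j w1 w2 ij h1 h2].
  - by lin.
  - by lin.
  transitivity ((-1) ^+ (n * j) *: (eh_eps e *: T w1 (aone O) w2)); last first.
    case: n he => [|n] he; first by rewrite mul0n scale1r.
    by rewrite (eps_homog hO he) scale0r scaler0.
  rewrite -(linZ _ _ (bT1 w1 w2)) -(SO_r hSO) (lin_out _ _ (bT1 w1 w2)) -tsumZ.
  apply: (eq_tsum_homog gO gO _ _ (sb_cop_degree hO he)) => [||a b e1 e2 ab ha hb].
  - by lin.
  - by lin.
  rewrite (koszul_homog gO gO' _ ha h2); last by lin.
  rewrite (SV_tens h2 hb) (linZ _ _ (br _)) scalerA -exprD /T.
  rewrite ebowtie_mulA mul_right; apply: sign_scale => //.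
  by rewrite -ab; sgn_odd.
rewrite tsumZ epsV_tens mulrC -scalerA.
under eq_tsum => w1 w2 do rewrite /T mul_left.
by rewrite -(lin_out _ _ (lin_tensl _)) (SO_r hSO') tensZl.
Qed.

Lemma ebowtie_super_antipode :
  is_super_antipode (eh_bialg (ebowtie R S O' SO)) pV SV.
Proof.
split; first by split; [exact: lin_SV|exact: SV_l|exact: SV_r].
by move=> b x; exact: (parity_lin gV gV lin_SV SV_homog).
Qed.

End Antipode.

(** * The action on [Omega(A)] *)

Local Notation eact := (@ebowtie_act k A R S O' O SO).

(** The actions of the two factors: [t <| c = t_(0) R (t_(1), c)], and the right super
    adjoint action. *)
Definition ract c (t : O) : O := rco (fun t1 b => R b c *: t1) t.
Definition adact (u e : O) : O :=
  \tsum_(e1, e2 <- eh_cop e) koszul p p (fun e1 u => amul (amul (SO e1) u) e2) e1 u.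

Lemma bilin_ract : bilin ract. Proof. by rewrite /ract; lin. Qed.
Lemma bilin_adact : bilin adact. Proof. by rewrite /adact; lin. Qed.
Let bract := bilin_ract. Let badact := bilin_adact.

Lemma ract_homog n c t : homog p n t -> homog p n (ract c t).
Proof.
move=> ht; rewrite /homog /ract [in LHS]/rco (lin_out _ _ (lin_pr gO n)).
apply: (eq_rco hO (F := fun x a' => p n (R a' c *: x)) _ _ ht) => [||x q hx]; [by lin|by lin|].
by rewrite (linZ _ _ (lin_pr gO n)) hx.
Qed.

Lemma ract_d c t : ract c (ext_d O t) = ext_d O (ract c t).
Proof.
rewrite /ract (rco_d hO); last by lin.
rewrite [in RHS]/rco (lin_out _ _ (lin_d hE)).
by apply: eq_tsum => t1 t2; rewrite (linZ _ _ (lin_d hE)).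
Qed.

Lemma ract_one t : ract (aone A) t = t.
Proof.
rewrite /ract -[RHS](rco_counit hO t (@lin_id _ _)).
by apply: eq_tsum => t1 t2; rewrite (R_one_r hR).
Qed.

Lemma one_ract c : ract c (aone O) = eps c *: aone O.
Proof. by rewrite /ract (rco_one hO) ?(R_one_l hR) //; lin. Qed.

Lemma ract_mul c c' t : ract (amul c c') t = ract c' (ract c t).
Proof.
rewrite {1}/ract /rco.
under eq_tsum => t1 t2 do rewrite (R_mul_r hR).
rewrite -/(rco (fun t1 b => \tsum_(b1, b2 <- cop b) R b1 c' *: (R b2 c *: t1)) t).
rewrite -(rco_coassoc hO (F := fun t1 b1 b2 => R b1 c' *: (R b2 c *: t1))); last by lin.
rewrite [ract c t]/ract {1}/rco [in RHS]/rco (lin_out _ _ (proj2 bract c')).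
apply: eq_tsum => t1 t2; rewrite (linZ _ _ (proj2 bract c')) /ract /rco -tsumZ.
by apply: eq_tsum => x y; rewrite !scalerA mulrC.
Qed.

Lemma mul_ract c t u :
  ract c (amul t u) = \tsum_(c1, c2 <- cop c) amul (ract c1 t) (ract c2 u).
Proof.
rewrite {1}/ract (rco_mul hO); last by lin.
rewrite /rco.
under eq_tsum => t1 t2 do under eq_tsum => u1 u2 do rewrite (R_mul_l hR).
under eq_tsum => t1 t2 do rewrite tsum_exch.
rewrite tsum_exch; apply: eq_tsum => c1 c2.
rewrite {1}/ract /rco (lin_out _ _ (lin_amul_l hAlg _)); apply: eq_tsum => t1 t2.
rewrite /ract /rco (lin_out _ _ (lin_amul_r hAlg _)); apply: eq_tsum => u1 u2.
by rewrite amulZl // amulZr // !scalerA mulrC.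
Qed.

Lemma ract_in c b : ract c (ext_in O b) = \tsum_(b1, b2 <- cop b) R b2 c *: ext_in O b1.
Proof. by rewrite /ract (rco_in hO) //; lin. Qed.

Lemma eactE t x : eact t x = \tsum_(w, e <- x) adact (ract (ext_res O' w) t) e.
Proof.
apply: eq_tsum => w e; apply: eq_tsum => e1 e2.
rewrite -(koszul_comp_r gO gO gO (g := ract (ext_res O' w))
  (F := fun e1 u => amul (amul (SO e1) u) e2)); last 3 first.
- by lin.
- by lin.
- by move=> n u hu; exact: ract_homog.
apply: eq_koszul => {}e1 {}t.
have hl : lin (fun u => amul (amul (SO e1) u) e2) by lin.
by rewrite /ract /rco (lin_out _ _ hl); apply: eq_tsum => t1 t2; rewrite (linZ _ _ hl).
Qed.

Let bfun t : bilin (fun w e => adact (ract (ext_res O' w) t) e).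
Proof. by lin. Qed.

Lemma eact_tens t w e : eact t (w \ox e) = adact (ract (ext_res O' w) t) e.
Proof. by rewrite eactE (tsum_pure _ _ (bfun t)). Qed.

Lemma bilin_eact : bilin eact.
Proof.
split=> [x|t]; last by move=> a x y; rewrite !eactE; exact: (lin_tsum (bfun t)).
move=> a t u; rewrite !eactE; move: a t u.
by change (lin (fun t => \tsum_(w, e <- x) adact (ract (ext_res O' w) t) e)); lin.
Qed.
Let beact := bilin_eact.

Lemma adact_homog m n u e : homog p m u -> homog p n e -> homog p (m + n) (adact u e).
Proof.
move=> hu he; apply: (homog_tsum gO gO gO _ (sb_cop_degree hO he)) => [|i j e1 e2 <- h1 h2].
  by lin.
rewrite (koszul_homog gO gO _ h1 hu); last by lin.
apply: homogZ => //; rewrite addnCA addnA.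
apply: (ext_mul_degree hE) h2; apply: (ext_mul_degree hE) hu.
exact: (SO_homog hO hSO h1).
Qed.

Lemma adact_one u : adact u (aone O) = u.
Proof.
rewrite /adact (tsum_cop_one hO); last by lin.
rewrite (koszul0l gO gO); [|by lin|exact: homog_one].
rewrite -{1}(ext_in_one hE) (SO_in hO hS hSO) (S_one hR hS) (ext_in_one hE).
by rewrite (alg_one_l hAlg) (alg_one_r hAlg).
Qed.

Lemma one_adact e : adact (aone O) e = eh_eps e *: aone O.
Proof.
rewrite -(SO_l hSO); apply: eq_tsum => e1 e2.
by rewrite (koszul0r gO gO) ?(alg_one_r hAlg) //; [lin|exact: homog_one].
Qed.

Lemma adact_in u c : adact u (ext_in O c) =
  \tsum_(c1, c2 <- cop c) amul (amul (ext_in O (S c1)) u) (ext_in O c2).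
Proof.
rewrite /adact (tsum_cop_in hO); last by lin.
apply: eq_tsum => c1 c2; rewrite (koszul0l gO gO); [|by lin|exact: homog_in].
by rewrite (SO_in hO hS hSO).
Qed.

(** The antipode commutes with [d], so [d] falls on each factor of [S e1 * u * e2] in turn. *)
Lemma adact_d m u e : homog p m u ->
  ext_d O (adact u e) = adact (ext_d O u) e + (-1) ^+ m *: adact u (ext_d O e).
Proof.
move=> hu; have hd := lin_d hE; have bd := bilin_dtens_fun gO hd.
have bk u' : bilin (fun e1 e2 => koszul p p (fun e1 u => amul (amul (SO e1) u) e2) e1 u') by lin.
move: e; apply: (homog_ext gO) => [||n e he]; [by lin|by lin|].
rewrite /adact (sb_cop_d hO) tsum_tsum // (lin_out _ _ hd) -tsumZ -tsumD.
apply: (eq_tsum_homog gO gO _ _ (sb_cop_degree hO he)) => [||i j e1 e2 ij h1 h2].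
- by lin.
- by lin.
have hdu := ext_d_degree hE hu; have h1' := SO_homog hO hSO h1.
rewrite (linD _ _ (lin_tsum (bk u))) tsum_pure //.
rewrite (dsign_homog gO _ h1); last by lin.
rewrite (linZ _ _ (lin_tsum (bk u))) tsum_pure //.
rewrite (koszul_homog gO gO _ h1 hu); last by lin.
rewrite (koszul_homog gO gO _ h1 hdu); last by lin.
rewrite (koszul_homog gO gO _ (ext_d_degree hE h1) hu); last by lin.
rewrite (koszul_homog gO gO _ h1 hu); last by lin.
rewrite (linZ _ _ hd) (ext_leibniz hE _ (ext_mul_degree hE h1' hu)).
rewrite (ext_leibniz hE _ h1') (SO_d hO hSO) amulDl // amulZl // !scalerDr !scalerA -!exprD.
rewrite -!addrA [LHS]addrCA; apply: eq_add; first by sgn.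
by apply: eq_add; sgn.
Qed.

(** The adjoint action is a right action, because the antipode reverses products. *)
Lemma adact_mul_in u c z : adact u (amul (ext_in O c) z) = adact (adact u (ext_in O c)) z.
Proof.
rewrite {1}/adact (tsum_cop_in_mul hO); last by lin.
rewrite adact_in (lin_out _ _ (proj1 badact z)); apply: eq_tsum => c1 c2.
apply: eq_tsum => z1 z2.
rewrite -(koszul_comp_r gO gO gO
  (g := fun u => amul (amul (ext_in O (S c1)) u) (ext_in O c2))
  (F := fun e1 u => amul (amul (SO e1) u) z2)); last 3 first.
- by lin.
- by lin.
- move=> n v hv; rewrite -[n]addn0; apply: (ext_mul_degree hE) (homog_in hE c2).
  exact: (ext_mul_degree hE (homog_in hE _) hv).
rewrite -(koszul_comp_l gO gO gO (g := amul (ext_in O c1))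
  (F := fun e u => amul (amul (SO e) u) (amul (ext_in O c2) z2))); last 3 first.
- by lin.
- by lin.
- by move=> n v hv; exact: (ext_mul_degree hE (homog_in hE c1) hv).
apply: eq_koszul => z1' v; rewrite (SO_mul_in hO hS hSO) (SO_in hO hS hSO).
by rewrite !(alg_assoc hAlg).
Qed.

(** Between [u] and [v] there is [c2 * S c3], which is a counit. *)
Lemma mul_adact_in u v c : adact (amul u v) (ext_in O c) =
  \tsum_(c1, c2 <- cop c) amul (adact u (ext_in O c1)) (adact v (ext_in O c2)).
Proof.
pose F c1 c2 c3 c4 :=
  amul (amul (amul (ext_in O (S c1)) u) (amul (ext_in O c2) (ext_in O (S c3))))
  (amul v (ext_in O c4)).
have E c1 c2 : amul (adact u (ext_in O c1)) (adact v (ext_in O c2)) =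
    \tsum_(x1, x2 <- cop c1) \tsum_(x3, x4 <- cop c2) F x1 x2 x3 x4.
  rewrite !adact_in (lin_out _ _ (lin_amul_l hAlg _)); apply: eq_tsum => x1 x2.
  rewrite (lin_out _ _ (lin_amul_r hAlg _)); apply: eq_tsum => x3 x4.
  by rewrite /F !(alg_assoc hAlg).
under [RHS]eq_tsum => c1 c2 do rewrite E.
rewrite (cop_assoc_mid hCA (F := F)); last 4 first.
- by rewrite /F; lin.
- by rewrite /F; lin.
- by rewrite /F; lin.
- by rewrite /F; lin.
rewrite adact_in; apply: eq_tsum => x1 r.
have E2 s x4 : \tsum_(x2, x3 <- cop s) F x1 x2 x3 x4 =
    eps s *: amul (amul (ext_in O (S x1)) u) (amul v (ext_in O x4)).
  have hl : lin (fun y => amul (amul (amul (ext_in O (S x1)) u) (ext_in O y))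
    (amul v (ext_in O x4))) by lin.
  rewrite -[X in _ *: amul X _](alg_one_r hAlg) -(ext_in_one hE) -(linZ _ _ hl).
  rewrite -(antip_r hS) (lin_out _ _ hl); apply: eq_tsum => x2 x3.
  by rewrite /F -(ext_in_mul hE).
under eq_tsum => s x4 do rewrite E2.
rewrite (counit_l hCA (f := fun x4 => amul (amul (ext_in O (S x1)) u) (amul v (ext_in O x4)))).
  by rewrite !(alg_assoc hAlg).
by lin.
Qed.

(** The exchange relation of the two actions. As [ract s] is multiplicative, it acts on all
    three factors of [S c1 * v * c2]; its effect on the outer two is [R] with a leg of
    [c], as in the action [act2] on [s]. *)
Lemma ract_adact_in s v c : ract s (adact v (ext_in O c)) =
  \tsum_(c123, c4 <- cop c) \tsum_(c1, c23 <- cop c123)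
  \tsum_(s12, s3 <- cop s) \tsum_(s1, s2 <- cop s12)
    R (S c1) s1 *: (R c4 s3 *: adact (ract s2 v) (ext_in O c23)).
Proof.
pose F c1 c2 c3 c4 := \tsum_(s12, s3 <- cop s) \tsum_(s1, s2 <- cop s12)
  R (S c1) s1 *: (R c4 s3 *: amul (amul (ext_in O (S c2)) (ract s2 v)) (ext_in O c3)).
transitivity (\tsum_(c12, c34 <- cop c) \tsum_(c1, c2 <- cop c12) \tsum_(c3, c4 <- cop c34)
    F c1 c2 c3 c4); last first.
  rewrite -(cop_assoc_pairs hCA (F := F)); last 4 first.
  - by rewrite /F; lin.
  - by rewrite /F; lin.
  - by rewrite /F; lin.
  - by rewrite /F; lin.
  apply: eq_tsum => c123 c4; apply: eq_tsum => c1 c23.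
  rewrite /F tsum_exch; apply: eq_tsum => s12 s3; rewrite tsum_exch; apply: eq_tsum => s1 s2.
  by rewrite adact_in !tsumZ.
rewrite adact_in (lin_out _ _ (proj2 bract s)); apply: eq_tsum => c12 c34.
rewrite mul_ract.
have E s3 : ract s3 (ext_in O c34) = \tsum_(c3, c4 <- cop c34) R c4 s3 *: ext_in O c3.
  exact: ract_in.
have E1 s1 : ract s1 (ext_in O (S c12)) = \tsum_(c1, c2 <- cop c12) R (S c1) s1 *: ext_in O (S c2).
  by rewrite ract_in (cop_S hR hS (F := fun b1 b2 => R b2 s1 *: ext_in O b1)); last by lin.
rewrite /F.
transitivity (\tsum_(s12, s3 <- cop s) \tsum_(s1, s2 <- cop s12)
  \tsum_(c1, c2 <- cop c12) \tsum_(c3, c4 <- cop c34)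
  R (S c1) s1 *: (R c4 s3 *: amul (amul (ext_in O (S c2)) (ract s2 v)) (ext_in O c3))).
  apply: eq_tsum => s12 s3; rewrite mul_ract (lin_out _ _ (lin_amul_l hAlg _)).
  apply: eq_tsum => s1 s2; rewrite E1.
  have hl : lin (fun x => amul (amul x (ract s2 v)) (ract s3 (ext_in O c34))) by lin.
  rewrite (lin_out _ _ hl); apply: eq_tsum => c1 c2; rewrite (linZ _ _ hl) E tsumZ.
  rewrite (lin_out _ _ (lin_amul_r hAlg _)); congr (_ *: _); apply: eq_tsum => c3 c4.
  by rewrite amulZr.
transitivity (\tsum_(s12, s3 <- cop s) \tsum_(c1, c2 <- cop c12) \tsum_(c3, c4 <- cop c34)
  \tsum_(s1, s2 <- cop s12)
  R (S c1) s1 *: (R c4 s3 *: amul (amul (ext_in O (S c2)) (ract s2 v)) (ext_in O c3))).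
  apply: eq_tsum => s12 s3; rewrite [LHS]tsum_exch; apply: eq_tsum => c1 c2.
  by rewrite [LHS]tsum_exch.
rewrite [LHS]tsum_exch; apply: eq_tsum => c1 c2.
by rewrite [LHS]tsum_exch.
Qed.

Lemma eact_degree m n v x : homog p m v -> homog pV n x -> homog p (m + n) (eact v x).
Proof.
move=> hv; move: x; apply: (homog_tens_ind gO' gO) => [x y hx hy||i j w e <- hw he].
- by rewrite (linD _ _ (proj2 beact _)); exact: homogD.
- by rewrite (lin0 (proj2 beact _)); exact: homog0.
rewrite eact_tens; case: i hw => [|i] hw.
  exact: adact_homog (ract_homog _ hv) he.
rewrite (res_homog hE' hw) (lin0 (proj1 bract _)) (lin0 (proj1 badact _)).
exact: homog0.
Qed.

(** In positive degree of [w] all terms vanish, also the one with [d w], whose degree is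
    never zero. *)
Lemma eact_d n v x : homog p n v ->
  ext_d O (eact v x) = eact (ext_d O v) x + (-1) ^+ n *: eact v (dV x).
Proof.
have hd := lin_d hE; have hdV := lin_dV; have [al ar] := beact.
move=> hv; move: x; apply: (tens_homog_ext gO' gO) => [||i j w e hw he]; [by lin|by lin|].
rewrite (dV_tens _ hw) (linD _ _ (ar _)) (linZ _ _ (ar _)) !eact_tens (res_d hE').
rewrite (lin0 (proj1 bract _)) (lin0 (proj1 badact _)) add0r.
case: i hw => [|i] hw; first by rewrite scale1r (adact_d _ (ract_homog _ hv)) ract_d.
rewrite (res_homog hE' hw) !(lin0 (proj1 bract _)) !(lin0 (proj1 badact _)).
by rewrite !scaler0 addr0 (lin0 hd).
Qed.

(** [ract] is an action by [R_mul_r]. *)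
Lemma eact_left v a y :
  eact v (bmul (ext_in O' a \ox aone O) y) = eact (eact v (ext_in O' a \ox aone O)) y.
Proof.
have [bl br] := bbmul; have [al ar] := beact.
move: y; apply: tens_ext => [||t z]; [by lin|by lin|].
by rewrite mul_left !eact_tens (res_mul hE') ract_mul adact_one.
Qed.

(** The product of [1 \ox c] and [t \ox z] involves [act2], as in [ract_adact_in]. *)
Lemma eact_right v c y :
  eact v (bmul (aone O' \ox ext_in O c) y) = eact (eact v (aone O' \ox ext_in O c)) y.
Proof.
have [bl br] := bbmul; have [al ar] := beact.
have bla := bilin_la hR hS hO'; have bra := bilin_ra hR hO'.
move: y; apply: tens_ext => [||t z]; [by lin|by lin|].
rewrite mul_right_in (lin_out _ _ (ar _)) !eact_tens (res_one hE') ract_one.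
rewrite ract_adact_in (lin_out _ _ (proj1 badact z)); apply: eq_tsum => c123 c4.
rewrite (lin_out _ _ (ar _)) (lin_out _ _ (proj1 badact z)); apply: eq_tsum => c1 c23.
rewrite eact_tens adact_mul_in.
have hl : lin (fun s => adact (adact (ract s v) (ext_in O c23)) z) by lin.
rewrite [RHS](lin_out _ _ (proj1 badact z)) /act2 (res_la S hR hO') (res_ra hR hO').
have hl2 : lin (fun q => \tsum_(t1, t2 <- cop q) R (S c1) t1 *: t2) by lin.
rewrite (lin_out _ _ hl2) (lin_out _ _ hl); apply: eq_tsum => s12 s3.
rewrite (linZ _ _ hl2) (linZ _ _ hl) (lin_out _ _ hl) [RHS](lin_out _ _ (proj1 badact z)) -tsumZ.
apply: eq_tsum => s1 s2; rewrite (linZ _ _ hl) !(linZ _ _ (proj1 badact z)).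
by rewrite !scalerA mulrC.
Qed.

Lemma eact_mul v x y : eact v (bmul x y) = eact (eact v x) y.
Proof.
have [bl br] := bbmul; have [al ar] := beact.
move: x v y; apply: (@act_mul_from_base k _ (ebowtie R S O' SO) ebowtie_exterior _ _ hE eact
  beact eact_degree eact_d) => b v y /=.
move: b; apply: tens_ext => [||a c]; [by lin|by lin|].
by rewrite in2_tens tens_mul -ebowtie_mulA !eact_left eact_right.
Qed.

Lemma eact_modalg x v w : eact (amul v w) x =
  \tsum_(x1, x2 <- copV x)
    koszul p pV (fun w x1 => amul (eact v x1) (eact w x2)) w x1.
Proof.
have [bl br] := bbmul; have [al ar] := beact.
move: x v w; apply: (@modalg_from_base k _ (ebowtie R S O' SO) ebowtie_exterior _ _ hE eact
  beact eact_degree eact_d ebowtie_coalgebra (fun x v y => eact_mul v x y) copV_in copV_d copV_mul) => b v w /=.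
move: b; apply: tens_ext => [||a c].
- by lin.
- by rewrite /bowtie_cop; lin.
rewrite /bowtie_cop tsum_pure; last by lin.
rewrite tsum_tsum; last by lin.
rewrite in2_tens eact_tens (ext_res_in hE') mul_ract (lin_out _ _ (proj1 badact _)).
apply: eq_tsum => a1 a2; rewrite mul_adact_in tsum_tsum; last by lin.
apply: eq_tsum => c1 c2; rewrite tsum_pure; last by lin.
by rewrite !in2_tens !eact_tens !(ext_res_in hE').
Qed.

Lemma eact_one v : eact v (aone O' \ox aone O) = v.
Proof. by rewrite eact_tens (res_one hE') ract_one adact_one. Qed.

Lemma one_eact x : eact (aone O) x = epsV x *: aone O.
Proof.
have [al ar] := beact.
move: x; apply: tens_ext => [||w e]; [by lin|by lin|].
rewrite eact_tens one_ract (linZ _ _ (proj1 badact _)) one_adact epsV_tens.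
by rewrite scalerA (eps_res hO').
Qed.

Lemma ebowtie_super_module_algebra :
  is_super_module_algebra (eh_bialg (ebowtie R S O' SO)) O pV p eact.
Proof.
split=> /=.
- by apply/bilin_for; exact: beact.
- by move=> b c v a; exact: (parity_bilin gO gV gO beact eact_degree).
- exact: eact_one.
- by move=> v a b; exact: eact_mul.
- exact: one_eact.
- by move=> v w a; exact: eact_modalg.
Qed.

Lemma eact_in b x : eact (ext_in O b) (in2 x) = ext_in O (@bowtie_act k A R S b x).
Proof.
have [al ar] := beact; have hi := lin_in hE.
have hb : bilin (fun x1 x2 : A => \tsum_(a1, a2 <- cop b) \tsum_(c1, c2 <- cop x2)
    R a2 x1 *: amul (amul (S c1) a1) c2) by lin.
have hl : lin (fun x => ext_in O (@bowtie_act k A R S b x)).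
  by apply: (lin_comp hi); exact: (lin_tsum hb).
move: x; apply: tens_ext => [||a c]; [by lin|exact: hl|].
rewrite in2_tens eact_tens (ext_res_in hE') ract_in (lin_out _ _ (proj1 badact _)).
rewrite /bowtie_act tsum_pure // (lin_out _ _ hi); apply: eq_tsum => b1 b2.
rewrite (linZ _ _ (proj1 badact _)) adact_in (lin_out _ _ hi) -tsumZ.
by apply: eq_tsum => c1 c2; rewrite (linZ _ _ hi) !(ext_in_mul hE).
Qed.

(** * Conclusion *)

Lemma epsV_in b : epsV (in2 b) = @bowtie_eps k A b.
Proof.
have hb : bilin (fun a b : A => eps a * eps b : k^o) by split=> *; lin.
move: b; apply: (tens_ext (U := k^o)) => [||a c].
- by lin.
- exact: (lin_tsum hb).
by rewrite in2_tens epsV_tens (eps_in hO) (eps_in hO') /bowtie_eps (tsum_pure (U :=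
  k^o) _ _ hb).
Qed.

Lemma ebowtie_strongly_bicovariant : is_strongly_bicovariant (ebowtie R S O' SO).
Proof.
have [SO' hSO'] := proj2 (sb_super_hopf hO').
have hanti := ebowtie_super_antipode hSO'.
split.
- apply: (degree0_hopf ebowtie_exterior ebowtie_super_bialgebra copV_in epsV_in).
  by exists (ebowtie_antipode SO'); exact: (proj1 hanti).
- exact: ebowtie_exterior.
- by split; [exact: ebowtie_super_bialgebra|exists (ebowtie_antipode SO')].
- exact: copV_degree.
- exact: copV_in.
- exact: copV_d.
Qed.

Lemma ebowtie_differentiable :
  differentiable_by (ebowtie R S O' SO) O (bowtie_act R S) (ebowtie_act R S SO).
Proof.
split.
- exact: ebowtie_strongly_bicovariant.
- exact: hE.
- exact: (degree0_module_algebra ebowtie_exterior copV_in epsV_in hE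
    ebowtie_super_module_algebra eact_in).
- exact: eact_in.
- exact: eact_degree.
- exact: ebowtie_super_module_algebra.
- exact: eact_d.
Qed.

End DoubleCross.

Theorem corollary3p8 (k : fieldType) (A : bialgOps k) (S : A -> A)
    (R : A -> A -> k) (O' O : extHopfOps A) (SO : O -> O) :
  is_coquasitriangular A R ->
  is_antipode A S ->
  is_strongly_bicovariant O' ->
  is_strongly_bicovariant O ->
  is_super_antipode (eh_bialg O) (ext_pr O) SO ->
  is_strongly_bicovariant (ebowtie R S O' SO) /\
  differentiable_by (ebowtie R S O' SO) O
    (bowtie_act R S) (ebowtie_act R S SO).
Proof.
move=> hR hS hO' hO hSO; split.
- exact: (ebowtie_strongly_bicovariant hR hS hO' hO hSO).
- exact: (ebowtie_differentiable hR hS hO' hO hSO).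
Qed.
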